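(* Let $K$ be an algebraically closed field and let $K\Delta$ be the incidence algebra of a finite poset $\Delta$ with connected Hasse quiver. If $K\Delta$ is piecewise hereditary, then the strong global dimension of $K\Delta$ is at most $3$.
   Context: All algebras are finite dimensional basic associative $K$-algebras; modules are finite dimensional right modules; $D^b$ denotes the bounded derived category. Incidence algebra: for a finite poset $(\Delta,\preceq)$, the Hasse quiver $Q$ has the elements of $\Delta$ as vertices, and there is one arrow $a\to b$ whenever $a\preceq b$, $a\ne b$, and there is no $c\neq a,b$ with $a\preceq c\preceq b$. Then $K\Delta=KQ/I$, where $I$ is the ideal generated by all differences $\gamma-\gamma'$ of parallel paths. Piecewise hereditary: an abelian $K$-category $\mathcal{H}$ is hereditary if $\operatorname{Ext}^n_{\mathcal H}(X,Y)=0$ for all objects $X,Y$ and all $n\ge 2$. An object $T\in\mathcal H$ is tilting if $\operatorname{Ext}^1_{\mathcal H}(T,T)=0$ and $\operatorname{Hom}_{\mathcal H}(T,X)=0=\operatorname{Ext}^1_{\mathcal H}(T,X)$ implies $X=0$. All hereditary categories considered have split idempotents, finite dimensional Hom spaces and a tilting object. An algebra $A$ is piecewise hereditary if $D^b(\operatorname{mod}A)$ is triangle equivalent to $D^b(\mathcal H)$ for such a hereditary abelian category $\mathcal H$. Strong global dimension of an algebra $A$: let $\mathcal P_A$ be the category of finite dimensional projective $A$-modules and $K^b(\mathcal P_A)$ the bounded homotopy category. A bounded complex $P=(P^i,d^i)$ of projectives is radical if the image of each differential $d^i:P^i\to P^{i+1}$ lies in the radical of $P^{i+1}$; every object of $K^b(\mathcal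 P_A)$ is isomorphic to a radical complex, unique up to isomorphism of complexes. For a nonzero object $P$, represented by a radical complex, let $r\le s$ be such that $P^i=0$ for $i<r$ and for $i>s$, with $P^r\neq0\neq P^s$; the length of $P$ is $\operatorname{l}(P)=s-r$. The strong global dimension of $A$ is $\sup\{\operatorname{l}(P) : P\in K^b(\mathcal P_A)\text{ indecomposable}\}$. *)

(* Defs.v *)
From HB Require Import structures.
From mathcomp Require Import all_boot all_order all_algebra.
From mathcomp Require Import zify boolp.

Set Implicit Arguments.
Unset Strict Implicit.
Unset Printing Implicit Defensive.

Import Order.TTheory GRing.Theory.
Local Open Scope ring_scope.
Local Open Scope quotient_scope.

Definition hasse d (D : finPOrderType d) : rel D :=
  fun a b => (a < b)%O && [forall c : D, ~~ ((a < c)%O && (c < b)%O)].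

Definition hasse_connected d (D : finPOrderType d) : Prop :=
  forall a b : D, connect (fun x y => hasse x y || hasse y x) a b.

Section HassePaths.
Context {d : Order.disp_t} {D : finPOrderType d}.

(* A path is its source together with the list of the subsequent vertices:
   there is at most one arrow between two vertices. *)
Record hpath := HPath {
  hverts : D * seq D;
  _ : path (@hasse d D) hverts.1 hverts.2 }.

HB.instance Definition _ := [isSub for hverts].
HB.instance Definition _ := [Countable of hpath by <:].

Definition hsrc (p : hpath) : D := (hverts p).1.
Definition htgt (p : hpath) : D := last (hverts p).1 (hverts p).2.
Definition htriv (x : D) : hpath := @HPath (x, [::]) isT.

(* p followed by q *)
Definition hcomp (p q : hpath) : option hpath :=
  if htgt p == hsrc q then insub (hsrc p, (hverts p).2 ++ (hverts q).2)
  else None.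

Definition hparallel (p q : hpath) : bool :=
  (hsrc p == hsrc q) && (htgt p == htgt q).

Lemma hpath_lt (p : hpath) : path (fun a b : D => a < b)%O (hsrc p) (hverts p).2.
Proof.
case: p => [[x s] /= h]; apply: sub_path h => a b; by case/andP.
Qed.

Lemma hpath_size (p : hpath) : (size (hverts p).2 < #|D|)%N.
Proof.
have u : uniq (hsrc p :: (hverts p).2).
  apply: (@sorted_uniq _ (fun a b : D => a < b)%O).
  - exact: lt_trans.
  - exact: ltxx.
  - exact: hpath_lt.
by rewrite -[X in (X < _)%N]/((size (hsrc p :: (hverts p).2)).-1) prednK //
           -(card_uniqP u) max_card.
Qed.

Definition hpath_bseq (p : hpath) : D * #|D|.-bseq D :=
  ((hverts p).1, Bseq (ltnW (hpath_size p))).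
Definition bseq_hpath (u : D * #|D|.-bseq D) : option hpath :=
  insub (u.1, bseqval u.2).

Lemma hpath_bseqK : pcancel hpath_bseq bseq_hpath.
Proof. by move=> p; rewrite /bseq_hpath /= -surjective_pairing valK. Qed.

HB.instance Definition _ := isFinite.Build hpath (pcan_enumP hpath_bseqK).

Lemma hcompE p q r : (hcomp p q == Some r) =
  (htgt p == hsrc q) && ((hsrc p, (hverts p).2 ++ (hverts q).2) == hverts r).
Proof.
rewrite /hcomp; case: (htgt p =P hsrc q) => //= e.
have h : path (@hasse d D) (hsrc p) ((hverts p).2 ++ (hverts q).2).
  rewrite cat_path (valP p) /= -[last _ _]/(htgt p) e; exact: (valP q).
case: insubP => [u _ <- // | ]; last by rewrite h.
Qed.

Lemma hcompP p q r : hcomp p q = Some r ->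
  [/\ hsrc p = hsrc r, htgt r = htgt q, htgt p = hsrc q &
      (hverts r).2 = (hverts p).2 ++ (hverts q).2].
Proof.
move/eqP; rewrite hcompE => /andP[/eqP e /eqP f].
split=> //; rewrite /htgt /hsrc -f //= last_cat.
by move: e; rewrite /htgt /hsrc => ->.
Qed.

Lemma hcomp_src p q r : hcomp p q = Some r -> hsrc p = hsrc r.
Proof. by case/hcompP. Qed.
Lemma hcomp_tgt p q r : hcomp p q = Some r -> htgt r = htgt q.
Proof. by case/hcompP. Qed.

Lemma hcomp_some p q : htgt p = hsrc q -> exists r, hcomp p q = Some r.
Proof.
move=> e.
have h : path (@hasse d D) (hsrc p) ((hverts p).2 ++ (hverts q).2).
  rewrite cat_path (valP p) /= -[last _ _]/(htgt p) e; exact: (valP q).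
exists (@HPath (hsrc p, (hverts p).2 ++ (hverts q).2) h).
by apply/eqP; rewrite hcompE e eqxx /=.
Qed.

Lemma hcompA p q r :
  obind (hcomp p) (hcomp q r) = obind (hcomp^~ r) (hcomp p q).
Proof.
case E: (hcomp q r) => [s|] /=; case F: (hcomp p q) => [t|] //=.
- have [e1 e2 e3 e4] := hcompP E; have [f1 f2 f3 f4] := hcompP F.
  have [u gu] : exists r, hcomp p s = Some r by apply: hcomp_some; rewrite -e1.
  rewrite gu; apply/esym/eqP; rewrite hcompE f2 e3 eqxx /=.
  have [g1 g2 g3 g4] := hcompP gu.
  by rewrite f4 -catA -e4 -g4 -f1 g1 /hsrc -surjective_pairing.
- case G: (hcomp p s) => [u|] //=.
  have [e1 e2 e3 e4] := hcompP E; have [f1 f2 f3 f4] := hcompP G.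
  have : htgt p = hsrc q by rewrite f3 -e1.
  by case/hcomp_some=> v; rewrite F.
- case G: (hcomp t r) => [u|] //=.
  have [e1 e2 e3 e4] := hcompP F; have [f1 f2 f3 f4] := hcompP G.
  have : htgt q = hsrc r by rewrite -e2.
  by case/hcomp_some=> v; rewrite E.
Qed.

Lemma htriv_eq p : (hverts p).2 = [::] -> p = htriv (hsrc p).
Proof.
by move=> h; apply: val_inj => /=; rewrite -h /hsrc -surjective_pairing.
Qed.

Lemma htriv_inj x y : (htriv x == htriv y) = (x == y).
Proof. by rewrite -val_eqE /= xpair_eqE eqxx andbT. Qed.

Lemma hcomp_trivl p q r : (hverts p).2 = [::] ->
  (hcomp p q == Some r) = (p == htriv (hsrc q)) && (q == r).
Proof.
move=> h; rewrite hcompE h (htriv_eq h) htriv_inj /htgt /hsrc /= -[q == r]val_eqE.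
by case: eqP => //= ->; rewrite -surjective_pairing.
Qed.

Lemma hcomp_trivr p q r : (hverts q).2 = [::] ->
  (hcomp p q == Some r) = (q == htriv (htgt p)) && (p == r).
Proof.
move=> h; rewrite hcompE h cats0 -surjective_pairing (htriv_eq h) htriv_inj.
by rewrite [hsrc (htriv _)]/hsrc /= eq_sym -[p == r]val_eqE.
Qed.

End HassePaths.
Arguments hpath {d} D.

Section PathAlgebra.
Variables (K : fieldType) (d : Order.disp_t) (D : finPOrderType d).

Definition path_algebra := {ffun hpath D -> K}.
HB.instance Definition _ := GRing.Zmodule.on path_algebra.

Definition pscale (a : K) (f : path_algebra) : path_algebra :=
  [ffun p => a * f p].

Lemma pscaleA a b f : pscale a (pscale b f) = pscale (a * b) f.
Proof. by apply/ffunP => p; rewrite !ffunE mulrA. Qed.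
Lemma pscale1 : left_id 1 pscale.
Proof. by move=> f; apply/ffunP => p; rewrite !ffunE mul1r. Qed.
Lemma pscaleDr : right_distributive pscale +%R.
Proof. by move=> a f g; apply/ffunP => p; rewrite !ffunE mulrDr. Qed.
Lemma pscaleDl f : {morph pscale^~ f : a b / a + b}.
Proof. by move=> a b; apply/ffunP => p; rewrite !ffunE mulrDl. Qed.

HB.instance Definition _ := GRing.Zmodule_isLmodule.Build K path_algebra
  pscaleA pscale1 pscaleDr pscaleDl.

Definition pbasis (p : hpath D) : path_algebra := [ffun q => (q == p)%:R].

(* Bilinear extension of concatenation; non-composable paths multiply to 0 *)
Definition pmul (f g : path_algebra) : path_algebra :=
  [ffun r => \sum_p \sum_(q | hcomp p q == Some r) f p * g q].
Definition pone : path_algebra := \sum_(x : D) pbasis (htriv x).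

Lemma pmulE f g r :
  pmul f g r = \sum_p \sum_q (hcomp p q == Some r)%:R * (f p * g q).
Proof.
rewrite ffunE; apply: eq_bigr => p _; rewrite big_mkcond /=.
by apply: eq_bigr => q _; case: ifP => _; rewrite ?mul1r ?mul0r.
Qed.

Lemma ponE r : pone r = ((hverts r).2 == [::])%:R.
Proof.
rewrite /pone sum_ffunE; under eq_bigr do rewrite ffunE.
rewrite (bigD1 (hsrc r)) //= big1 ?addr0; last first.
  move=> x ne; case: eqP => // e; move: ne; rewrite e /hsrc /= eqxx //.
congr (_%:R); rewrite -val_eqE /= /hsrc; case: (hverts r) => x s /=.
by rewrite xpair_eqE eqxx.
Qed.

Lemma sum_obind (o : option (hpath D)) (h : hpath D -> option (hpath D)) r :
  \sum_s (o == Some s)%:R * (h s == Some r)%:R = (obind h o == Some r)%:R :> K.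
Proof.
case: o => [t|] /=; last by rewrite big1 // => s _; rewrite mul0r.
rewrite (bigD1 t) //= eqxx mul1r big1 ?addr0 // => s ne.
by rewrite [Some t == _](_ : _ = false) ?mul0r //; apply/eqP => -[e]; rewrite e eqxx in ne.
Qed.

Lemma pmulA : associative pmul.
Proof.
move=> f g h; apply/ffunP => r.
transitivity (\sum_p \sum_q \sum_t (obind (hcomp p) (hcomp q t) == Some r)%:R
     * (f p * (g q * h t))).
  rewrite pmulE; apply: eq_bigr => p _.
  under eq_bigr => s _ do rewrite pmulE !mulr_sumr.
  rewrite exchange_big /=; apply: eq_bigr => q _.
  under eq_bigr => s _ do rewrite !mulr_sumr.
  rewrite exchange_big /=; apply: eq_bigr => t _.
  rewrite -sum_obind mulr_suml; apply: eq_bigr => s _.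
  by rewrite [f p * _]mulrCA [LHS]mulrCA mulrA.
rewrite pmulE.
under [RHS]eq_bigr => s _ do
  (under eq_bigr => t _ do rewrite pmulE mulr_suml mulr_sumr).
under [RHS]eq_bigr => s _ do rewrite exchange_big /=.
rewrite [RHS]exchange_big /=; apply: eq_bigr => p _.
under [RHS]eq_bigr => s _ do
  (under eq_bigr => t _ do rewrite mulr_suml mulr_sumr).
under [RHS]eq_bigr => s _ do rewrite exchange_big /=.
rewrite [RHS]exchange_big /=; apply: eq_bigr => q _.
rewrite [RHS]exchange_big /=; apply: eq_bigr => t _.
rewrite hcompA -sum_obind mulr_suml; apply: eq_bigr => s _.
by rewrite -!mulrA [RHS]mulrCA.
Qed.

Lemma pmul1 : left_id pone pmul.
Proof.
move=> f; apply/ffunP => r; rewrite pmulE exchange_big /= (bigD1 r) //=.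
rewrite (bigD1 (htriv (hsrc r))) //= ponE hcomp_trivl // !eqxx !mul1r.
rewrite big1 ?addr0 => [|p ne]; last first.
  rewrite ponE; case: ((hverts p).2 =P [::]) => [e|_]; last by rewrite ?(mul0r, mulr0).
  by rewrite hcomp_trivl ?e // (negbTE ne) mul0r.
rewrite big1 ?addr0 // => q ne; rewrite big1 // => p _.
rewrite ponE; case: ((hverts p).2 =P [::]) => [e|_]; last by rewrite ?(mul0r, mulr0).
by rewrite hcomp_trivl ?e // (negbTE ne) andbF mul0r.
Qed.

Lemma pmulr1 : right_id pone pmul.
Proof.
move=> f; apply/ffunP => r; rewrite pmulE (bigD1 r) //=.
rewrite (bigD1 (htriv (htgt r))) //= ponE hcomp_trivr // !eqxx !mul1r mulr1.
rewrite big1 ?addr0 => [|q ne]; last first.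
  rewrite ponE; case: ((hverts q).2 =P [::]) => [e|_]; last by rewrite ?(mul0r, mulr0).
  by rewrite hcomp_trivr ?e // (negbTE ne) mul0r.
rewrite big1 ?addr0 // => p ne; rewrite big1 // => q _.
rewrite ponE; case: ((hverts q).2 =P [::]) => [e|_]; last by rewrite ?(mul0r, mulr0).
by rewrite hcomp_trivr ?e // (negbTE ne) andbF mul0r.
Qed.

Lemma pmulDl : left_distributive pmul +%R.
Proof.
move=> f g h; apply/ffunP => r; rewrite [RHS]ffunE !pmulE -big_split /=.
apply: eq_bigr => p _; rewrite -big_split /=; apply: eq_bigr => q _.
by rewrite ffunE mulrDl mulrDr.
Qed.

Lemma pmulDr : right_distributive pmul +%R.
Proof.
move=> f g h; apply/ffunP => r; rewrite [RHS]ffunE !pmulE -big_split /=.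
apply: eq_bigr => p _; rewrite -big_split /=; apply: eq_bigr => q _.
by rewrite ffunE !mulrDr.
Qed.

HB.instance Definition _ := GRing.Zmodule_isPzRing.Build path_algebra
  pmulA pmul1 pmulr1 pmulDl pmulDr.

Lemma pscaleAl (a : K) (f g : path_algebra) : a *: (f * g) = (a *: f) * g.
Proof.
apply/ffunP => r; rewrite [LHS]ffunE !pmulE mulr_sumr; apply: eq_bigr => p _.
rewrite mulr_sumr; apply: eq_bigr => q _; rewrite ffunE.
by rewrite mulrCA !mulrA.
Qed.

Lemma pscaleAr (a : K) (f g : path_algebra) : a *: (f * g) = f * (a *: g).
Proof.
apply/ffunP => r; rewrite [LHS]ffunE !pmulE mulr_sumr; apply: eq_bigr => p _.
rewrite mulr_sumr; apply: eq_bigr => q _; rewrite ffunE.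
by rewrite mulrCA; congr (_ * _); rewrite mulrCA.
Qed.

(* The two-sided ideal of KQ generated by the differences of parallel paths.
   Closure under opposites follows from [PIMl] with f = -1. *)
Inductive parallel_ideal : path_algebra -> Prop :=
| PIgen p q : hparallel p q -> parallel_ideal (pbasis p - pbasis q)
| PI0 : parallel_ideal 0
| PID f g : parallel_ideal f -> parallel_ideal g -> parallel_ideal (f + g)
| PIMl f g : parallel_ideal g -> parallel_ideal (f * g)
| PIMr f g : parallel_ideal f -> parallel_ideal (f * g).

Definition parallel_pred : {pred path_algebra} :=
  fun f => `[< parallel_ideal f >].

Lemma parallel_predP f : reflect (parallel_ideal f) (f \in parallel_pred).
Proof. exact: asboolP. Qed.

Lemma parallel_closed : zmod_closed parallel_pred.
Proof.
split=> [|f g /parallel_predP hf /parallel_predP hg]; apply/parallel_predP.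
  exact: PI0.
by apply: PID => //; rewrite -mulN1r; apply: PIMl.
Qed.
HB.instance Definition _ :=
  GRing.isZmodClosed.Build path_algebra parallel_pred parallel_closed.

(* The total coefficient of the paths from x to y; it vanishes on the ideal. *)
Definition psum (x y : D) (f : path_algebra) : K :=
  \sum_(p | (hsrc p == x) && (htgt p == y)) f p.

Lemma psumM x y f g : psum x y (f * g) = \sum_z psum x z f * psum z y g.
Proof.
transitivity (\sum_p \sum_q ((hsrc p == x) && (htgt q == y) && (htgt p == hsrc q))%:R * (f p * g q)).
  rewrite /psum; under eq_bigr => r _ do rewrite pmulE.
  rewrite exchange_big; apply: eq_bigr => p _.
  rewrite exchange_big; apply: eq_bigr => q _; rewrite -mulr_suml.
  congr (_ * _); rewrite big_mkcond /=.
  case: (htgt p =P hsrc q) => [e|ne].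
    have [r hr] := hcomp_some e; rewrite (bigD1 r) //= hr eqxx big1 ?addr0.
      rewrite -(hcomp_src hr) (hcomp_tgt hr) andbT; by case: (_ && _).
    move=> s ns; case: ifP => // _; rewrite [Some r == _](_ : _ = false) //.
    by apply/eqP => -[e1]; rewrite e1 eqxx in ns.
  rewrite andbF big1 // => r _; case: ifP => // _.
  by case: eqP => // /hcompP[].
transitivity (\sum_p \sum_q \sum_z (((hsrc p == x) && (htgt p == z)) && ((hsrc q == z) && (htgt q == y)))%:R * (f p * g q)).
  apply: eq_bigr => p _; apply: eq_bigr => q _; rewrite -mulr_suml; congr (_ * _).
  rewrite (bigD1 (htgt p)) //= big1 ?addr0.
    rewrite eqxx andbT [htgt p == hsrc q]eq_sym; congr (_%:R).
    by rewrite -andbA [(htgt q == y) && _]andbC.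
  by move=> z nz; rewrite [htgt p == z]eq_sym (negbTE nz) andbF.
under eq_bigr => p _ do rewrite exchange_big /=.
rewrite exchange_big /=; apply: eq_bigr => z _.
rewrite /psum mulr_suml [RHS]big_mkcond /=; apply: eq_bigr => p _.
case: ifP => _ /=; last by rewrite big1 // => q _; rewrite mul0r.
rewrite mulr_sumr [RHS]big_mkcond; apply: eq_bigr => q _.
by case: ifP => _; rewrite ?mul1r ?mul0r.
Qed.

Lemma psum_basis x y p : psum x y (pbasis p) = ((hsrc p == x) && (htgt p == y))%:R.
Proof.
rewrite /psum; under eq_bigr do rewrite ffunE.
rewrite big_mkcond (bigD1 p) //= eqxx big1 ?addr0; first by case: ifP.
by move=> q /negbTE->; case: ifP.
Qed.

Lemma psum_ideal f : parallel_ideal f -> forall x y, psum x y f = 0.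
Proof.
elim=> {f}.
- move=> p q /andP[/eqP e1 /eqP e2] x y.
  have -> : psum x y (pbasis p - pbasis q) = psum x y (pbasis p) - psum x y (pbasis q).
    rewrite /psum -sumrB; apply: eq_bigr => r _; by rewrite !ffunE.
  by rewrite !psum_basis e1 e2 subrr.
- by move=> x y; rewrite /psum big1 // => p _; rewrite ffunE.
- move=> f g _ hf _ hg x y.
  have -> : psum x y (f + g) = psum x y f + psum x y g.
    rewrite /psum -big_split; apply: eq_bigr => r _; by rewrite !ffunE.
  by rewrite hf hg addr0.
- by move=> f g _ hg x y; rewrite psumM big1 // => z _; rewrite hg mulr0.
- by move=> f g _ hf x y; rewrite psumM big1 // => z _; rewrite hf mul0r.
Qed.

End PathAlgebra.

(* The nonemptiness argument is only there to make 1 <> 0, as algType requires. *)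
Definition incidence_algebra (K : fieldType) d (D : finPOrderType d)
    (_ : (0 < #|D|)%N) : Type :=
  Quotient.quot (@parallel_pred K d D : zmodClosed (path_algebra K D)).

Section IncidenceAlgebra.
Variables (K : fieldType) (d : Order.disp_t) (D : finPOrderType d).
Hypothesis D_gt0 : (0 < #|D|)%N.

Local Notation A := (incidence_algebra K D_gt0).
Local Notation KQ := (path_algebra K D).

HB.instance Definition _ := GRing.Zmodule.on A.
HB.instance Definition _ := EqQuotient.on A.

Definition qpi (f : KQ) : A := \pi_A f.

Lemma qpi_eq f g : (qpi f == qpi g) = (f - g \in @parallel_pred K d D).
Proof. by rewrite /qpi -Quotient.idealrBE. Qed.

Lemma qpiD f g : qpi (f + g) = qpi f + qpi g.
Proof. exact: (Quotient.pi_add (@parallel_pred K d D : zmodClosed KQ)). Qed.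

Lemma qpiK (u : A) : qpi (repr u) = u.
Proof. exact: reprK. Qed.

Lemma repr_qpi f : parallel_ideal (repr (qpi f) - f).
Proof. by apply/parallel_predP; rewrite -qpi_eq qpiK. Qed.

Lemma qpi_sub f g : parallel_ideal (f - g) -> qpi f = qpi g.
Proof. by move=> h; apply/eqP; rewrite qpi_eq; apply/parallel_predP. Qed.

Definition qmul (u v : A) : A := qpi (repr u * repr v).
Definition qscale (a : K) (u : A) : A := qpi (a *: repr u).

Lemma qpiM f g : qpi (f * g) = qmul (qpi f) (qpi g).
Proof.
apply/esym/qpi_sub.
rewrite -[repr _ * _](addrNK (repr (qpi f) * g)) -mulrBr -addrA -mulrBl.
apply: PID; [apply: PIMl | apply: PIMr]; exact: repr_qpi.
Qed.

Lemma qpiZ a f : qpi (a *: f) = qscale a (qpi f).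
Proof.
apply/esym/qpi_sub; rewrite -scalerBr -[_ - _]mul1r pscaleAl.
by apply: PIMl; apply: repr_qpi.
Qed.

Lemma qmulA : associative qmul.
Proof.
by move=> u v w; rewrite -[u]qpiK -[v]qpiK -[w]qpiK -!qpiM mulrA.
Qed.
Lemma qmul1 : left_id (qpi 1) qmul.
Proof. by move=> u; rewrite -[u]qpiK -qpiM mul1r. Qed.
Lemma qmulr1 : right_id (qpi 1) qmul.
Proof. by move=> u; rewrite -[u]qpiK -qpiM mulr1. Qed.
Lemma qmulDl : left_distributive qmul +%R.
Proof.
by move=> u v w; rewrite -[u]qpiK -[v]qpiK -[w]qpiK -qpiD -!qpiM -qpiD mulrDl.
Qed.
Lemma qmulDr : right_distributive qmul +%R.
Proof.
by move=> u v w; rewrite -[u]qpiK -[v]qpiK -[w]qpiK -qpiD -!qpiM -qpiD mulrDr.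
Qed.
Lemma qone_neq0 : qpi 1 != 0.
Proof.
have -> : 0 = qpi 0.
  by apply: (@addrI _ (qpi 0)); rewrite -qpiD !addr0.
rewrite qpi_eq subr0; apply/parallel_predP => /psum_ideal h.
have [x _] : exists x : D, x \in D by apply/card_gt0P.
have /eqP := h x x; rewrite /psum (bigD1 (htriv x)) /= ?eqxx //.
rewrite [X in X + _]ponE /= big1 ?addr0 ?oner_eq0 // => p.
case/andP => /andP[/eqP e _] ne; rewrite ponE; case: eqP => // t.
by rewrite (htriv_eq t) e eqxx in ne.
Qed.
HB.instance Definition _ := GRing.Zmodule_isNzRing.Build A
  qmulA qmul1 qmulr1 qmulDl qmulDr qone_neq0.

Lemma qscaleA a b u : qscale a (qscale b u) = qscale (a * b) u.
Proof. by rewrite -[u]qpiK -!qpiZ scalerA. Qed.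
Lemma qscale1 : left_id 1 qscale.
Proof. by move=> u; rewrite -[u]qpiK -qpiZ scale1r. Qed.
Lemma qscaleDr : right_distributive qscale +%R.
Proof.
by move=> a u v; rewrite -[u]qpiK -[v]qpiK -qpiD -!qpiZ -qpiD scalerDr.
Qed.
Lemma qscaleDl u : {morph qscale^~ u : a b / a + b}.
Proof. by move=> a b; rewrite -[u]qpiK -!qpiZ -qpiD scalerDl. Qed.
HB.instance Definition _ := GRing.Zmodule_isLmodule.Build K A
  qscaleA qscale1 qscaleDr qscaleDl.

Lemma qscaleAl (a : K) (u v : A) : a *: (u * v) = (a *: u) * v.
Proof.
rewrite -[u]qpiK -[v]qpiK.
by rewrite -[LHS]/(qscale a (qmul _ _)) -[RHS]/(qmul (qscale a _) _)
  -qpiM -!qpiZ -qpiM pscaleAl.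
Qed.
Lemma qscaleAr (a : K) (u v : A) : a *: (u * v) = u * (a *: v).
Proof.
rewrite -[u]qpiK -[v]qpiK.
by rewrite -[LHS]/(qscale a (qmul _ _)) -[RHS]/(qmul _ (qscale a _))
  -qpiM -!qpiZ -qpiM pscaleAr.
Qed.
HB.instance Definition _ := GRing.Lmodule_isLalgebra.Build K A qscaleAl.
HB.instance Definition _ := GRing.Lalgebra_isAlgebra.Build K A qscaleAr.

End IncidenceAlgebra.

(* K-linear categories with a zero object.  Composition is written [g \oc f],
   f first. *)
Record kcat (K : fieldType) := KCat {
  kob :> Type;
  khom : kob -> kob -> lmodType K;
  kid : forall X, khom X X;
  kcomp : forall X Y Z, khom Y Z -> khom X Y -> khom X Z;
  kcompA : forall W X Y Z (h : khom Y Z) (g : khom X Y) (f : khom W X),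
    kcomp h (kcomp g f) = kcomp (kcomp h g) f;
  kcomp1f : forall X Y (f : khom X Y), kcomp (kid Y) f = f;
  kcompf1 : forall X Y (f : khom X Y), kcomp f (kid X) = f;
  kcompDl : forall X Y Z (g g' : khom Y Z) (f : khom X Y),
    kcomp (g + g') f = kcomp g f + kcomp g' f;
  kcompDr : forall X Y Z (g : khom Y Z) (f f' : khom X Y),
    kcomp g (f + f') = kcomp g f + kcomp g f';
  kcompZl : forall X Y Z (a : K) (g : khom Y Z) (f : khom X Y),
    kcomp (a *: g) f = a *: kcomp g f;
  kcompZr : forall X Y Z (a : K) (g : khom Y Z) (f : khom X Y),
    kcomp g (a *: f) = a *: kcomp g f;
  kzero : kob;
  kid_zero : kid kzero = 0 }.

Arguments khom {K k}.
Arguments kid {K k}.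
Arguments kcomp {K k X Y Z}.
Arguments kzero {K}.
Notation "g \oc f" := (kcomp g f) (at level 40, left associativity).

Section KCatTheory.
Context {K : fieldType} {C : kcat K}.
Implicit Types X Y Z W : C.

Lemma kcomp0f X Y Z (f : khom X Y) : (0 : khom Y Z) \oc f = 0.
Proof. by rewrite -(scale0r (0 : khom Y Z)) kcompZl scale0r. Qed.
Lemma kcompf0 X Y Z (g : khom Y Z) : g \oc (0 : khom X Y) = 0.
Proof. by rewrite -(scale0r (0 : khom X Y)) kcompZr scale0r. Qed.
Lemma kcompNf X Y Z (g : khom Y Z) (f : khom X Y) : (- g) \oc f = - (g \oc f).
Proof. by rewrite -scaleN1r kcompZl scaleN1r. Qed.
Lemma kcompfN X Y Z (g : khom Y Z) (f : khom X Y) : g \oc (- f) = - (g \oc f).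
Proof. by rewrite -scaleN1r kcompZr scaleN1r. Qed.

Definition is_zero X : Prop := kid X = 0.

Definition is_iso X Y (f : khom X Y) : Prop :=
  exists g : khom Y X, g \oc f = kid X /\ f \oc g = kid Y.

Definition is_mono X Y (f : khom X Y) : Prop :=
  forall W (g h : khom W X), f \oc g = f \oc h -> g = h.

Definition is_epi X Y (f : khom X Y) : Prop :=
  forall W (g h : khom Y W), g \oc f = h \oc f -> g = h.

Definition is_kernel X Y Z (f : khom X Y) (k : khom Z X) : Prop :=
  f \oc k = 0 /\
  forall W (g : khom W X), f \oc g = 0 -> exists! h : khom W Z, k \oc h = g.

Definition is_cokernel X Y Z (f : khom X Y) (c : khom Y Z) : Prop :=
  c \oc f = 0 /\
  forall W (g : khom Y W), g \oc f = 0 -> exists! h : khom Z W, h \oc c = g.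

Definition is_biproduct X Y Z (i1 : khom X Z) (i2 : khom Y Z)
    (p1 : khom Z X) (p2 : khom Z Y) : Prop :=
  [/\ p1 \oc i1 = kid X, p2 \oc i2 = kid Y, p2 \oc i1 = 0, p1 \oc i2 = 0 &
      i1 \oc p1 + i2 \oc p2 = kid Z].

Definition is_projective P : Prop :=
  forall X Y (e : khom X Y) (f : khom P Y), is_epi e ->
    exists g : khom P X, e \oc g = f.

End KCatTheory.

Section KCatProperties.
Context {K : fieldType}.
Variable C : kcat K.

Definition abelian_kcat : Prop :=
  [/\ forall X Y : C, exists Z i1 i2 p1 p2, @is_biproduct K C X Y Z i1 i2 p1 p2,
      forall (X Y : C) (f : khom X Y),
        (exists Z (k : khom Z X), is_kernel f k) /\
        (exists Z (c : khom Y Z), is_cokernel f c),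
      forall (X Y : C) (f : khom X Y), is_mono f ->
        exists Z (g : khom Y Z), is_kernel g f
    & forall (X Y : C) (f : khom X Y), is_epi f ->
        exists Z (g : khom Z X), is_cokernel g f].

Definition hom_finite : Prop := forall X Y : C,
  exists n (e : 'I_n -> khom X Y), forall f : khom X Y,
    exists c : 'I_n -> K, f = \sum_(i < n) c i *: e i.

Definition split_idempotents : Prop :=
  forall (X : C) (e : khom X X), e \oc e = e ->
    exists Y (r : khom X Y) (s : khom Y X), s \oc r = e /\ r \oc s = kid Y.

End KCatProperties.

Definition succz (i : int) : int := i + 1.

(* Bounded cochain complexes.  Writing successive degrees as i, succz i,
   succz (succz i) makes the shift below well-typed without any cast. *)
Record bcx {K : fieldType} (C : kcat K) := BCx {
  cob :> int -> C;
  cdiff : forall i, khom (cob i) (cob (succz i));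
  cdiff2 : forall i, cdiff (succz i) \oc cdiff i = 0;
  cbounded : exists n : nat, forall i : int, (n < `|i|)%N -> is_zero (cob i) }.
Arguments cdiff {K C}.

Record cmap {K : fieldType} {C : kcat K} (X Y : bcx C) := CMap {
  cfun :> forall i, khom (X i) (Y i);
  cfun_diff : forall i, cfun (succz i) \oc cdiff X i = cdiff Y i \oc cfun i }.

Section Complexes.
Context {K : fieldType} {C : kcat K}.
Implicit Types X Y Z : bcx C.

Program Definition cid X : cmap X X := @CMap K C X X (fun i => kid (X i)) _.
Next Obligation. by rewrite kcomp1f kcompf1. Qed.

Program Definition ccomp X Y Z (g : cmap Y Z) (f : cmap X Y) : cmap X Z :=
  @CMap K C X Z (fun i => g i \oc f i) _.
Next Obligation. by rewrite -kcompA cfun_diff kcompA cfun_diff kcompA. Qed.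

Program Definition czero X Y : cmap X Y := @CMap K C X Y (fun i => 0) _.
Next Obligation. by rewrite kcomp0f kcompf0. Qed.

Program Definition cadd X Y (f g : cmap X Y) : cmap X Y :=
  @CMap K C X Y (fun i => f i + g i) _.
Next Obligation. by rewrite kcompDl kcompDr !cfun_diff. Qed.

Program Definition cscale X Y (a : K) (f : cmap X Y) : cmap X Y :=
  @CMap K C X Y (fun i => a *: f i) _.
Next Obligation. by rewrite kcompZl kcompZr cfun_diff. Qed.

Program Definition cshift X : bcx C :=
  @BCx K C (fun i => X (succz i)) (fun i => - cdiff X (succz i)) _ _.
Next Obligation. by rewrite kcompNf kcompfN cdiff2 !oppr0. Qed.
Next Obligation.
have [n hn] := cbounded X; exists n.+1 => i hi; apply: hn.
by move: hi; rewrite /succz; lia.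
Qed.

Program Definition cshiftf X Y (f : cmap X Y) : cmap (cshift X) (cshift Y) :=
  @CMap K C (cshift X) (cshift Y) (fun i => f (succz i)) _.
Next Obligation. by rewrite kcompfN kcompNf cfun_diff. Qed.

Program Definition cstalk (M : C) : bcx C :=
  @BCx K C (fun i => if i == 0 then M else kzero C) (fun i => 0) _ _.
Next Obligation. by rewrite kcompf0. Qed.
Next Obligation. by exists 0%N => i; case: eqP => [-> //|_ _]; exact: kid_zero. Qed.

Definition homotopic X Y (f g : cmap X Y) : Prop :=
  exists h : forall i, khom (X (succz i)) (Y i), forall i,
    f (succz i) - g (succz i) = cdiff Y i \oc h i + h (succz i) \oc cdiff X (succz i).

(* H is the cohomology of X in degree i + 1, presented as the cokernel of the
   map X^i -> Ker d^(i+1) induced by d^i. *)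
Definition is_cohomology X (i : int) (B H : C) (k : khom B (X (succz i)))
    (b : khom (X i) B) (p : khom B H) : Prop :=
  [/\ is_kernel (cdiff X (succz i)) k, k \oc b = cdiff X i & is_cokernel b p].

Definition quasi_iso X Y (f : cmap X Y) : Prop :=
  forall i (B H : C) (k : khom B (X (succz i))) b (p : khom B H)
         (B' H' : C) (k' : khom B' (Y (succz i))) b' (p' : khom B' H'),
    is_cohomology k b p -> is_cohomology k' b' p' ->
    exists (u : khom B B') (v : khom H H'),
      [/\ k' \oc u = f (succz i) \oc k, v \oc p = p' \oc u & is_iso v].

Lemma is_cohomology_shift X i (B H : C) (k : khom B (cshift X (succz i)))
    (b : khom (cshift X i) B) (p : khom B H) :
  is_cohomology k b p ->
  @is_cohomology X (succz i) B H k (- b) p.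
Proof.
case=> [[k0 ku] kb [p0 pu]]; split.
- split; first by apply: oppr_inj; rewrite oppr0 -kcompNf.
  by move=> W g g0; apply: ku; rewrite kcompNf g0 oppr0.
- by rewrite kcompfN kb opprK.
- split; first by rewrite kcompfN p0 oppr0.
  by move=> W g g0; apply: pu; apply: oppr_inj; rewrite -kcompfN g0 oppr0.
Qed.

Lemma quasi_iso_shift X Y (f : cmap X Y) : quasi_iso f -> quasi_iso (cshiftf f).
Proof.
move=> qf i B H k b p B' H' k' b' p' h h'.
exact: qf (is_cohomology_shift h) (is_cohomology_shift h').
Qed.

(* The bounded derived category as the localization of the category of bounded
   complexes at the quasi-isomorphisms (Gabriel-Zisman): a morphism is a formal
   composite of chain maps and formal inverses of quasi-isomorphisms, and two
   of them are identified by the congruence [deq]. *)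
Inductive dmor : bcx C -> bcx C -> Type :=
| dof X Y : cmap X Y -> dmor X Y
| dinv X Y (s : cmap X Y) : quasi_iso s -> dmor Y X
| dcomp X Y Z : dmor Y Z -> dmor X Y -> dmor X Z.

Inductive deq : forall X Y, dmor X Y -> dmor X Y -> Prop :=
| deq_refl X Y (a : dmor X Y) : deq a a
| deq_sym X Y (a b : dmor X Y) : deq a b -> deq b a
| deq_trans X Y (a b c : dmor X Y) : deq a b -> deq b c -> deq a c
| deq_comp X Y Z (b b' : dmor Y Z) (a a' : dmor X Y) :
    deq b b' -> deq a a' -> deq (dcomp b a) (dcomp b' a')
| deq_compA W X Y Z (c : dmor Y Z) (b : dmor X Y) (a : dmor W X) :
    deq (dcomp c (dcomp b a)) (dcomp (dcomp c b) a)
| deq_id_l X Y (a : dmor X Y) : deq (dcomp (dof (cid Y)) a) a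
| deq_id_r X Y (a : dmor X Y) : deq (dcomp a (dof (cid X))) a
| deq_of X Y (f g : cmap X Y) : (forall i, f i = g i) -> deq (dof f) (dof g)
| deq_of_comp X Y Z (g : cmap Y Z) (f : cmap X Y) :
    deq (dof (ccomp g f)) (dcomp (dof g) (dof f))
| deq_inv_l X Y (s : cmap X Y) (qs : quasi_iso s) :
    deq (dcomp (dinv qs) (dof s)) (dof (cid X))
| deq_inv_r X Y (s : cmap X Y) (qs : quasi_iso s) :
    deq (dcomp (dof s) (dinv qs)) (dof (cid Y)).

Fixpoint dshift X Y (a : dmor X Y) : dmor (cshift X) (cshift Y) :=
  match a with
  | dof _ _ f => dof (cshiftf f)
  | dinv _ _ s qs => dinv (quasi_iso_shift qs)
  | dcomp _ _ _ b a => dcomp (dshift b) (dshift a)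
  end.

Definition d_iso X Y (a : dmor X Y) : Prop :=
  exists b : dmor Y X,
    deq (dcomp b a) (dof (cid X)) /\ deq (dcomp a b) (dof (cid Y)).

(* Z is a mapping cone of f, with structure maps u : Y -> Z and v : Z -> X[1]:
   Z^i = X^(i+1) (+) Y^i with differential (x, y) |-> (- d x, f x + d y). *)
Definition is_cone X Y Z (f : cmap X Y) (u : cmap Y Z) (v : cmap Z (cshift X)) :
    Prop :=
  exists (j : forall i, khom (X (succz i)) (Z i)) (q : forall i, khom (Z i) (Y i)),
  forall i, is_biproduct (j i) (u i) (v i) (q i) /\
    cdiff Z i = - (j (succz i) \oc cdiff X (succz i) \oc v i)
                + u (succz i) \oc f (succz i) \oc v i
                + u (succz i) \oc cdiff Y i \oc q i.

Definition distinguished X Y Z (a : dmor X Y) (b : dmor Y Z)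
    (c : dmor Z (cshift X)) : Prop :=
  exists X' Y' Z' (f : cmap X' Y') (u : cmap Y' Z') (v : cmap Z' (cshift X'))
         (x : dmor X X') (y : dmor Y Y') (z : dmor Z Z'),
  is_cone f u v /\ [/\ d_iso x, d_iso y & d_iso z] /\
  [/\ deq (dcomp y a) (dcomp (dof f) x), deq (dcomp z b) (dcomp (dof u) y)
    & deq (dcomp (dshift x) c) (dcomp (dof v) z)].

Definition ext_vanishes (n : nat) (M N : C) : Prop :=
  forall a : dmor (cstalk M) (iter n cshift (cstalk N)), deq a (dof (czero _ _)).

End Complexes.

(* K-linear triangle equivalences D^b(C) -> D^b(C').  Additivity on morphisms
   is automatic for an equivalence, so K-linearity amounts to [te_scale]. *)
Record triangle_equivalence {K : fieldType} (C C' : kcat K) := TriEquiv {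
  te_ob : bcx C -> bcx C';
  te_mor : forall X Y, dmor X Y -> dmor (te_ob X) (te_ob Y);
  te_eq : forall X Y (a b : dmor X Y), deq a b -> deq (te_mor a) (te_mor b);
  te_id : forall X, deq (te_mor (dof (cid X))) (dof (cid (te_ob X)));
  te_comp : forall X Y Z (b : dmor Y Z) (a : dmor X Y),
    deq (te_mor (dcomp b a)) (dcomp (te_mor b) (te_mor a));
  te_scale : forall X (c : K),
    deq (te_mor (dof (cscale c (cid X)))) (dof (cscale c (cid (te_ob X))));
  te_faithful : forall X Y (a b : dmor X Y),
    deq (te_mor a) (te_mor b) -> deq a b;
  te_full : forall X Y (b : dmor (te_ob X) (te_ob Y)),
    exists a : dmor X Y, deq (te_mor a) b;
  te_surj : forall Y, exists X (a : dmor (te_ob X) Y), d_iso a;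
  te_shift : forall X, dmor (te_ob (cshift X)) (cshift (te_ob X));
  te_shift_iso : forall X, d_iso (te_shift X);
  te_shift_nat : forall X Y (a : dmor X Y),
    deq (dcomp (te_shift Y) (te_mor (dshift a)))
        (dcomp (dshift (te_mor a)) (te_shift X));
  te_exact : forall X Y Z (a : dmor X Y) (b : dmor Y Z) (c : dmor Z (cshift X)),
    distinguished a b c ->
    distinguished (te_mor a) (te_mor b) (dcomp (te_shift X) (te_mor c)) }.

Definition hereditary {K : fieldType} (H : kcat K) : Prop :=
  forall (n : nat) (X Y : H), (2 <= n)%N -> ext_vanishes n X Y.

Definition tilting_object {K : fieldType} {H : kcat K} (T : H) : Prop :=
  ext_vanishes 1 T T /\
  forall X : H, (forall f : khom T X, f = 0) -> ext_vanishes 1 T X -> is_zero X.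

Record rmodule {K : fieldType} (A : algType K) := RModule {
  rcar :> vectType K;
  ract : rcar -> A -> rcar;
  ractDl : forall v w a, ract (v + w) a = ract v a + ract w a;
  ractDr : forall v a b, ract v (a + b) = ract v a + ract v b;
  ractZl : forall (c : K) v a, ract (c *: v) a = c *: ract v a;
  ractZr : forall (c : K) v a, ract v (c *: a) = c *: ract v a;
  ractM : forall v a b, ract v (a * b) = ract (ract v a) b;
  ract1 : forall v, ract v 1 = v }.
Arguments ract {K A}.

Section Modules.
Context {K : fieldType} {A : algType K}.
Implicit Types M N : rmodule A.

Definition rlinear M N : {pred 'Hom(M, N)} :=
  fun f => `[< forall v a, f (ract M v a) = ract N (f v) a >].

Record rhom M N := RHom { rhom_val : 'Hom(M, N); _ : rhom_val \in @rlinear M N }.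
HB.instance Definition _ M N := [isSub for @rhom_val M N].
HB.instance Definition _ M N := [Choice of rhom M N by <:].

Lemma ract0 M a : ract M 0 a = 0.
Proof. by have := @ractZl _ _ M 0 0 a; rewrite !scale0r. Qed.

Lemma rlinear_closed M N : GRing.subsemimod_closed (@rlinear M N).
Proof.
split; first split.
- by apply/asboolP => v a; rewrite !zero_lfunE ract0.
- move=> f g /asboolP hf /asboolP hg; apply/asboolP => v a.
  by rewrite !add_lfunE hf hg ractDl.
- move=> c f /asboolP hf; apply/asboolP => v a.
  by rewrite !scale_lfunE hf ractZl.
Qed.

HB.instance Definition _ M N :=
  GRing.SubChoice_isSubLmodule.Build K 'Hom(M, N) (@rlinear M N) (rhom M N)
    (rlinear_closed M N).

Lemma rhomP M N (f : rhom M N) v a :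
  rhom_val f (ract M v a) = ract N (rhom_val f v) a.
Proof. by case: f => f /= /asboolP. Qed.

Lemma rid_subproof M : \1%VF \in @rlinear M M.
Proof. by apply/asboolP => v a; rewrite !lfunE. Qed.
Definition rid M : rhom M M := RHom (rid_subproof M).

Lemma rcomp_subproof M N P (g : rhom N P) (f : rhom M N) :
  (rhom_val g \o rhom_val f)%VF \in @rlinear M P.
Proof. by apply/asboolP => v a; rewrite !lfunE /= !rhomP. Qed.
Definition rcomp M N P (g : rhom N P) (f : rhom M N) : rhom M P :=
  RHom (rcomp_subproof g f).

Program Definition rzero : rmodule A :=
  @RModule K A ('rV[K]_0 : vectType K) (fun v _ => 0) _ _ _ _ _ _.
Next Obligation. by rewrite addr0. Qed.
Next Obligation. by rewrite addr0. Qed.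
Next Obligation. by rewrite scaler0. Qed.
Next Obligation. by rewrite scaler0. Qed.
Next Obligation. by rewrite [v]thinmx0. Qed.

Program Definition mod_kcat : kcat K :=
  @KCat K (rmodule A) (fun M N => rhom M N : lmodType K) rid rcomp
    _ _ _ _ _ _ _ rzero _.
Next Obligation. by apply: val_inj; rewrite /= comp_lfunA. Qed.
Next Obligation. by apply: val_inj; rewrite /= comp_lfun1l. Qed.
Next Obligation. by apply: val_inj; rewrite /= comp_lfun1r. Qed.
Next Obligation. by apply: val_inj; rewrite /= comp_lfunDl. Qed.
Next Obligation. by apply: val_inj; rewrite /= comp_lfunDr. Qed.
Next Obligation. by apply: val_inj; rewrite /= comp_lfunZl. Qed.
Next Obligation. by apply: val_inj; rewrite /= comp_lfunZr. Qed.
Next Obligation. by apply: val_inj; apply/lfunP => v; rewrite [v]thinmx0 !linear0. Qed.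

Definition submodule M (U : {vspace M}) : Prop :=
  forall v a, v \in U -> ract M v a \in U.

Definition maximal_submodule M (U : {vspace M}) : Prop :=
  [/\ submodule U, U <> fullv &
      forall V : {vspace M}, submodule V -> (U <= V)%VS -> V = U \/ V = fullv].

Definition in_radical M (v : M) : Prop :=
  forall U : {vspace M}, maximal_submodule U -> v \in U.

End Modules.
Arguments mod_kcat {K} A.

Definition piecewise_hereditary {K : fieldType} (A : algType K) : Prop :=
  exists H : kcat K,
    [/\ abelian_kcat H, hom_finite H, split_idempotents H & hereditary H] /\
    (exists T : H, tilting_object T) /\
    inhabited (triangle_equivalence (mod_kcat A) H).

Section StrongGlobalDimension.
Context {K : fieldType}.
Variable A : algType K.
Implicit Types P Q : bcx (mod_kcat A).

(* The objects of K^b(P_A); morphisms are chain maps up to [homotopic]. *)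
Definition proj_complex P : Prop := forall i, is_projective (P i).

Definition radical_complex P : Prop :=
  forall i (v : P i), in_radical (rhom_val (cdiff P i) v).

Definition Kb_isomorphic P Q : Prop :=
  exists (f : cmap P Q) (g : cmap Q P),
    homotopic (ccomp g f) (cid P) /\ homotopic (ccomp f g) (cid Q).

Definition Kb_zero P : Prop := homotopic (cid P) (czero P P).

Definition Kb_biproduct P Q R (i1 : cmap P R) (i2 : cmap Q R)
    (p1 : cmap R P) (p2 : cmap R Q) : Prop :=
  [/\ homotopic (ccomp p1 i1) (cid P), homotopic (ccomp p2 i2) (cid Q),
      homotopic (ccomp p2 i1) (czero P Q), homotopic (ccomp p1 i2) (czero Q P) &
      homotopic (cadd (ccomp i1 p1) (ccomp i2 p2)) (cid R)].

Definition Kb_indecomposable R : Prop :=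
  ~ Kb_zero R /\
  forall P Q (i1 : cmap P R) (i2 : cmap Q R) (p1 : cmap R P) (p2 : cmap R Q),
    proj_complex P -> proj_complex Q -> Kb_biproduct i1 i2 p1 p2 ->
    Kb_zero P \/ Kb_zero Q.

Definition Kb_length P (l : nat) : Prop :=
  exists R r s, [/\ proj_complex R, radical_complex R & Kb_isomorphic P R] /\
    [/\ ~ is_zero (R r), ~ is_zero (R s),
        forall i : int, (i < r) || (s < i) -> is_zero (R i) & s = r + l%:Z].

Definition indecomposable_length (l : nat) : Prop :=
  exists P, [/\ proj_complex P, Kb_indecomposable P & Kb_length P l].

(* The supremum of the lengths of the indecomposable objects, [None] standing
   for infinity. *)
Definition is_length_bound (n : nat) : bool :=
  `[< forall l, indecomposable_length l -> (l <= n)%N >].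

Definition strong_global_dimension : option nat :=
  match pselect (exists n, is_length_bound n) with
  | left h => Some (ex_minn h)
  | right _ => None
  end.

End StrongGlobalDimension.

Definition le_ext (d : option nat) (n : nat) : bool :=
  if d is Some m then (m <= n)%N else false.

(* Main.v *)
From HB Require Import structures.
From Stdlib Require Import Setoid Morphisms.
From mathcomp Require Import all_boot all_order all_algebra.
From mathcomp Require Import zify boolp.
Require Import Defs.

(** Let F be a triangle equivalence from D^b(mod A) to D^b(H), with A the incidence
    algebra and H hereditary.  In D^b(H) the lowest cohomology of a complex splits off,
    so F sends an object whose only idempotents are 0 and 1 to a complex with cohomology
    in a single degree; and Hom vanishes from degree p to degree q unless p - q is 0
    or 1.  The constant module M has scalar endomorphisms, hence lives in one degree m,
    and it receives a nonzero map from every indecomposable projective P_x; so the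
    degrees p_x of the F(P_x) lie in {m, m + 1}.  If R is an indecomposable radical
    complex with ends r <= s and F(R) lives in degree n, minimality gives nonzero maps
    P_x[-s] -> R and R -> P_y[-r], whence p_x + s - n and n - p_y - r are 0 or 1 and
    s - r <= 2 + p_y - p_x <= 3.

    Vanishing in the localization is detected by a calculus of left fractions, carried
    out by letting zigzags act on roofs; statements inside an abelian category are
    proved with generalized elements, refined along epimorphisms when needed. *)

Set Implicit Arguments.
Unset Strict Implicit.
Unset Printing Implicit Defensive.

Import Order.TTheory GRing.Theory.
Local Open Scope ring_scope.

(** * Abelian categories *)

Section Preadditive.
Context {K : fieldType} {C : kcat K}.
Implicit Types X Y Z W : C.

(** Indecomposability in K^b(P_A) speaks of decompositions, the splitting argument of idempotents:
    an idempotent up to homotopy is therefore first replaced by a strict one, which splits degree by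
    degree. Morphisms of D^b are formal zigzags modulo a generated congruence, so shift, truncation
    and cohomology are extended to them by induction on zigzags, each time showing that
    quasi-isomorphisms stay quasi-isomorphisms. The vanishing of an Ext^2 is used in the form of a
    homotopy, which corrects a family of maps into a chain map. Only one cohomology object is ever
    split off: for an object with trivial idempotents it is already everything. In the bound 3, one
    unit comes from each end of R, where Hom tolerates a difference of 0 or 1 between degrees, and
    one from the spread of the p_x. Connectedness of the Hasse quiver enters through the scalar
    endomorphisms of M, which tie the p_x of all vertices to one number m. *)

Lemma kcompBl X Y Z (g g' : khom Y Z) (f : khom X Y) :
  (g - g') \oc f = g \oc f - g' \oc f.
Proof. by rewrite kcompDl kcompNf. Qed.

Lemma kcompBr X Y Z (g : khom Y Z) (f f' : khom X Y) :
  g \oc (f - f') = g \oc f - g \oc f'.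
Proof. by rewrite kcompDr kcompfN. Qed.

Lemma is_epiP X Y (f : khom X Y) :
  is_epi f <-> forall Z (g : khom Y Z), g \oc f = 0 -> g = 0.
Proof.
split=> [ef Z g gf|ef Z g h gh]; first by apply: ef; rewrite gf kcomp0f.
by apply/eqP; rewrite -subr_eq0; apply/eqP/ef; rewrite kcompBl gh subrr.
Qed.

Lemma is_monoP X Y (f : khom X Y) :
  is_mono f <-> forall Z (g : khom Z X), f \oc g = 0 -> g = 0.
Proof.
split=> [ef Z g gf|ef Z g h gh]; first by apply: ef; rewrite gf kcompf0.
by apply/eqP; rewrite -subr_eq0; apply/eqP/ef; rewrite kcompBr gh subrr.
Qed.

Lemma is_epi_id X : is_epi (kid X).
Proof. by move=> W g h; rewrite !kcompf1. Qed.

Lemma is_epi_comp X Y Z (g : khom Y Z) (f : khom X Y) :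
  is_epi g -> is_epi f -> is_epi (g \oc f).
Proof. by move=> eg ef W u v; rewrite !kcompA => /ef/eg. Qed.

Lemma is_zero_to X Y (f : khom X Y) : is_zero Y -> f = 0.
Proof. by move=> z; rewrite -(kcomp1f f) z kcomp0f. Qed.

Lemma is_zero_from X Y (f : khom X Y) : is_zero X -> f = 0.
Proof. by move=> z; rewrite -(kcompf1 f) z kcompf0. Qed.

Lemma is_kernel_mono X Y Z (f : khom X Y) (k : khom Z X) :
  is_kernel f k -> is_mono k.
Proof.
move=> [fk uk]; apply/is_monoP => W g kg.
have [h [_ hu]] := uk W 0 ltac:(by rewrite kcompf0).
by rewrite -(hu g kg) -(hu 0) // kcompf0.
Qed.

Lemma is_kernel_lift X Y Z (f : khom X Y) (k : khom Z X) W (g : khom W X) :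
  is_kernel f k -> f \oc g = 0 -> exists h, k \oc h = g.
Proof. by move=> [_ uk] /uk [h [kh _]]; exists h. Qed.

Lemma is_cokernel_epi X Y Z (f : khom X Y) (c : khom Y Z) :
  is_cokernel f c -> is_epi c.
Proof.
move=> [cf uc]; apply/is_epiP => W g gc.
have [h [_ hu]] := uc W 0 ltac:(by rewrite kcomp0f).
by rewrite -(hu g gc) -(hu 0) // kcomp0f.
Qed.

Lemma is_cokernel_desc X Y Z (f : khom X Y) (c : khom Y Z) W (g : khom Y W) :
  is_cokernel f c -> g \oc f = 0 -> exists h, h \oc c = g.
Proof. by move=> [_ uc] /uc [h [hc _]]; exists h. Qed.

Lemma is_iso_mono X Y (f : khom X Y) : is_iso f -> is_mono f.
Proof.
move=> [g [gf _]] W u v fu.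
by rewrite -(kcomp1f u) -(kcomp1f v) -gf -!kcompA fu.
Qed.

Lemma is_iso_epi X Y (f : khom X Y) : is_iso f -> is_epi f.
Proof.
move=> [g [_ fg]] W u v uf.
by rewrite -(kcompf1 u) -(kcompf1 v) -fg !kcompA uf.
Qed.

End Preadditive.

Section Abelian.
Context {K : fieldType} {C : kcat K}.
Hypothesis abC : abelian_kcat C.
Implicit Types X Y Z W : C.

Lemma ex_kernel X Y (f : khom X Y) : exists Z (k : khom Z X), is_kernel f k.
Proof. by case: abC => _ /(_ X Y f) []. Qed.

Lemma ex_cokernel X Y (f : khom X Y) : exists Z (c : khom Y Z), is_cokernel f c.
Proof. by case: abC => _ /(_ X Y f) []. Qed.

Lemma ex_biproduct X Y :
  exists Z i1 i2 p1 p2, @is_biproduct K C X Y Z i1 i2 p1 p2.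
Proof. by case: abC. Qed.

Lemma balanced X Y (f : khom X Y) : is_mono f -> is_epi f -> is_iso f.
Proof.
case: abC => _ _ mk _ mf ef; have [Z [g [gf ug]]] := mk _ _ f mf.
have g0 : g = 0 by move/is_epiP: ef; apply.
have [h [fh _]] := ug _ (kid Y) ltac:(by rewrite g0 kcomp0f).
exists h; split=> //; apply: mf.
by rewrite kcompA fh kcomp1f kcompf1.
Qed.

(** The pullback is the kernel of [d] on the biproduct. If [g] kills [p2 \oc k], then [g \oc p2]
    factors through the epimorphism [d], and restriction to the first summand shows that the factor
    is 0. *)
Lemma epi_pullback X Y W (e : khom X Y) (f : khom W Y) : is_epi e ->
  exists V (e' : khom V W) (f' : khom V X), is_epi e' /\ e \oc f' = f \oc e'.
Proof.
move=> ee; have [B [i1 [i2 [p1 [p2 [p11 p22 p21 p12 bid]]]]]] := ex_biproduct X W.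
pose d := e \oc p1 - f \oc p2.
have di1 : d \oc i1 = e by rewrite kcompBl -!kcompA p11 p21 kcompf1 kcompf0 subr0.
have di2 : d \oc i2 = - f by rewrite kcompBl -!kcompA p12 p22 kcompf1 kcompf0 sub0r.
have ed : is_epi d.
  apply/is_epiP => Z g gd; move/is_epiP: ee; apply.
  by rewrite -di1 kcompA gd kcomp0f.
have [V [k kk]] := ex_kernel d.
have dk : d \oc k = 0 by case: kk.
exists V, (p2 \oc k), (p1 \oc k); split; last first.
  by apply/eqP; rewrite -subr_eq0 !kcompA -kcompBl dk.
apply/is_epiP => Z g gk.
case: abC => _ _ _ /(_ _ _ d ed) [T [t tk]].
have [s ks] : exists s, k \oc s = t by apply: is_kernel_lift kk _; case: tk.
have [h hd] : exists h, h \oc d = g \oc p2.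
  by apply: is_cokernel_desc tk _; rewrite -ks -kcompA [p2 \oc _]kcompA kcompA gk kcomp0f.
have h0 : h = 0.
  by move/is_epiP: ee; apply; rewrite -di1 kcompA hd -kcompA p21 kcompf0.
by rewrite -(kcompf1 g) -p22 kcompA -hd h0 !kcomp0f.
Qed.

Lemma epi_lift X Y W (e : khom X Y) (y : khom W Y) : is_epi e ->
  exists W' (c : khom W' W) x, is_epi c /\ e \oc x = y \oc c.
Proof. exact: epi_pullback. Qed.

(** The image is the kernel of the cokernel. If [h] kills [p], then [m] restricted to the kernel of
    [h] is a monomorphism, hence a kernel of some [w]; as [w] kills [f] it kills [m], so this
    restriction is all of the image and [h] is 0. *)
Lemma ex_image X Y (f : khom X Y) :
  exists I (p : khom X I) (m : khom I Y),
  [/\ is_epi p, is_mono m, m \oc p = f &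
    forall W (y : khom W Y), (forall Z (g : khom Y Z), g \oc f = 0 -> g \oc y = 0) ->
      exists x, m \oc x = y].
Proof.
have [Q [c cc]] := ex_cokernel f; have [I [m mk]] := ex_kernel c.
have cf : c \oc f = 0 by case: cc.
have mm := is_kernel_mono mk.
have [p mp] := is_kernel_lift mk cf.
exists I, p, m; split=> //; last first.
  by move=> W y hy; apply: is_kernel_lift mk _; apply: hy.
apply/is_epiP => Z h hp; have [L [k kk]] := ex_kernel h.
have mK := is_kernel_mono kk.
have [p' kp] := is_kernel_lift kk hp.
have mmk : is_mono (m \oc k) by move=> W u v; rewrite -!kcompA => /mm/mK.
case: abC => _ _ /(_ _ _ _ mmk) [T [w wk]] _.
have wf : w \oc f = 0 by rewrite -mp -kp !kcompA -[w \oc m \oc k]kcompA; case: wk => ->; rewrite kcomp0f.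
have [w' w'c] := is_cokernel_desc cc wf.
have [s ms] : exists s, (m \oc k) \oc s = m.
  by apply: is_kernel_lift wk _; rewrite -w'c -kcompA; case: mk => ->; rewrite kcompf0.
have ks : k \oc s = kid I by apply: mm; rewrite kcompA ms kcompf1.
by rewrite -(kcompf1 h) -ks kcompA; case: kk => ->; rewrite kcomp0f.
Qed.

(** An element killed by the cokernel lies in the image, and lifts along the epimorphism from [X]
    onto it. *)
Lemma coker_lift X Y Z W (f : khom X Y) (c : khom Y Z) (y : khom W Y) :
  is_cokernel f c -> c \oc y = 0 ->
  exists W' (e : khom W' W) x, is_epi e /\ f \oc x = y \oc e.
Proof.
move=> cc cy; have [I [p [m [ep mm mp mI]]]] := ex_image f.
have [y0 my] : exists x, m \oc x = y.
  by apply: mI => T g gf; have [h <-] := is_cokernel_desc cc gf; rewrite -kcompA cy kcompf0.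
have [W' [e [x [ee px]]]] := epi_lift y0 ep.
by exists W', e, x; rewrite -mp -my -kcompA px kcompA.
Qed.

End Abelian.

(** * Cohomology and quasi-isomorphisms *)

Section QuasiIso.
Context {K : fieldType} {C : kcat K}.
Implicit Types X Y Z : bcx C.

(** Rewrites a composite of two maps inside an expression associated to the right. *)
Lemma kra (U V W T : C) (f : khom W T) (g : khom V W) (h : khom V T)
    (x : khom U V) : f \oc g = h -> f \oc (g \oc x) = h \oc x.
Proof. by rewrite kcompA => ->. Qed.

(* Vanishing of the cohomology in degree i + 1, tested on generalized elements. *)
Definition exact_at X i := forall W (x : khom W (X (succz i))),
  cdiff X (succz i) \oc x = 0 ->
  exists W' (e : khom W' W) (y : khom W' (X i)),
    is_epi e /\ cdiff X i \oc y = x \oc e.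

Definition acyclic X := forall i, exact_at X i.

(** [quasi_iso] quantifies over all presentations of the cohomology by kernels and cokernels. This
    condition and [coh_surj_at] mention none, so that chases with generalized elements apply
    directly; [quasi_isoP] compares the two. *)
Definition coh_inj_at X Y (f : cmap X Y) i :=
  forall W (x : khom W (X (succz i))) (y : khom W (Y i)),
  cdiff X (succz i) \oc x = 0 -> f (succz i) \oc x = cdiff Y i \oc y ->
  exists W' (e : khom W' W) (x' : khom W' (X i)),
    is_epi e /\ cdiff X i \oc x' = x \oc e.

Definition coh_surj_at X Y (f : cmap X Y) i :=
  forall W (y : khom W (Y (succz i))), cdiff Y (succz i) \oc y = 0 ->
  exists W' (e : khom W' W) (x : khom W' (X (succz i))) (y' : khom W' (Y i)),
    [/\ is_epi e, cdiff X (succz i) \oc x = 0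
      & f (succz i) \oc x + cdiff Y i \oc y' = y \oc e].

Definition coh_iso X Y (f : cmap X Y) :=
  forall i, coh_inj_at f i /\ coh_surj_at f i.

Lemma coh_iso_comp X Y Z (g : cmap Y Z) (f : cmap X Y) :
  coh_iso g -> coh_iso f -> coh_iso (ccomp g f).
Proof.
move=> qg qf i; split.
- move=> W x z dx /= gfx.
  have [||W1 [e1 [y1 [ee1 dy1]]]] := (qg i).1 W (f (succz i) \oc x) z.
  - by rewrite kcompA -cfun_diff -kcompA dx kcompf0.
  - by rewrite kcompA.
  have [||W2 [e2 [x2 [ee2 dx2]]]] := (qf i).1 W1 (x \oc e1) y1.
  - by rewrite kcompA dx kcomp0f.
  - by rewrite kcompA dy1.
  by exists W2, (e1 \oc e2), x2; split; [exact: is_epi_comp|rewrite kcompA].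
- move=> W z dz; have [W1 [e1 [y1 [z1 [ee1 dy1 Ez]]]]] := (qg i).2 W z dz.
  have [W2 [e2 [x2 [y2 [ee2 dx2 Ey]]]]] := (qf i).2 W1 y1 dy1.
  exists W2, (e1 \oc e2), x2, (g i \oc y2 + z1 \oc e2); split=> //=.
    exact: is_epi_comp.
  rewrite kcompA -Ez !(kcompDl, kcompDr) -!kcompA -Ey !kcompDr (kra _ (cfun_diff g i)).
  by rewrite !kcompA addrA.
Qed.

Lemma coh_iso_cancelr X Y Z (g : cmap Y Z) (f : cmap X Y) :
  coh_iso (ccomp g f) -> coh_iso f -> coh_iso g.
Proof.
move=> qgf qf i; split.
- move=> W y z dy gy; have [W1 [e1 [x1 [y1 [ee1 dx1 Ey]]]]] := (qf i).2 W y dy.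
  have [||W2 [e2 [x2 [ee2 dx2]]]] := (qgf i).1 W1 x1 (z \oc e1 - g i \oc y1) => //=.
    rewrite kcompBr (kcompA _ z) -gy -(kcompA _ y) -Ey !kcompDr.
    by rewrite (kra _ (cfun_diff g i)) !kcompA addrK.
  exists W2, (e1 \oc e2), (f i \oc x2 + y1 \oc e2); split; first exact: is_epi_comp.
  rewrite (kcompA y) -Ey kcompDr kcompDl -!kcompA -dx2.
  by rewrite (kra _ (cfun_diff f i)) -kcompA.
- move=> W z dz; have [W1 [e1 [x1 [z1 [ee1 dx1 Ez]]]]] := (qgf i).2 W z dz.
  exists W1, e1, (f (succz i) \oc x1), z1; split=> //.
    by rewrite kcompA -cfun_diff -kcompA dx1 kcompf0.
  by rewrite -Ez /= kcompA.
Qed.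

Lemma coh_iso_cancell X Y Z (g : cmap Y Z) (f : cmap X Y) :
  coh_iso (ccomp g f) -> coh_iso g -> coh_iso f.
Proof.
move=> qgf qg i; split.
- move=> W x y dx fx; apply: ((qgf i).1 W x (g i \oc y) dx).
  by rewrite /= -kcompA fx kcompA cfun_diff -kcompA.
- move=> W y dy; have [|W1 [e1 [x1 [z1 [ee1 dx1 Ez]]]]] := (qgf i).2 W (g (succz i) \oc y).
    by rewrite kcompA -cfun_diff -kcompA dy kcompf0.
  have [||W2 [e2 [y2 [ee2 dy2]]]] := (qg i).1 W1 (y \oc e1 - f (succz i) \oc x1) z1.
  - rewrite kcompBr kcompA dy kcomp0f (kra _ (esym (cfun_diff f (succz i)))).
    by rewrite -kcompA dx1 kcompf0 subrr.
  - rewrite kcompBr kcompA -Ez; by rewrite /= -!kcompA addrAC subrr add0r.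
  exists W2, (e1 \oc e2), (x1 \oc e2), y2; split; first exact: is_epi_comp.
    by rewrite kcompA dx1 kcomp0f.
  by rewrite dy2 kcompBl !kcompA addrC subrK.
Qed.

Lemma homotopic_refl X Y (f : cmap X Y) : homotopic f f.
Proof. by exists (fun=> 0) => i; rewrite subrr kcompf0 kcomp0f addr0. Qed.

Lemma homotopic_sym X Y (f g : cmap X Y) : homotopic f g -> homotopic g f.
Proof.
move=> [h E]; exists (fun i => - h i) => i.
by rewrite -opprB E opprD kcompNf kcompfN.
Qed.

Lemma homotopic_trans X Y (f g k : cmap X Y) :
  homotopic f g -> homotopic g k -> homotopic f k.
Proof.
move=> [h E] [h' E']; exists (fun i => h i + h' i) => i.
rewrite kcompDl kcompDr addrACA -E -E'; by rewrite addrA subrK.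
Qed.

Lemma homotopic_ext X Y (f g : cmap X Y) : (forall i, f i = g i) -> homotopic f g.
Proof.
by move=> E; exists (fun=> 0) => i; rewrite E subrr kcompf0 kcomp0f addr0.
Qed.

Lemma homotopic_compl X Y Z (g : cmap Y Z) (f f' : cmap X Y) :
  homotopic f f' -> homotopic (ccomp g f) (ccomp g f').
Proof.
move=> [h E]; exists (fun i => g i \oc h i) => i /=.
by rewrite -kcompBr E kcompDr (kcompA _ (h _)) !kcompA cfun_diff.
Qed.

Lemma homotopic_compr X Y Z (g g' : cmap Y Z) (f : cmap X Y) :
  homotopic g g' -> homotopic (ccomp g f) (ccomp g' f).
Proof.
move=> [h E]; exists (fun i => h i \oc f (succz i)) => i /=.
by rewrite -kcompBl E kcompDl -!kcompA cfun_diff.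
Qed.

Lemma homotopic_comp X Y Z (g g' : cmap Y Z) (f f' : cmap X Y) :
  homotopic g g' -> homotopic f f' -> homotopic (ccomp g f) (ccomp g' f').
Proof.
move=> hg hf; apply: homotopic_trans (homotopic_compl _ hf).
exact: homotopic_compr.
Qed.

Lemma coh_iso_homotopic X Y (f g : cmap X Y) :
  homotopic f g -> coh_iso f -> coh_iso g.
Proof.
move=> [h E] qf i.
have fE W (x : khom W (X (succz i))) : cdiff X (succz i) \oc x = 0 ->
  f (succz i) \oc x = g (succz i) \oc x + cdiff Y i \oc (h i \oc x).
  move=> dx; apply/eqP; rewrite addrC -subr_eq -kcompBl E kcompDl -!kcompA dx.
  by rewrite kcompf0 addr0.
split.
- move=> W x y dx gx; apply: ((qf i).1 W x (y + h i \oc x) dx).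
  by rewrite fE // gx kcompDr.
- move=> W y dy; have [W1 [e1 [x1 [y1 [ee1 dx1 Ey]]]]] := (qf i).2 W y dy.
  exists W1, e1, x1, (h i \oc x1 + y1); split=> //.
  by rewrite -Ey fE // kcompDr addrA.
Qed.

Lemma coh_iso_heq X Y (f : cmap X Y) (g : cmap Y X) :
  homotopic (ccomp g f) (cid X) -> homotopic (ccomp f g) (cid Y) -> coh_iso f.
Proof.
move=> [h hE] [k kE] i; split.
- move=> W x y dx fx; exists W, (kid W), (g i \oc y - h i \oc x); split.
    exact: is_epi_id.
  rewrite kcompf1 kcompBr kcompA -cfun_diff -kcompA -fx.
  have := congr1 (fun u => u \oc x) (hE i); rewrite /= kcompBl kcompDl kcomp1f -!kcompA dx.
  by rewrite kcompf0 addr0 => <-; rewrite opprB addrC subrK.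
- move=> W y dy; exists W, (kid W), (g (succz i) \oc y), (- (k i \oc y)); split.
  - exact: is_epi_id.
  - by rewrite kcompA -cfun_diff -kcompA dy kcompf0.
  have := congr1 (fun u => u \oc y) (kE i); rewrite /= kcompBl kcompDl kcomp1f -!kcompA dy.
  by rewrite kcompf0 addr0 kcompfN => <-; rewrite kcompf1 opprB addrC subrK.
Qed.

Lemma coh_iso_iso X Y (f : cmap X Y) (g : cmap Y X) :
  (forall i, g i \oc f i = kid (X i)) -> (forall i, f i \oc g i = kid (Y i)) ->
  coh_iso f.
Proof. by move=> h k; apply: (@coh_iso_heq _ _ f g); apply: homotopic_ext. Qed.

Hypothesis abC : abelian_kcat C.

Lemma ex_cohomology X i : exists (B H : C) (k : khom B (X (succz i)))
  (b : khom (X i) B) (p : khom B H), is_cohomology k b p.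
Proof.
have [B [k kk]] := ex_kernel abC (cdiff X (succz i)).
have [b kb] := is_kernel_lift kk (cdiff2 X i).
by have [H [p pp]] := ex_cokernel abC b; exists B, H, k, b, p.
Qed.

(** From left to right one presentation of each cohomology is chosen and the isomorphism [v] is
    chased. Conversely the universal properties give [u] and [v] for arbitrary presentations, and
    [v] is an isomorphism because it is both mono and epi. *)
Lemma quasi_isoP X Y (f : cmap X Y) : quasi_iso f <-> coh_iso f.
Proof.
split=> [qf i|qf i B H k b p B' H' k' b' p' [kk kb pp] [kk' kb' pp']].
- have [B [H [k [b [p hX]]]]] := ex_cohomology X i.
  have [B' [H' [k' [b' [p' hY]]]]] := ex_cohomology Y i.
  have [u [v [ku vp [w [wv vw]]]]] := qf _ _ _ _ _ _ _ _ _ _ _ hX hY.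
  case: hX hY => kk kb pp [kk' kb' pp']; split.
  + move=> W x y dx fx; have [x0 kx] := is_kernel_lift kk dx.
    have px : p \oc x0 = 0.
      apply: (is_iso_mono (ex_intro _ w (conj wv vw))).
      rewrite kcompf0 kcompA vp -kcompA.
      have -> : u \oc x0 = b' \oc y.
        by apply: (is_kernel_mono kk'); rewrite !kcompA ku kb' -kcompA kx.
      by rewrite kcompA; case: pp' => ->; rewrite kcomp0f.
    have [W1 [e1 [x1 [ee1 bx]]]] := coker_lift abC pp px.
    by exists W1, e1, x1; split=> //; rewrite -kb -kx -!kcompA bx.
  + move=> W y dy; have [y0 ky] := is_kernel_lift kk' dy.
    have [W1 [e1 [x0 [ee1 px]]]] := epi_lift abC (w \oc (p' \oc y0)) (is_cokernel_epi pp).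
    have : p' \oc (y0 \oc e1 - u \oc x0) = 0.
      rewrite kcompBr (kcompA p' u) -vp -!kcompA px -kcompA (kra _ vw) kcomp1f.
      by rewrite kcompA subrr.
    move/(coker_lift abC pp') => [W2 [e2 [y1 [ee2 by1]]]].
    exists W2, (e1 \oc e2), (k \oc (x0 \oc e2)), y1; split; first exact: is_epi_comp.
      by rewrite kcompA; case: kk => ->; rewrite kcomp0f.
    rewrite -kb' -ky -kcompA by1 kcompA -ku -!kcompA -kcompDr; congr (_ \oc _).
    by rewrite kcompBl !kcompA addrC subrK.
- have [u ku] : exists u, k' \oc u = f (succz i) \oc k.
    apply: is_kernel_lift kk' _; rewrite kcompA -cfun_diff -kcompA.
    by case: kk => ->; rewrite kcompf0.
  have ub : u \oc b = b' \oc f i.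
    by apply: (is_kernel_mono kk'); rewrite !kcompA ku kb' -kcompA kb cfun_diff.
  have [v vp] : exists v, v \oc p = p' \oc u.
    by apply: is_cokernel_desc pp _; rewrite -kcompA ub kcompA; case: pp' => ->; rewrite kcomp0f.
  exists u, v; split=> //; apply: balanced => //.
  + apply/is_monoP => W h vh.
    have [W1 [e1 [x0 [ee1 px]]]] := epi_lift abC h (is_cokernel_epi pp).
    have : p' \oc (u \oc x0) = 0 by rewrite kcompA -vp -kcompA px kcompA vh kcomp0f.
    move/(coker_lift abC pp') => [W2 [e2 [y1 [ee2 by1]]]].
    have [||W3 [e3 [x3 [ee3 dx3]]]] := (qf i).1 W2 (k \oc (x0 \oc e2)) y1.
    * by rewrite kcompA; case: kk => ->; rewrite kcomp0f.
    * by rewrite kcompA -ku -kb' -!kcompA by1 -!kcompA.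
    have bx : b \oc x3 = x0 \oc e2 \oc e3.
      by apply: (is_kernel_mono kk); rewrite kcompA kb dx3 -!kcompA.
    move/is_epiP: (is_epi_comp ee1 (is_epi_comp ee2 ee3)); apply.
    rewrite kcompA -px -kcompA (kcompA x0) -bx kcompA.
    by case: pp => ->; rewrite kcomp0f.
  + apply/is_epiP => Z g gv; move/is_epiP: (is_cokernel_epi pp'); apply.
    have [|W1 [e1 [x1 [y1 [ee1 dx1 E1]]]]] := (qf i).2 B' k' _; first by case: kk'.
    have [x0 kx] := is_kernel_lift kk dx1.
    move/is_epiP: ee1; apply.
    have -> : e1 = u \oc x0 + b' \oc y1.
      by apply: (is_kernel_mono kk'); rewrite kcompDr !kcompA ku kb' -E1 -kx kcompA.
    rewrite kcompDr -!kcompA (kcompA p') -vp (kcompA p' b').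
    by case: pp' => ->; rewrite kcomp0f kcompf0 addr0 !kcompA gv !kcomp0f.
Qed.

End QuasiIso.

(** * Mapping cones *)

Section DependentFamilies.

Lemma dep_choice (I : Type) (T : I -> Type) (P : forall i, T i -> Prop) :
  (forall i, exists t, P i t) -> exists f : forall i, T i, forall i, P i (f i).
Proof.
move=> h; exists (fun i => sval (boolp.cid (h i))) => i.
exact: svalP (boolp.cid (h i)).
Qed.

(** The value is transported along [n = i]; at [n] itself this transport is trivial, since proofs of
    equality in [int] are unique. *)
Lemma dep_update (T : int -> Type) (g : forall i, T i) n (t : T n) :
  exists g' : forall i, T i, g' n = t /\ forall i, i != n -> g' i = g i.
Proof.
pose g' i := if eqVneq n i is EqNotNeq e then eq_rect n T t i e else g i.
exists g'; split.
  rewrite /g'; case: eqVneq => [e|]; last by rewrite eqxx.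
  by rewrite (eq_irrelevance e erefl).
move=> i ni; rewrite /g'; case: eqVneq => // e.
by rewrite e eqxx in ni.
Qed.

Lemma succzK (i : int) : succz (i - 1) = i.
Proof. by rewrite /succz subrK. Qed.

Lemma succz_inj : injective succz.
Proof. by move=> i j /addIr. Qed.

Lemma succz_ind (P : int -> Prop) : (forall i, P (succz i)) -> forall i, P i.
Proof. by move=> h i; rewrite -(succzK i). Qed.

(** Components along a cone come indexed by [succz i], whereas a chain map or a homotopy needs a
    value at every degree. *)
Lemma dep_succz (T : int -> Type) (g : forall i, T (succz i)) :
  exists g' : forall i, T i, forall i, g' (succz i) = g i.
Proof.
exists (fun i => eq_rect _ T (g (i - 1)) i (succzK i)) => i.
move: (succzK (succz i)); have -> : succz i - 1 = i by rewrite /succz addrK.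
by move=> e; rewrite (eq_irrelevance e erefl).
Qed.

End DependentFamilies.

Section Cones.
Context {K : fieldType} {C : kcat K}.
Implicit Types X Y Z : bcx C.

Lemma biproduct_ext (X Y Z W : C) (i1 : khom X Z) i2 p1 (p2 : khom Z Y)
    (f g : khom Z W) :
  is_biproduct i1 i2 p1 p2 -> f \oc i1 = g \oc i1 -> f \oc i2 = g \oc i2 -> f = g.
Proof.
case=> _ _ _ _ E e1 e2.
by rewrite -(kcompf1 f) -(kcompf1 g) -E !kcompDr !kcompA e1 e2.
Qed.

Definition null_htpy X Y (f : cmap X Y) (h : forall i, khom (X (succz i)) (Y i)) :=
  forall i, f (succz i) = cdiff Y i \oc h i + h (succz i) \oc cdiff X (succz i).

Lemma homotopic0P X Y (f : cmap X Y) :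
  homotopic f (czero X Y) <-> exists h, null_htpy f h.
Proof. by split=> -[h E]; exists h => i; have := E i; rewrite /= subr0. Qed.

Definition csub X Y (f g : cmap X Y) : cmap X Y := cadd f (cscale (-1) g).

Lemma csubE X Y (f g : cmap X Y) i : csub f g i = f i - g i.
Proof. by rewrite /= scaleN1r. Qed.

Lemma homotopic_subP X Y (f g : cmap X Y) :
  homotopic f g <-> homotopic (csub f g) (czero X Y).
Proof.
split=> [[h E]|/homotopic0P [h E]]; last by exists h => i; rewrite -E csubE.
by apply/homotopic0P; exists h => i; rewrite csubE E.
Qed.

(** The cone is described by the composites of its differential with [j] and [q]; those with [u] and
    [v] are the chain map conditions of [u] and [v]. *)
Definition cone_of X Y Z (f : cmap X Y) (u : cmap Y Z) (v : cmap Z (cshift X))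
    (j : forall i, khom (X (succz i)) (Z i)) (q : forall i, khom (Z i) (Y i)) :=
  [/\ forall i, is_biproduct (j i) (u i) (v i) (q i),
      forall i, cdiff Z i \oc j i =
        u (succz i) \oc f (succz i) - j (succz i) \oc cdiff X (succz i)
    & forall i, q (succz i) \oc cdiff Z i = f (succz i) \oc v i + cdiff Y i \oc q i].

Lemma cone_diffv X Y Z (f : cmap X Y) u (v : cmap Z (cshift X)) j q i :
  cone_of f u v j q ->
  v (succz i) \oc cdiff Z i = - (cdiff X (succz i) \oc v i).
Proof. by move=> _; rewrite cfun_diff /= kcompNf. Qed.

Lemma cone_htpy X Y Z (f : cmap X Y) (u : cmap Y Z) v j q :
  cone_of f u v j q -> homotopic (ccomp u f) (czero X Z).
Proof.
by case=> _ E _; apply/homotopic0P; exists j => i; rewrite /= E subrK.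
Qed.

(** Universal property of the cone: a null-homotopy of [ccomp g f] provides the components on the
    shift of [X] of a map extending [g]. *)
Lemma ex_cone_map X Y Z W (f : cmap X Y) (u : cmap Y Z) v j q (g : cmap Y W) h :
  cone_of f u v j q -> null_htpy (ccomp g f) h ->
  exists k : cmap Z W, (forall i, k i \oc u i = g i) /\ (forall i, k i \oc j i = h i).
Proof.
move=> [B E _] hh; pose k i := g i \oc q i + h i \oc v i.
have ku i : k i \oc u i = g i.
  by case: (B i) => [_ qu _ vu _]; rewrite kcompDl -!kcompA qu vu kcompf1 kcompf0 addr0.
have kj i : k i \oc j i = h i.
  by case: (B i) => [vj _ qj _ _]; rewrite kcompDl -!kcompA vj qj kcompf1 kcompf0 add0r.
have kd i : k (succz i) \oc cdiff Z i = cdiff W i \oc k i.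
  apply: (biproduct_ext (B i)); rewrite -!kcompA.
    rewrite E kcompBr !kcompA ku kj -[cdiff W i \oc _ \oc _]kcompA kj.
    have := hh i; rewrite /= => ->.
    by rewrite addrK.
  by rewrite -cfun_diff !kcompA ku -kcompA ku cfun_diff.
by exists (CMap kd).
Qed.

Hypothesis abC : abelian_kcat C.

Lemma ex_cone X Y (f : cmap X Y) : exists Z u v j q, @cone_of X Y Z f u v j q.
Proof.
have [Z hZ] := choice (fun i => ex_biproduct abC (X (succz i)) (Y i)).
have [j hj] := dep_choice hZ; have [u hu] := dep_choice hj.
have [v hv] := dep_choice hu; have [q B] := dep_choice hv; clear hZ hj hu hv.
pose D i : khom (Z i) (Z (succz i)) :=
  (u (succz i) \oc f (succz i) - j (succz i) \oc cdiff X (succz i)) \oc v i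
  + u (succz i) \oc cdiff Y i \oc q i.
have Dj i : D i \oc j i = u (succz i) \oc f (succz i) - j (succz i) \oc cdiff X (succz i).
  by case: (B i) => [vj _ qj _ _]; rewrite kcompDl -!kcompA vj qj !kcompf1 !kcompf0 addr0.
have Du i : D i \oc u i = u (succz i) \oc cdiff Y i.
  by case: (B i) => [_ qu _ vu _]; rewrite kcompDl -!kcompA qu vu !kcompf1 !kcompf0 add0r.
have D2 i : D (succz i) \oc D i = 0.
  apply: (biproduct_ext (B i)); rewrite -!kcompA kcomp0f ?Dj ?Du.
    rewrite kcompBr !kcompA Du Dj kcompBl -!kcompA cdiff2 kcompf0 subr0.
    by rewrite cfun_diff subrr.
  by rewrite kcompA Du -kcompA cdiff2 kcompf0.
have bd : exists n : nat, forall i : int, (n < `|i|)%N -> is_zero (Z i).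
  have [n hn] := cbounded X; have [m hm] := cbounded Y.
  exists (n + m).+1 => i hi; rewrite /is_zero.
  have zX : is_zero (X (succz i)) by apply: hn; rewrite /succz; lia.
  have zY : is_zero (Y i) by apply: hm; lia.
  case: (B i) => _ _ _ _ <-.
  by rewrite (is_zero_to (v i) zX) (is_zero_to (q i) zY) !kcompf0 addr0.
pose ZZ := @BCx K C Z D D2 bd.
have uE i : u (succz i) \oc cdiff Y i = cdiff ZZ i \oc u i by rewrite Du.
have qE i : q (succz i) \oc D i = f (succz i) \oc v i + cdiff Y i \oc q i.
  case: (B (succz i)) => [_ qu qj _ _].
  rewrite /D kcompDr !kcompA kcompBr !kcompA qu qj !kcomp0f subr0 !kcomp1f //.
have vE i : v (succz i) \oc cdiff ZZ i = cdiff (cshift X) i \oc v i.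
  case: (B (succz i)) => [vj _ _ vu _].
  by rewrite /= /D kcompDr !kcompA kcompBr !kcompA vu vj !kcomp0f sub0r kcomp1f addr0.
by exists ZZ, (@CMap _ _ Y ZZ _ uE), (@CMap _ _ ZZ (cshift X) _ vE), j, q; split.
Qed.

Lemma ex_cbiproduct X Y : exists Z (i1 : cmap X Z) (i2 : cmap Y Z)
  (p1 : cmap Z X) (p2 : cmap Z Y), forall i, is_biproduct (i1 i) (i2 i) (p1 i) (p2 i).
Proof.
have [Z hZ] := choice (fun i => ex_biproduct abC (X i) (Y i)).
have [j hj] := dep_choice hZ; have [u hu] := dep_choice hj.
have [v hv] := dep_choice hu; have [q B] := dep_choice hv; clear hZ hj hu hv.
pose D i : khom (Z i) (Z (succz i)) :=
  j (succz i) \oc cdiff X i \oc v i + u (succz i) \oc cdiff Y i \oc q i.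
have Dj i : j (succz i) \oc cdiff X i = D i \oc j i.
  by case: (B i) => [vj _ qj _ _]; rewrite kcompDl -!kcompA vj qj !kcompf1 !kcompf0 addr0.
have Du i : u (succz i) \oc cdiff Y i = D i \oc u i.
  by case: (B i) => [_ qu _ vu _]; rewrite kcompDl -!kcompA qu vu !kcompf1 !kcompf0 add0r.
have D2 i : D (succz i) \oc D i = 0.
  apply: (biproduct_ext (B i)); rewrite -!kcompA kcomp0f -?Dj -?Du.
    by rewrite kcompA -Dj -kcompA cdiff2 kcompf0.
  by rewrite kcompA -Du -kcompA cdiff2 kcompf0.
have bd : exists n : nat, forall i : int, (n < `|i|)%N -> is_zero (Z i).
  have [n hn] := cbounded X; have [m hm] := cbounded Y.
  exists (n + m)%N => i hi; rewrite /is_zero.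
  have zX : is_zero (X i) by apply: hn; lia.
  have zY : is_zero (Y i) by apply: hm; lia.
  case: (B i) => _ _ _ _ <-.
  by rewrite (is_zero_to (v i) zX) (is_zero_to (q i) zY) !kcompf0 addr0.
pose ZZ := @BCx K C Z D D2 bd.
have qE i : q (succz i) \oc cdiff ZZ i = cdiff Y i \oc q i.
  case: (B (succz i)) => [_ qu qj _ _].
  by rewrite /= /D kcompDr !kcompA qu qj !kcomp0f !kcomp1f add0r.
have vE i : v (succz i) \oc cdiff ZZ i = cdiff X i \oc v i.
  case: (B (succz i)) => [vj _ _ vu _].
  by rewrite /= /D kcompDr !kcompA vu vj !kcomp0f kcomp1f addr0.
by exists ZZ, (@CMap _ _ X ZZ _ Dj), (@CMap _ _ Y ZZ _ Du),
  (@CMap _ _ ZZ X _ vE), (@CMap _ _ ZZ Y _ qE).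
Qed.

(** For a cocycle (a, b), injectivity gives a1 with d a1 = a. Then f a1 + b is a cocycle of Y, and
    surjectivity gives a cocycle a2 and some b2 with f a2 + d b2 = f a1 + b. The preimage is (a2 -
    a1, b2). *)
Lemma cone_acyclic X Y Z (f : cmap X Y) (u : cmap Y Z) v j q :
  cone_of f u v j q -> coh_iso f -> acyclic Z.
Proof.
move=> cf; have [B Ej Eq] := cf => hf i W x dx.
have da : cdiff X (succz (succz i)) \oc (v (succz i) \oc x) = 0.
  by apply: oppr_inj; rewrite oppr0 kcompA -kcompNf -(cone_diffv _ cf) -kcompA dx kcompf0.
have fa : f (succz (succz i)) \oc (v (succz i) \oc x)
    = cdiff Y (succz i) \oc (- (q (succz i) \oc x)).
  apply/eqP; rewrite kcompfN -addr_eq0 !kcompA -kcompDl -Eq -kcompA dx.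
  by rewrite kcompf0.
have [W1 [e1 [a1 [ee1 da1]]]] := (hf (succz i)).1 _ _ _ da fa.
have [|W2 [e2 [a2 [b2 [ee2 da2 E2]]]]] :=
    (hf i).2 W1 (f (succz i) \oc a1 + q (succz i) \oc x \oc e1).
  rewrite kcompDr kcompA -cfun_diff -kcompA da1 kcompA fa kcompfN kcompNf.
  by rewrite !kcompA addNr.
pose al := a1 \oc e2 - a2.
have dal : cdiff X (succz i) \oc al = v (succz i) \oc x \oc (e1 \oc e2).
  by rewrite kcompBr da2 subr0 kcompA da1 !kcompA.
exists W2, (e1 \oc e2), (- (j i \oc al) + u i \oc b2); split; first exact: is_epi_comp.
rewrite kcompDr kcompfN !kcompA Ej -cfun_diff kcompBl -!kcompA dal opprB.
have -> : f (succz i) \oc al = cdiff Y i \oc b2 - q (succz i) \oc x \oc (e1 \oc e2).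
  rewrite kcompBr kcompA; apply/eqP; rewrite subr_eq addrAC eq_sym subr_eq.
  by rewrite addrC E2 kcompDl !kcompA.
rewrite kcompBr opprB addrA subrK.
case: (B (succz i)) => _ _ _ _ id1.
by rewrite -[x in RHS]kcomp1f -id1 !kcompDl -!kcompA.
Qed.

(** The quotient of the cone by [Y] is the shift of [X], which is acyclic. *)
Lemma cone_incl_coh_iso X Y Z (f : cmap X Y) (u : cmap Y Z) v j q :
  cone_of f u v j q -> acyclic X -> coh_iso u.
Proof.
move=> cf; have [B Ej Eq] := cf => aX i; split.
- move=> W y w dy uy.
  have [|W1 [e1 [a1 [ee1 da1]]]] := aX i W (v i \oc w).
    apply: oppr_inj; rewrite oppr0 kcompA -kcompNf -(cone_diffv _ cf) -kcompA -uy.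
    by rewrite kcompA; case: (B (succz i)) => _ _ _ -> _; rewrite kcomp0f.
  exists W1, e1, (f i \oc a1 + q i \oc w \oc e1); split=> //.
  have yE : y = f (succz i) \oc v i \oc w + cdiff Y i \oc q i \oc w.
    rewrite -kcompDl -Eq -kcompA -uy kcompA.
    by case: (B (succz i)) => _ -> _ _ _; rewrite kcomp1f.
  by rewrite [in RHS]yE kcompDr kcompDl !kcompA -cfun_diff -kcompA da1 !kcompA.
- move=> W x dx.
  have [|W1 [e1 [a1 [ee1 da1]]]] := aX (succz i) W (v (succz i) \oc x).
    by apply: oppr_inj; rewrite oppr0 kcompA -kcompNf -(cone_diffv _ cf) -kcompA dx kcompf0.
  have dqx : cdiff Y (succz i) \oc (q (succz i) \oc x)
      = - (f (succz (succz i)) \oc (v (succz i) \oc x)).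
    by apply/eqP; rewrite -addr_eq0 addrC !kcompA -kcompDl -Eq -kcompA dx kcompf0.
  exists W1, e1, (q (succz i) \oc x \oc e1 + f (succz i) \oc a1), (- (j i \oc a1)).
  split=> //.
    rewrite kcompDr !kcompA -cfun_diff -[cdiff Y _ \oc _ \oc x]kcompA dqx -kcompA.
    by rewrite da1 kcompNf !kcompA addNr.
  rewrite kcompfN kcompA Ej kcompBl -!kcompA da1 kcompDr opprB addrA addrAC addrK.
  case: (B (succz i)) => _ _ _ _ id1.
  by rewrite -[x in RHS]kcomp1f -id1 !kcompDl -!kcompA addrC.
Qed.

(** [Q] is the cone of (s, -t) from [X] to the sum of [Y] and [Z], and its null-homotopy is the
    homotopy between the two composites. The quotient of [Q] by [Z] is the cone of [s], which is
    acyclic; the chase below makes this explicit. *)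
Lemma ore_square X Y Z (s : cmap X Y) (t : cmap X Z) : coh_iso s ->
  exists Q (p : cmap Y Q) (s' : cmap Z Q),
    coh_iso s' /\ homotopic (ccomp p s) (ccomp s' t).
Proof.
move=> hs; have [B [i1 [i2 [p1 [p2 bB]]]]] := ex_cbiproduct Y Z.
pose c := csub (ccomp i1 s) (ccomp i2 t).
have [Q [u [v [j [q cf]]]]] := ex_cone c; have [bQ Ej Eq] := cf.
exists Q, (ccomp u i1), (ccomp u i2); split; last first.
  apply/homotopic_subP; apply: homotopic_trans (cone_htpy cf).
  by apply: homotopic_ext => i; rewrite csubE /= scaleN1r kcompBr !kcompA.
have p1c i : p1 i \oc c i = s i.
  case: (bB i) => [p11 _ _ p12 _].
  by rewrite csubE /= kcompBr !kcompA p11 p12 kcomp1f kcomp0f subr0.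
have p2c i : p2 i \oc c i = - t i.
  case: (bB i) => [_ p22 p21 _ _].
  by rewrite csubE /= kcompBr !kcompA p22 p21 kcomp1f kcomp0f sub0r.
have Ep1 i : p1 (succz i) \oc (q (succz i) \oc cdiff Q i)
    = s (succz i) \oc v i + cdiff Y i \oc (p1 i \oc q i).
  by rewrite Eq kcompDr !kcompA p1c cfun_diff.
have Ep2 i : p2 (succz i) \oc (q (succz i) \oc cdiff Q i)
    = - (t (succz i) \oc v i) + cdiff Z i \oc (p2 i \oc q i).
  by rewrite Eq kcompDr !kcompA p2c cfun_diff kcompNf.
move=> i; split.
- move=> W z w dz /= uz.
  have dvw : cdiff X (succz i) \oc (v i \oc w) = 0.
    apply: oppr_inj; rewrite oppr0 kcompA -kcompNf -(cone_diffv _ cf) -kcompA -uz.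
    by rewrite !kcompA; case: (bQ (succz i)) => _ _ _ -> _; rewrite !kcomp0f.
  have qdw : q (succz i) \oc (cdiff Q i \oc w) = i2 (succz i) \oc z.
    by rewrite -uz !kcompA; case: (bQ (succz i)) => _ -> _ _ _; rewrite kcomp1f.
  have svw : s (succz i) \oc (v i \oc w) = cdiff Y i \oc (- (p1 i \oc q i \oc w)).
    apply/eqP; rewrite kcompfN -addr_eq0 !kcompA -kcompDl -(kcompA (cdiff Y i)) -Ep1.
    rewrite -!kcompA qdw kcompA; case: (bB (succz i)) => _ _ _ -> _.
    by rewrite kcomp0f.
  have [W1 [e1 [a1 [ee1 da1]]]] := (hs i).1 _ _ _ dvw svw.
  have zE : z = - (t (succz i) \oc (v i \oc w)) + cdiff Z i \oc (p2 i \oc q i \oc w).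
    rewrite (kcompA (t _)) (kcompA (cdiff Z i)) -kcompNf -kcompDl -Ep2 -!kcompA qdw kcompA.
    by case: (bB (succz i)) => _ -> _ _ _; rewrite kcomp1f.
  exists W1, e1, (- (t i \oc a1) + p2 i \oc q i \oc w \oc e1); split=> //.
  rewrite [in RHS]zE kcompDl kcompNf -(kcompA _ (v i \oc w)) -da1 kcompDr kcompfN !kcompA.
  by rewrite cfun_diff.
- move=> W x dx.
  have da : cdiff X (succz (succz i)) \oc (v (succz i) \oc x) = 0.
    by apply: oppr_inj; rewrite oppr0 kcompA -kcompNf -(cone_diffv _ cf) -kcompA dx kcompf0.
  have sa : s (succz (succz i)) \oc (v (succz i) \oc x)
      = cdiff Y (succz i) \oc (- (p1 (succz i) \oc q (succz i) \oc x)).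
    apply/eqP; rewrite kcompfN -addr_eq0 !kcompA -kcompDl -(kcompA (cdiff Y _)) -Ep1.
    by rewrite -!kcompA dx !kcompf0.
  have ta : cdiff Z (succz i) \oc (p2 (succz i) \oc q (succz i) \oc x)
      = t (succz (succz i)) \oc (v (succz i) \oc x).
    apply/eqP; rewrite -subr_eq0 addrC (kcompA (cdiff Z _)) (kcompA (t _)) -kcompNf -kcompDl.
    by rewrite -Ep2 -!kcompA dx !kcompf0.
  have [W1 [e1 [a1 [ee1 da1]]]] := (hs (succz i)).1 _ _ _ da sa.
  have [|W2 [e2 [a2 [b2 [ee2 da2 E2]]]]] :=
      (hs i).2 W1 (s (succz i) \oc a1 + p1 (succz i) \oc q (succz i) \oc x \oc e1).
    rewrite kcompDr kcompA -cfun_diff -kcompA da1 kcompA sa kcompfN kcompNf.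
    by rewrite !kcompA addNr.
  pose al := a1 \oc e2 - a2.
  have dal : cdiff X (succz i) \oc al = v (succz i) \oc x \oc (e1 \oc e2).
    by rewrite kcompBr da2 subr0 kcompA da1 !kcompA.
  have sal : s (succz i) \oc al
      = cdiff Y i \oc b2 - p1 (succz i) \oc q (succz i) \oc x \oc (e1 \oc e2).
    rewrite kcompBr kcompA; apply/eqP; rewrite subr_eq addrAC eq_sym subr_eq.
    by rewrite addrC E2 kcompDl !kcompA.
  exists W2, (e1 \oc e2),
    (p2 (succz i) \oc q (succz i) \oc x \oc (e1 \oc e2) - t (succz i) \oc al),
    (- (j i \oc al) + u i \oc i1 i \oc b2); split; first exact: is_epi_comp.
    rewrite kcompBr (kcompA _ _ (e1 \oc e2)) ta (kcompA _ (t _)) -cfun_diff.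
    by rewrite -(kcompA (t _) _ al) dal !kcompA subrr.
  have uc : u (succz i) \oc c (succz i) \oc al =
     u (succz i) \oc i1 (succz i) \oc (cdiff Y i \oc b2)
     - u (succz i) \oc i1 (succz i) \oc (p1 (succz i) \oc q (succz i) \oc x \oc (e1 \oc e2))
     - u (succz i) \oc i2 (succz i) \oc (t (succz i) \oc al).
    by rewrite -kcompBr -sal -kcompA csubE /= kcompBl kcompBr !kcompA.
  have -> : cdiff Q i \oc (- (j i \oc al) + u i \oc i1 i \oc b2) =
      - (u (succz i) \oc c (succz i) \oc al) + j (succz i) \oc (cdiff X (succz i) \oc al)
      + u (succz i) \oc i1 (succz i) \oc (cdiff Y i \oc b2).
    rewrite kcompDr kcompfN !kcompA Ej kcompBl opprB -cfun_diff [- _ + _]addrC.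
    by rewrite -!kcompA (kcompA (cdiff B _)) -(cfun_diff i1) !kcompA.
  rewrite uc dal /=.
  case: (bQ (succz i)) => _ _ _ _ id1; case: (bB (succz i)) => _ _ _ _ id2.
  have xE : x = j (succz i) \oc (v (succz i) \oc x) + u (succz i) \oc
     (i1 (succz i) \oc (p1 (succz i) \oc q (succz i) \oc x)
     + i2 (succz i) \oc (p2 (succz i) \oc q (succz i) \oc x)).
    rewrite -(kcompA (p1 _)) -(kcompA (p2 _)) (kcompA (i1 _)) (kcompA (i2 _)).
    by rewrite -kcompDl id2 kcomp1f (kcompA (u _)) (kcompA (j _)) -kcompDl id1 kcomp1f.
  rewrite [in RHS]xE kcompBr.
  have zE (V : zmodType) (a b c' d e : V) :
      (a - b) + (- (c' - d - b) + e + c') = e + (d + a).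
    by rewrite !opprB -!addrA addKr [e + c']addrC addKr [d + e]addrC addrC -addrA.
  by rewrite zE !(kcompDl, kcompDr) !kcompA.
Qed.

End Cones.

(** * The derived category *)

Section DerivedCategory.
Context {K : fieldType} {C : kcat K}.
Implicit Types X Y Z : bcx C.

#[export] Instance deq_equiv X Y : Equivalence (@deq K C X Y).
Proof.
by split=> [a|a b|a b c]; [exact: deq_refl|exact: deq_sym|exact: deq_trans].
Qed.

#[export] Instance dcomp_proper X Y Z :
  Proper (@deq K C Y Z ==> @deq K C X Y ==> @deq K C X Z) (@dcomp K C X Y Z).
Proof. by move=> b b' hb a a' ha; exact: deq_comp. Qed.

#[local] Hint Resolve deq_refl : core.

Definition did X : dmor X X := dof (cid X).
Definition d0 X Y : dmor X Y := dof (czero X Y).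
Definition hom0 X Y := forall a : dmor X Y, deq a (d0 X Y).

(** Absorption is not among the rules of [deq]. On the formal inverse of [s] it follows by writing 0
    as 0 composed with [s] and cancelling. *)
Lemma dcomp0l X Y Z (a : dmor X Y) : deq (dcomp (d0 Y Z) a) (d0 X Z).
Proof.
elim: a Z => {X Y} [X Y f|X Y s qs|X Y Z' b IHb a IHa] Z.
- by rewrite /d0 -deq_of_comp; apply: deq_of => i /=; rewrite kcomp0f.
- have -> : deq (d0 X Z) (dcomp (d0 Y Z) (dof s)).
    by rewrite /d0 -deq_of_comp; apply: deq_of => i /=; rewrite kcomp0f.
  by rewrite -deq_compA deq_inv_r deq_id_r.
- by rewrite deq_compA IHb IHa.
Qed.

Lemma dcomp0r X Y Z (a : dmor Y Z) : deq (dcomp a (d0 X Y)) (d0 X Z).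
Proof.
elim: a X => {Y Z} [Y Z f|Y Z s qs|Y Z Z' b IHb a IHa] X.
- by rewrite /d0 -deq_of_comp; apply: deq_of => i /=; rewrite kcompf0.
- have -> : deq (d0 X Z) (dcomp (dof s) (d0 X Y)).
    by rewrite /d0 -deq_of_comp; apply: deq_of => i /=; rewrite kcompf0.
  by rewrite deq_compA deq_inv_l deq_id_l.
- by rewrite -deq_compA IHa IHb.
Qed.

Definition diso X Y := exists a : dmor X Y, d_iso a.

Lemma diso_sym X Y : diso X Y -> diso Y X.
Proof. by move=> [a [b [ba ab]]]; exists b, a. Qed.

Lemma diso_trans X Y Z : diso X Y -> diso Y Z -> diso X Z.
Proof.
move=> [a [a' [h1 h2]]] [b [b' [h3 h4]]]; exists (dcomp b a), (dcomp a' b'); split.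
  by rewrite -deq_compA [dcomp b' _]deq_compA h3 deq_id_l.
by rewrite -deq_compA [dcomp a _]deq_compA h2 deq_id_l.
Qed.

Lemma diso_iso X Y (f : cmap X Y) (g : cmap Y X) :
  (forall i, g i \oc f i = kid (X i)) -> (forall i, f i \oc g i = kid (Y i)) ->
  diso X Y.
Proof.
by move=> gf fg; exists (dof f), (dof g); rewrite -!deq_of_comp; split; apply: deq_of.
Qed.

Lemma diso_quasi_iso X Y (f : cmap X Y) : quasi_iso f -> diso X Y.
Proof. by move=> qf; exists (dof f), (dinv qf); split; rewrite (deq_inv_l, deq_inv_r). Qed.

Lemma hom0_diso X X' Y Y' : diso X X' -> diso Y Y' -> hom0 X Y -> hom0 X' Y'.
Proof.
move=> [a [a' [_ aa']]] [b [b' [_ bb']]] h c.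
rewrite -[c]deq_id_l -[dcomp _ c]deq_id_r -bb' -aa' -!deq_compA.
by rewrite [dcomp c _]deq_compA [dcomp b' _]deq_compA (h (dcomp _ _)) dcomp0l dcomp0r.
Qed.

Lemma hom0_idr X Y : deq (did Y) (d0 Y Y) -> hom0 X Y.
Proof. by move=> h a; rewrite -[a]deq_id_l [dof _]h dcomp0l. Qed.

Hypothesis abC : abelian_kcat C.

Lemma diso_coh_iso X Y (f : cmap X Y) : coh_iso f -> diso X Y.
Proof. by move/(quasi_isoP abC); exact: diso_quasi_iso. Qed.

Lemma coh_iso_epi_deq X Y Z (s : cmap Y Z) (a b : dmor X Y) : coh_iso s ->
  deq (dcomp (dof s) a) (dcomp (dof s) b) -> deq a b.
Proof.
move/(quasi_isoP abC) => qs E.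
by rewrite -[a]deq_id_l -[b]deq_id_l -(deq_inv_l qs) -!deq_compA E.
Qed.

Lemma coh_iso_mono_deq X Y Z (s : cmap X Y) (a b : dmor Y Z) : coh_iso s ->
  deq (dcomp a (dof s)) (dcomp b (dof s)) -> deq a b.
Proof.
move/(quasi_isoP abC) => qs E.
by rewrite -[a]deq_id_r -[b]deq_id_r -(deq_inv_r qs) !deq_compA E.
Qed.

Lemma coh_iso_id X : coh_iso (cid X).
Proof. by apply: (@coh_iso_iso _ _ _ _ (cid X) (cid X)) => i /=; rewrite kcomp1f. Qed.

(** On an acyclic complex the zero endomorphism is a quasi-isomorphism, so it may be cancelled after
    the identity and after 0. *)
Lemma acyclic_d0 X : acyclic X -> deq (did X) (d0 X X).
Proof.
move=> aX; have qz : coh_iso (czero X X).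
  move=> i; split=> [W x y dx _|W y dy].
    exact: aX dx.
  have [W1 [e1 [y1 [ee1 E]]]] := aX i W y dy.
  by exists W1, e1, 0, y1; split; rewrite ?kcompf0 ?add0r.
apply: (coh_iso_epi_deq qz); rewrite /did /d0 -!deq_of_comp.
by apply: deq_of => i /=; rewrite !kcomp0f.
Qed.

(** The homotopy extends f - g to a map [k] on the cone [D] of the identity, which is acyclic. On
    the sum of [X] and [D] the projection [p1] is a quasi-isomorphism with the two sections [i1] and
    i1 + i2 u, which therefore coincide in the localization; the map (g, k) takes them to [g] and
    [f]. *)
Lemma homotopic_deq X Y (f g : cmap X Y) : homotopic f g -> deq (dof f) (dof g).
Proof.
move/homotopic_subP/homotopic0P=> [h hh].
have [D [u [v [j [q cD]]]]] := ex_cone abC (cid X).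
have aD : acyclic D by apply: cone_acyclic cD _ => //; exact: coh_iso_id.
have [k [ku _]] : exists k : cmap D Y, (forall i, k i \oc u i = csub f g i) /\
    (forall i, k i \oc j i = h i).
  by apply: ex_cone_map cD _ => i; rewrite [LHS]kcompf1; apply: hh.
have [B [i1 [i2 [p1 [p2 bB]]]]] := ex_cbiproduct abC X D.
have qp : coh_iso p1.
  move=> i; split.
  - move=> W x y dx px; have [|W1 [e1 [c [ee1 dc]]]] := aD i W (p2 (succz i) \oc x).
      by rewrite kcompA -cfun_diff -kcompA dx kcompf0.
    exists W1, e1, (i1 i \oc (y \oc e1) + i2 i \oc c); split=> //.
    rewrite kcompDr !kcompA -!cfun_diff -!kcompA dc (kcompA (cdiff X i)) -px.
    case: (bB (succz i)) => _ _ _ _ id1.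
    by rewrite -[x in RHS]kcomp1f -id1 !kcompDl -!kcompA.
  - move=> W y dy; exists W, (kid W), (i1 (succz i) \oc y), 0; split.
    + exact: is_epi_id.
    + by rewrite kcompA -cfun_diff -kcompA dy kcompf0.
    by case: (bB (succz i)) => E _ _ _ _; rewrite kcompA E kcomp1f kcompf1 kcompf0 addr0.
have E : deq (dof (cadd i1 (ccomp i2 u))) (dof i1).
  apply: (coh_iso_epi_deq qp); rewrite -!deq_of_comp; apply: deq_of => i /=.
  by case: (bB i) => _ _ _ z _; rewrite kcompDr (kcompA _ (i2 i)) z kcomp0f addr0.
pose l := cadd (ccomp g p1) (ccomp k p2).
have -> : deq (dof f) (dcomp (dof l) (dof (cadd i1 (ccomp i2 u)))).
  rewrite -deq_of_comp; apply: deq_of => i /=.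
  case: (bB i) => e11 e22 e21 e12 _.
  rewrite kcompDl !kcompDr !kcompA -!(kcompA (g i)) -!(kcompA (k i)) e11 e12 e21 e22.
  by rewrite !kcomp0f !kcompf0 kcompf1 kcomp1f addr0 add0r ku csubE addrC subrK.
rewrite E -deq_of_comp; apply: deq_of => i /=.
case: (bB i) => e11 e22 e21 e12 _.
by rewrite kcompDl -!kcompA e11 e21 kcompf1 kcompf0 addr0.
Qed.

(** The homotopy extends f - g to a map [k] on the acyclic cone [D] of [s]. The inclusion [t] of [Y]
    in the cone of [k] makes [k] null-homotopic, and it is a quasi-isomorphism because [D] is
    acyclic. *)
Lemma coh_iso_cancel X' X Y (s : cmap X' X) (f g : cmap X Y) : coh_iso s ->
  homotopic (ccomp f s) (ccomp g s) ->
  exists Q (t : cmap Y Q), coh_iso t /\ homotopic (ccomp t f) (ccomp t g).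
Proof.
move=> hs /homotopic_subP/homotopic0P [h hh].
have [D [u [v [j [q cD]]]]] := ex_cone abC s.
have aD : acyclic D := cone_acyclic cD hs.
have [k [ku _]] : exists k : cmap D Y, (forall i, k i \oc u i = csub f g i) /\
    (forall i, k i \oc j i = h i).
  apply: ex_cone_map cD _ => i; rewrite -[RHS]hh csubE /= scaleN1r.
  by rewrite kcompBl.
have [Q [t [v' [j' [q' cQ]]]]] := ex_cone abC k.
exists Q, t; split; first exact: (cone_incl_coh_iso cQ).
apply/homotopic_subP.
have H : homotopic (ccomp (ccomp t k) u) (czero X Q).
  apply: homotopic_trans (homotopic_compr u (cone_htpy cQ)) _.
  by apply: homotopic_ext => i /=; rewrite kcomp0f.
apply: homotopic_trans H; apply: homotopic_ext => i.
by rewrite csubE /= -kcompA ku csubE kcompBr.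
Qed.

End DerivedCategory.

(** * Left fractions *)

Section Roofs.
Context {K : fieldType} {C : kcat K}.
Hypothesis abC : abelian_kcat C.
Implicit Types X Y Z : bcx C.

#[export] Instance homotopic_equiv X Y : Equivalence (@homotopic K C X Y).
Proof.
split=> [a|a b|a b c]; [exact: homotopic_refl|exact: homotopic_sym|].
exact: homotopic_trans.
Qed.

#[export] Instance ccomp_proper X Y Z :
  Proper (@homotopic K C Y Z ==> @homotopic K C X Y ==> @homotopic K C X Z)
    (@ccomp K C X Y Z).
Proof. by move=> b b' hb a a' ha; exact: homotopic_comp. Qed.

#[local] Hint Resolve homotopic_refl : core.

Lemma ccompA W X Y Z (h : cmap Y Z) (g : cmap X Y) (f : cmap W X) :
  homotopic (ccomp h (ccomp g f)) (ccomp (ccomp h g) f).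
Proof. by apply: homotopic_ext => i /=; rewrite kcompA. Qed.

Lemma ccomp1f X Y (f : cmap X Y) : homotopic (ccomp (cid Y) f) f.
Proof. by apply: homotopic_ext => i /=; rewrite kcomp1f. Qed.

Lemma ccompf1 X Y (f : cmap X Y) : homotopic (ccomp f (cid X)) f.
Proof. by apply: homotopic_ext => i /=; rewrite kcompf1. Qed.

Lemma coh_iso_hcancelr X Y Z (g : cmap Y Z) (f : cmap X Y) (k : cmap X Z) :
  homotopic (ccomp g f) k -> coh_iso k -> coh_iso f -> coh_iso g.
Proof.
move=> h hk hf; apply: coh_iso_cancelr hf.
exact: coh_iso_homotopic (homotopic_sym h) hk.
Qed.

Variable X0 : bcx C.

(** A left fraction from the fixed object [X0] to [Y], with numerator [rnum] and denominator
    [rden]. *)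
Record lroof Y := LRoof {
  rtop : bcx C; rden : cmap Y rtop; rnum : cmap X0 rtop; rden_iso : coh_iso rden }.

(** The fraction [r2] represents [t] composed with [r1]. This is a relation because a composite
    fraction depends on choices; for [t] the identity it is equivalence of fractions. *)
Definition roof_map Y Z (t : cmap Y Z) (r1 : lroof Y) (r2 : lroof Z) : Prop :=
  exists Q (u : cmap (rtop r1) Q) (v : cmap (rtop r2) Q),
  [/\ coh_iso v, homotopic (ccomp u (rden r1)) (ccomp v (ccomp (rden r2) t))
    & homotopic (ccomp u (rnum r1)) (ccomp v (rnum r2))].

Lemma roof_map_total Y Z (t : cmap Y Z) r1 : exists r2, roof_map t r1 r2.
Proof.
have [Q [p [s [qs E]]]] := ore_square abC t (rden_iso r1).
exists (LRoof (ccomp p (rnum r1)) qs), Q, p, (cid Q) => /=.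
by split; rewrite ?ccomp1f //; apply: coh_iso_id.
Qed.

Lemma roof_map_refl Y (r : lroof Y) : roof_map (cid Y) r r.
Proof.
by exists (rtop r), (cid _), (cid _); split; rewrite ?ccompf1 //; apply: coh_iso_id.
Qed.

Lemma roof_map_htpy Y Z (t t' : cmap Y Z) r1 r2 :
  homotopic t t' -> roof_map t r1 r2 -> roof_map t' r1 r2.
Proof. by move=> E [Q [u [v [h1 h2 h3]]]]; exists Q, u, v; split=> //; rewrite -E. Qed.

Lemma roof_map_comp Y Z W (t : cmap Y Z) (t' : cmap Z W) r1 r2 r3 :
  roof_map t r1 r2 -> roof_map t' r2 r3 -> roof_map (ccomp t' t) r1 r3.
Proof.
move=> [Q [u [v [qv E1 E2]]]] [Q' [u' [v' [qv' E1' E2']]]].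
have [P [p [p' [qp' E]]]] := ore_square abC u' qv.
exists P, (ccomp p u), (ccomp p' v'); split; first exact: coh_iso_comp.
- by rewrite -ccompA E1 !ccompA E -(ccompA p') -(ccompA p') E1' !ccompA.
- by rewrite -ccompA E2 !ccompA E -!ccompA E2'.
Qed.

(** An Ore square brings both results under one top, where they agree after precomposition with the
    denominator of [r1]; [coh_iso_cancel] removes that denominator. *)
Lemma roof_map_fun Y Z (t : cmap Y Z) r1 r2 r3 :
  roof_map t r1 r2 -> roof_map t r1 r3 -> roof_map (cid Z) r2 r3.
Proof.
move=> [Q [u [v [qv E1 E2]]]] [Q' [u' [v' [qv' E1' E2']]]].
have qvs : coh_iso (ccomp v (rden r2)) by apply: coh_iso_comp qv (rden_iso r2).
have [P [a [b [qb E]]]] := ore_square abC (ccomp v' (rden r3)) qvs.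
have Es : homotopic (ccomp (ccomp a u) (rden r1)) (ccomp (ccomp b u') (rden r1)).
  by rewrite -ccompA E1 (ccompA v) ccompA E -ccompA -(ccompA v') -E1' ccompA.
have [P' [k [qk Ek]]] := coh_iso_cancel abC (rden_iso r1) Es.
exists P', (ccomp k (ccomp a v)), (ccomp k (ccomp b v')); split.
- by apply: coh_iso_comp => //; apply: coh_iso_comp.
- by rewrite ccompf1 -!ccompA E.
- by rewrite -!ccompA -E2 -E2' (ccompA a) (ccompA b) ccompA Ek -ccompA.
Qed.

(** Together with [roof_map_surj] this makes a quasi-isomorphism act bijectively on classes of
    roofs, so that its formal inverse can act by the converse relation. *)
Lemma roof_map_inj Y Z (s : cmap Y Z) r1 r2 r3 : coh_iso s ->
  roof_map s r1 r2 -> roof_map s r3 r2 -> roof_map (cid Y) r1 r3.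
Proof.
move=> qs [Q [u [v [qv E1 E2]]]] [Q' [u' [v' [qv' E1' E2']]]].
have [P [p [p' [qp' E]]]] := ore_square abC v' qv.
exists P, (ccomp p u), (ccomp p' u'); split.
- apply: coh_iso_comp => //; apply: (coh_iso_hcancelr E1') (rden_iso r3).
  by do 2!apply: coh_iso_comp => //; apply: rden_iso.
- by rewrite ccompf1 -!ccompA E1 E1' ccompA E -!ccompA.
- by rewrite -!ccompA E2 E2' ccompA E -!ccompA.
Qed.

Lemma roof_map_surj Y Z (s : cmap Y Z) r2 : coh_iso s -> exists r1, roof_map s r1 r2.
Proof.
move=> qs; exists (LRoof (rnum r2) (coh_iso_comp (rden_iso r2) qs)).
by exists (rtop r2), (cid _), (cid _); split=> //; apply: coh_iso_id.
Qed.

Lemma roof_map_sym Y (r1 r2 : lroof Y) :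
  roof_map (cid Y) r1 r2 -> roof_map (cid Y) r2 r1.
Proof.
move=> [Q [u [v [qv E1 E2]]]]; exists Q, v, u.
rewrite ccompf1 in E1; split; rewrite ?ccompf1 ?E1 ?E2 //.
apply: (coh_iso_hcancelr E1) (rden_iso r1).
by apply: coh_iso_comp => //; apply: rden_iso.
Qed.

Fixpoint dact Y Z (a : dmor Y Z) : lroof Y -> lroof Z -> Prop :=
  match a with
  | dof _ _ f => roof_map f
  | dinv _ _ s _ => fun r1 r2 => roof_map s r2 r1
  | dcomp _ _ _ b a => fun r1 r3 => exists r2, dact a r1 r2 /\ dact b r2 r3
  end.

Lemma dact_congr Y Z (a : dmor Y Z) r1 r2 r1' r2' :
  roof_map (cid Y) r1' r1 -> roof_map (cid Z) r2 r2' -> dact a r1 r2 -> dact a r1' r2'.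
Proof.
elim: a r1 r2 r1' r2' => {Y Z} [Y Z f|Y Z s qs|Y Z W b IHb a IHa] r1 r2 r1' r2' h h' /=.
- move=> hf; have := roof_map_comp h (roof_map_comp hf h').
  by apply: roof_map_htpy; rewrite ccomp1f ccompf1.
- move=> hf; have := roof_map_comp (roof_map_sym h') (roof_map_comp hf (roof_map_sym h)).
  by apply: roof_map_htpy; rewrite ccomp1f ccompf1.
- move=> [r [ha hb]]; exists r; split; first exact: IHa h (roof_map_refl _) ha.
  exact: IHb (roof_map_refl _) h' hb.
Qed.

(** Each rule of [deq] is one of the properties of [roof_map] above. This is the step that turns an
    equality in the generated congruence into an equality of fractions. *)
Lemma dact_deq Y Z (a b : dmor Y Z) : deq a b -> forall r1 r2, dact a r1 r2 <-> dact b r1 r2.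
Proof.
elim=> {Y Z a b} //=.
- by move=> X Y a b _ IH r1 r2; rewrite IH.
- by move=> X Y a b c _ IH _ IH' r1 r2; rewrite IH.
- move=> X Y Z b b' a a' _ IH _ IH' r1 r2.
  by split=> -[r [h h']]; exists r; split; first [exact/IH'|exact/IH].
- move=> W X Y Z c b a r1 r2; split.
    by move=> [r [[r' [h h']] h'']]; exists r'; split=> //; exists r.
  by move=> [r [h [r' [h' h'']]]]; exists r'; split=> //; exists r.
- move=> X Y a r1 r2; split; last by move=> h; exists r2; split=> //; apply: roof_map_refl.
  by move=> [r [h h']]; apply: dact_congr h' h; apply: roof_map_refl.
- move=> X Y a r1 r2; split; last by move=> h; exists r1; split=> //; apply: roof_map_refl.
  by move=> [r [h h']]; apply: (dact_congr h) h'; apply: roof_map_refl.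
- move=> X Y f g E r1 r2; split; apply: roof_map_htpy; apply: homotopic_ext => // i.
- move=> X Y Z g f r1 r3; split; last by move=> [r [h h']]; apply: roof_map_comp h h'.
  move=> h; have [r2 h2] := roof_map_total f r1; exists r2; split=> //.
  have [r3' h3] := roof_map_total g r2.
  have := roof_map_comp h3 (roof_map_fun (roof_map_comp h2 h3) h).
  by apply: roof_map_htpy; rewrite ccomp1f.
- move=> X Y s qs r1 r3; split.
    by move=> [r [h h']]; apply: roof_map_inj h h'; apply/quasi_isoP.
  move=> h; have [r h'] := roof_map_total s r3; exists r; split=> //.
  by have := roof_map_comp h h'; apply: roof_map_htpy; rewrite ccompf1.
- move=> X Y s qs r1 r3; split; first by move=> [r [h h']]; apply: roof_map_fun h h'.
  move=> h; have [r h'] : exists r, roof_map s r r1.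
    by apply: roof_map_surj; apply/quasi_isoP.
  exists r; split=> //.
  by have := roof_map_comp h' h; apply: roof_map_htpy; rewrite ccomp1f.
Qed.

End Roofs.

(** Acting on the identity roof of [X], the two maps produce themselves as fractions over the
    identity of [Y]. *)
Lemma deq_dof {K : fieldType} {C : kcat K} (abC : abelian_kcat C) (X Y : bcx C)
    (f g : cmap X Y) : deq (dof f) (dof g) ->
  exists Q (t : cmap Y Q), coh_iso t /\ homotopic (ccomp t f) (ccomp t g).
Proof.
move/(dact_deq abC) => h.
pose r1 := LRoof (cid X) (@coh_iso_id _ _ X).
pose r2 := LRoof f (@coh_iso_id _ _ Y).
have /h [Q [u [v [qv E1 E2]]]] : dact (dof f) r1 r2.
  exists Y, f, (cid Y); split; first exact: coh_iso_id.
    by apply: homotopic_ext => i /=; rewrite kcompf1 !kcomp1f.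
  by apply: homotopic_ext => i /=; rewrite kcompf1 kcomp1f.
rewrite /= in E1 E2 *; exists Q, v; split=> //.
by rewrite -E2 E1 ccomp1f; exact: homotopic_refl.
Qed.

(** * Shifts *)

Section Shift.
Context {K : fieldType} {C : kcat K}.
Implicit Types X Y Z : bcx C.
#[local] Hint Resolve deq_refl : core.

(** Transport between degrees that are equal but not convertible, such as [succz (i - 1)] and
    [succz i - 1]; the inverse shift cannot avoid it. *)
Definition ctr (X : int -> C) i j (e : i = j) : khom (X i) (X j) :=
  eq_rect i (fun k => khom (X i) (X k)) (kid (X i)) j e.

Lemma ctr_id (X : int -> C) i (e : i = i) : ctr X e = kid (X i).
Proof. by rewrite (eq_irrelevance e erefl). Qed.

Lemma ctr_comp (X : int -> C) i j k (e : i = j) (e' : j = k) :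
  ctr X e' \oc ctr X e = ctr X (etrans e e').
Proof. by case: k / e'; rewrite /= kcomp1f. Qed.

Lemma ctr_nat (X Y : int -> C) (f : forall i, khom (X i) (Y i)) i j (e : i = j) :
  f j \oc ctr X e = ctr Y e \oc f i.
Proof. by case: j / e; rewrite /= kcompf1 kcomp1f. Qed.

Lemma ctr_diff X i j (e : i = j) (e' : succz i = succz j) :
  cdiff X j \oc ctr X e = ctr X e' \oc cdiff X i.
Proof. by case: j / e e' => e'; rewrite /= ctr_id kcompf1 kcomp1f. Qed.

Lemma ctr_succz X i j (e : i = j) :
  ctr (cshift X) e = ctr X (congr1 succz e).
Proof. by case: j / e. Qed.

Lemma succz_sub1 (i : int) : succz (i - 1) = succz i - 1.
Proof. by rewrite /succz; lia. Qed.

Lemma sub1_succz (i : int) : succz i - 1 = i.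
Proof. by rewrite /succz; lia. Qed.

Definition cunshift_diff X (i : int) : khom (X (i - 1)) (X (succz i - 1)) :=
  - (ctr X (succz_sub1 i) \oc cdiff X (i - 1)).

Lemma cunshift_diff2 X i : cunshift_diff X (succz i) \oc cunshift_diff X i = 0.
Proof.
rewrite /cunshift_diff kcompNf kcompfN opprK -!kcompA.
rewrite (kcompA _ (ctr X _)) (ctr_diff X _ (congr1 succz (succz_sub1 i))).
by rewrite -(kcompA (ctr X _)) cdiff2 !kcompf0.
Qed.

Lemma cunshift_bounded X :
  exists n : nat, forall i : int, (n < `|i|)%N -> is_zero (X (i - 1)).
Proof. by have [n hn] := cbounded X; exists n.+1 => i hi; apply: hn; lia. Qed.

Definition cunshift X : bcx C :=
  @BCx K C (fun i => X (i - 1)) (cunshift_diff X) (cunshift_diff2 X) (cunshift_bounded X).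

Lemma cunshiftf_diff X Y (f : cmap X Y) i :
  f (succz i - 1) \oc cdiff (cunshift X) i = cdiff (cunshift Y) i \oc f (i - 1).
Proof.
rewrite /= /cunshift_diff kcompNf kcompfN kcompA (ctr_nat f) -!kcompA.
by rewrite cfun_diff.
Qed.

Definition cunshiftf X Y (f : cmap X Y) : cmap (cunshift X) (cunshift Y) :=
  @CMap K C (cunshift X) (cunshift Y) (fun i => f (i - 1)) (cunshiftf_diff f).

Lemma shunsh_diff X i : ctr X (sub1_succz (succz i)) \oc cdiff (cshift (cunshift X)) i
  = cdiff X i \oc ctr X (sub1_succz i).
Proof.
rewrite /= /cunshift_diff opprK kcompA ctr_comp.
by rewrite (ctr_diff X _ (etrans (succz_sub1 (succz i)) (sub1_succz (succz i)))).
Qed.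
Definition shunsh X : cmap (cshift (cunshift X)) X := CMap (@shunsh_diff X).

Lemma unshsh_diff X i : ctr X (succzK (succz i)) \oc cdiff (cunshift (cshift X)) i
  = cdiff X i \oc ctr X (succzK i).
Proof.
rewrite /= /cunshift_diff /= !kcompfN opprK ctr_succz kcompA ctr_comp.
by rewrite -(ctr_diff X (succzK i)).
Qed.
Definition unshsh X : cmap (cunshift (cshift X)) X := CMap (@unshsh_diff X).

Lemma levelwise_iso X Y (f : cmap X Y) : (forall i, is_iso (f i)) ->
  exists g : cmap Y X, (forall i, g i \oc f i = kid (X i)) /\
                       (forall i, f i \oc g i = kid (Y i)).
Proof.
move=> h; have [g hg] := dep_choice h.
have gd i : g (succz i) \oc cdiff Y i = cdiff X i \oc g i.
  have mf : is_mono (f (succz i)) by apply: is_iso_mono; exists (g (succz i)).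
  apply: mf; rewrite !kcompA cfun_diff (hg _).2 -kcompA (hg _).2.
  by rewrite kcomp1f kcompf1.
by exists (CMap gd); split=> i; case: (hg i).
Qed.

Lemma ctr_is_iso (X : int -> C) i j (e : i = j) : is_iso (ctr X e).
Proof. by exists (ctr X (esym e)); rewrite !ctr_comp !ctr_id. Qed.

Lemma levelwise_diso X Y (f : cmap X Y) : (forall i, is_iso (f i)) -> diso X Y.
Proof. by move/levelwise_iso => [g [gf fg]]; apply: diso_iso gf fg. Qed.

Lemma levelwise_coh_iso X Y (f : cmap X Y) : (forall i, is_iso (f i)) -> coh_iso f.
Proof. by move/levelwise_iso => [g [gf fg]]; apply: coh_iso_iso gf fg. Qed.

Lemma shunsh_iso X i : is_iso (shunsh X i).
Proof. exact: ctr_is_iso. Qed.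

Lemma unshsh_iso X i : is_iso (unshsh X i).
Proof. exact: ctr_is_iso. Qed.

Lemma coh_iso_cshift X Y (f : cmap X Y) : coh_iso (cshiftf f) <-> coh_iso f.
Proof.
split=> h.
- apply: succz_ind => i; split.
  + move=> W x y dx fx; have [||W1 [e1 [x1 [ee1 dx1]]]] := (h i).1 W x (- y).
    * by rewrite /= kcompNf dx oppr0.
    * by rewrite /= kcompNf kcompfN opprK.
    by exists W1, e1, (- x1); split=> //; rewrite kcompfN -kcompNf.
  + move=> W y dy; have [|W1 [e1 [x1 [y1 [ee1 dx1 E]]]]] := (h i).2 W y.
      by rewrite /= kcompNf dy oppr0.
    exists W1, e1, x1, (- y1); split=> //; last by rewrite kcompfN -kcompNf.
    by apply: oppr_inj; rewrite oppr0 -kcompNf.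
- move=> i; split.
  + move=> W x y dx fx; have [||W1 [e1 [x1 [ee1 dx1]]]] := (h (succz i)).1 W x (- y).
    * by apply: oppr_inj; rewrite oppr0 -kcompNf.
    * by rewrite kcompfN -kcompNf.
    by exists W1, e1, (- x1); split=> //; rewrite /= kcompfN kcompNf opprK.
  + move=> W y dy; have [|W1 [e1 [x1 [y1 [ee1 dx1 E]]]]] := (h (succz i)).2 W y.
      by apply: oppr_inj; rewrite oppr0 -kcompNf.
    exists W1, e1, x1, (- y1); split=> //; last by rewrite /= kcompfN kcompNf opprK.
    by rewrite /= kcompNf dx1 oppr0.
Qed.

Lemma exact_at_cshift X i : exact_at (cshift X) i <-> exact_at X (succz i).
Proof.
split=> h W x dx.
  have [|W1 [e1 [y [ee1 dy]]]] := h W x; first by rewrite /= kcompNf dx oppr0.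
  by exists W1, e1, (- y); split=> //; rewrite kcompfN -kcompNf.
have [|W1 [e1 [y [ee1 dy]]]] := h W x.
  by apply: oppr_inj; rewrite oppr0 -kcompNf.
by exists W1, e1, (- y); split=> //; rewrite /= kcompfN kcompNf opprK.
Qed.

Lemma deq_dshift X Y (a b : dmor X Y) : deq a b -> deq (dshift a) (dshift b).
Proof.
elim=> {X Y a b} //=.
- by move=> X Y a b _ h; apply: deq_sym.
- by move=> X Y a b c _ h _ h'; rewrite h.
- by move=> X Y Z b b' a a' _ h _ h'; rewrite h h'.
- by move=> *; rewrite deq_compA.
- by move=> X Y a; rewrite -[X in deq _ X]deq_id_l; apply: deq_comp => //; apply: deq_of.
- by move=> X Y a; rewrite -[X in deq _ X]deq_id_r; apply: deq_comp => //; apply: deq_of.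
- by move=> X Y f g h; apply: deq_of => i /=.
- by move=> X Y Z g f; rewrite -deq_of_comp; apply: deq_of.
- by move=> X Y s qs; rewrite deq_inv_l; apply: deq_of.
- by move=> X Y s qs; rewrite deq_inv_r; apply: deq_of.
Qed.

Lemma diso_cshift X Y : diso X Y -> diso (cshift X) (cshift Y).
Proof.
move=> [a [b [ba ab]]]; exists (dshift a), (dshift b).
by split; [move: (deq_dshift ba)|move: (deq_dshift ab)] => /= ->; apply: deq_of.
Qed.

Hypothesis abC : abelian_kcat C.

Lemma quasi_iso_cunshift X Y (f : cmap X Y) : quasi_iso f -> quasi_iso (cunshiftf f).
Proof.
move/(quasi_isoP abC) => qf; apply/(quasi_isoP abC)/coh_iso_cshift.
have q1 : coh_iso (shunsh Y) by apply: levelwise_coh_iso => i; apply: shunsh_iso.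
apply: (coh_iso_cancell (g := shunsh Y)) => //.
apply: (@coh_iso_homotopic _ _ _ _ (ccomp f (shunsh X))).
  by apply: homotopic_ext => i /=; rewrite (ctr_nat f).
by apply: coh_iso_comp => //; apply: levelwise_coh_iso => i; apply: shunsh_iso.
Qed.

Fixpoint dunshift X Y (a : dmor X Y) : dmor (cunshift X) (cunshift Y) :=
  match a with
  | dof _ _ f => dof (cunshiftf f)
  | dinv _ _ s qs => dinv (quasi_iso_cunshift qs)
  | dcomp _ _ _ b a => dcomp (dunshift b) (dunshift a)
  end.

Lemma deq_dunshift X Y (a b : dmor X Y) : deq a b -> deq (dunshift a) (dunshift b).
Proof.
elim=> {X Y a b} //=.
- by move=> X Y a b _ h; apply: deq_sym.
- by move=> X Y a b c _ h _ h'; rewrite h.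
- by move=> X Y Z b b' a a' _ h _ h'; rewrite h h'.
- by move=> *; rewrite deq_compA.
- by move=> X Y a; rewrite -[X in deq _ X]deq_id_l; apply: deq_comp => //; apply: deq_of.
- by move=> X Y a; rewrite -[X in deq _ X]deq_id_r; apply: deq_comp => //; apply: deq_of.
- by move=> X Y f g h; apply: deq_of => i /=.
- by move=> X Y Z g f; rewrite -deq_of_comp; apply: deq_of.
- by move=> X Y s qs; rewrite deq_inv_l; apply: deq_of.
- by move=> X Y s qs; rewrite deq_inv_r; apply: deq_of.
Qed.

(** The case of a formal inverse in each naturality statement proved by induction on zigzags. *)
Lemma dinv_square X Y X' Y' (s : cmap X Y) (qs : quasi_iso s) (s' : cmap X' Y')
    (qs' : quasi_iso s') (f : dmor X X') (g : dmor Y Y') :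
  deq (dcomp (dof s') f) (dcomp g (dof s)) -> deq (dcomp (dinv qs') g) (dcomp f (dinv qs)).
Proof.
move=> E; rewrite -[g]deq_id_r -(deq_inv_r qs) [dcomp g _]deq_compA -E.
by rewrite -[dcomp (dcomp _ _) (dinv qs)]deq_compA deq_compA deq_inv_l deq_id_l.
Qed.

Lemma unshsh_nat X Y (a : dmor X Y) :
  deq (dcomp (dof (unshsh Y)) (dunshift (dshift a))) (dcomp a (dof (unshsh X))).
Proof.
elim: a => {X Y} [X Y f|X Y s qs|X Y Z b IHb a IHa] /=.
- by rewrite -!deq_of_comp; apply: deq_of => i /=; rewrite (ctr_nat f).
- apply: deq_sym; apply: dinv_square; rewrite -!deq_of_comp.
  by apply: deq_of => i /=; rewrite (ctr_nat s).
- by rewrite deq_compA IHb -deq_compA IHa deq_compA.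
Qed.

Lemma shunsh_nat X Y (a : dmor X Y) :
  deq (dcomp (dof (shunsh Y)) (dshift (dunshift a))) (dcomp a (dof (shunsh X))).
Proof.
elim: a => {X Y} [X Y f|X Y s qs|X Y Z b IHb a IHa] /=.
- by rewrite -!deq_of_comp; apply: deq_of => i /=; rewrite (ctr_nat f).
- apply: deq_sym; apply: dinv_square; rewrite -!deq_of_comp.
  by apply: deq_of => i /=; rewrite (ctr_nat s).
- by rewrite deq_compA IHb -deq_compA IHa deq_compA.
Qed.

Lemma shunsh_coh_iso X : coh_iso (shunsh X).
Proof. by apply: levelwise_coh_iso => i; apply: shunsh_iso. Qed.

Lemma unshsh_coh_iso X : coh_iso (unshsh X).
Proof. by apply: levelwise_coh_iso => i; apply: unshsh_iso. Qed.

Lemma diso_shunsh X : diso (cshift (cunshift X)) X.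
Proof. by apply: levelwise_diso => i; apply: shunsh_iso. Qed.

Lemma diso_unshsh X : diso (cunshift (cshift X)) X.
Proof. by apply: levelwise_diso => i; apply: unshsh_iso. Qed.

Lemma diso_cunshift X Y : diso X Y -> diso (cunshift X) (cunshift Y).
Proof.
move=> [a [b [ba ab]]]; exists (dunshift a), (dunshift b).
by split; [move: (deq_dunshift ba)|move: (deq_dunshift ab)] => /= ->; apply: deq_of.
Qed.

(** The inverse shift recovers a morphism from its shift, through the natural isomorphism
    [unshsh]. *)
Lemma hom0_of_cshift X Y : hom0 (cshift X) (cshift Y) -> hom0 X Y.
Proof.
move=> h a; apply: (coh_iso_mono_deq abC (@unshsh_coh_iso X)).
rewrite -unshsh_nat (deq_dunshift (h (dshift a))) dcomp0l /=.
by rewrite /d0 -deq_of_comp; apply: deq_of => i /=; rewrite kcompf0.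
Qed.

Lemma hom0_of_cunshift X Y : hom0 (cunshift X) (cunshift Y) -> hom0 X Y.
Proof.
move=> h a; apply: (coh_iso_mono_deq abC (@shunsh_coh_iso X)).
rewrite -shunsh_nat (deq_dshift (h (dunshift a))) dcomp0l /=.
by rewrite /d0 -deq_of_comp; apply: deq_of => i /=; rewrite kcompf0.
Qed.

End Shift.

(** * Truncations *)

Ltac slia := unfold succz in *; lia.

Section Truncation.
Context {K : fieldType} {C : kcat K}.
Implicit Types X Y Z S T : bcx C.
#[local] Hint Resolve deq_refl : core.

Lemma is_zero_iso (M N : C) (f : khom M N) : is_zero M -> is_zero N -> is_iso f.
Proof.
move=> zM zN; exists 0; rewrite kcomp0f kcompf0.
by split; [rewrite zM|rewrite zN].
Qed.

(** Since the [m i] are monic, the square-zero condition and boundedness are inherited from [X];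
    only the restricted differential has to be supplied. *)
Lemma ex_subcx X (T : int -> C) (m : forall i, khom (T i) (X i)) :
  (forall i, is_mono (m i)) ->
  (forall i, exists d : khom (T i) (T (succz i)), m (succz i) \oc d = cdiff X i \oc m i) ->
  exists D h1 h2 (f : cmap (@BCx K C T D h1 h2) X), forall i, f i = m i.
Proof.
move=> mm /dep_choice [D hD].
have h1 i : D (succz i) \oc D i = 0.
  by apply: mm; rewrite kcompA hD -kcompA hD kcompA cdiff2 kcomp0f kcompf0.
have h2 : exists n : nat, forall i : int, (n < `|i|)%N -> is_zero (T i).
  have [n hn] := cbounded X; exists n => i /hn zi.
  by apply: mm; rewrite kcompf0 [LHS](is_zero_to _ zi).
by exists D, h1, h2, (@CMap K C (BCx h1 h2) X m hD).
Qed.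

Lemma ex_quotcx X (T : int -> C) (e : forall i, khom (X i) (T i)) :
  (forall i, is_epi (e i)) ->
  (forall i, exists d : khom (T i) (T (succz i)), d \oc e i = e (succz i) \oc cdiff X i) ->
  exists D h1 h2 (f : cmap X (@BCx K C T D h1 h2)), forall i, f i = e i.
Proof.
move=> ee /dep_choice [D hD].
have h1 i : D (succz i) \oc D i = 0.
  by apply: ee; rewrite -kcompA hD kcompA hD -kcompA cdiff2 kcomp0f kcompf0.
have h2 : exists n : nat, forall i : int, (n < `|i|)%N -> is_zero (T i).
  have [n hn] := cbounded X; exists n => i /hn zi.
  by apply: ee; rewrite kcomp0f [LHS](is_zero_from _ zi).
by exists D, h1, h2, (@CMap K C X (BCx h1 h2) e (fun i => esym (hD i))).
Qed.

Definition stalk_at (p : int) X := forall i, i != p -> is_zero (X i).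

Lemma stalk_diff0 p X i : stalk_at p X -> cdiff X i = 0.
Proof.
move=> sX; have [->|ni] := eqVneq i p.
  by apply: is_zero_to; apply: sX; apply/eqP; slia.
by apply: is_zero_from; apply: sX.
Qed.

Lemma ex_map_from_stalk p S X (f : khom (S p) (X p)) : stalk_at p S ->
  cdiff X p \oc f = 0 -> exists F : cmap S X, F p = f.
Proof.
move=> sS df.
have [F [Fp F0]] := dep_update (fun i => 0 : khom (S i) (X i)) f.
have FE i : F (succz i) \oc cdiff S i = cdiff X i \oc F i.
  rewrite (stalk_diff0 i sS) kcompf0; have [->|ni] := eqVneq i p.
    by rewrite Fp.
  by rewrite F0 // kcompf0.
by exists (CMap FE).
Qed.

Lemma ex_map_to_stalk p X S (f : khom (X (succz p)) (S (succz p))) :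
  stalk_at (succz p) S -> f \oc cdiff X p = 0 ->
  exists F : cmap X S, F (succz p) = f.
Proof.
move=> sS fd.
have [F [Fp F0]] := dep_update (fun i => 0 : khom (X i) (S i)) f.
have FE i : F (succz i) \oc cdiff X i = cdiff S i \oc F i.
  rewrite (stalk_diff0 i sS) kcomp0f; have [->|ni] := eqVneq i p.
    by rewrite Fp.
  by rewrite F0 ?kcomp0f //; apply/eqP => /succz_inj/eqP; rewrite (negbTE ni).
by exists (CMap FE).
Qed.

Lemma stalk_map_iso p S X (f : cmap S X) : stalk_at p S -> stalk_at p X ->
  is_iso (f p) -> forall i, is_iso (f i).
Proof.
move=> sS sX fp i; have [->|ni] // := eqVneq i p.
by apply: is_zero_iso; [apply: sS|apply: sX].
Qed.

Lemma stalk_diso p S X (f : khom (S p) (X p)) :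
  stalk_at p S -> stalk_at p X -> is_iso f -> diso S X.
Proof.
move=> sS sX fi; have [|F Fp] := ex_map_from_stalk (f := f) sS.
  by rewrite (stalk_diff0 p sX) kcomp0f.
by apply: (levelwise_diso (f := F)); apply: (stalk_map_iso sS sX); rewrite Fp.
Qed.

(** The canonical truncation in degrees at most [a], as a property of [f]: its terms are determined
    only up to isomorphism, which avoids transports between degrees. *)
Definition truncation (a : int) T X (f : cmap T X) :=
  [/\ forall i, i < a -> is_iso (f i), is_kernel (cdiff X a) (f a)
    & forall i, a < i -> is_zero (T i)].

Lemma truncation_mono a T X (f : cmap T X) i : truncation a f -> is_mono (f i).
Proof.
move=> [h1 h2 h3]; have [ia|ai|->] := ltgtP i a.
- by apply: is_iso_mono; apply: h1.
- by move=> W u v _; rewrite [u](is_zero_to _ (h3 _ ai)) [v](is_zero_to _ (h3 _ ai)).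
- exact: is_kernel_mono h2.
Qed.

Lemma truncation_lift_lt a T X (f : cmap T X) i W (x : khom W (X i)) :
  truncation a f -> i < a -> exists y, f i \oc y = x.
Proof. by move=> [h _ _] /h [g [_ fg]]; exists (g \oc x); rewrite kcompA fg kcomp1f. Qed.

Lemma truncation_lift a T X (f : cmap T X) i W (x : khom W (X i)) :
  truncation a f -> i <= a -> cdiff X i \oc x = 0 -> exists y, f i \oc y = x.
Proof.
move=> tf; rewrite le_eqVlt => /predU1P[ia|ia]; last by move=> _; exact: truncation_lift_lt tf ia.
by move: x; rewrite ia => x dx; case: tf => _ kf _; apply: is_kernel_lift kf dx.
Qed.

Lemma truncation_lift0 a T X (f : cmap T X) i W (y : khom W (T i)) :
  truncation a f -> cdiff X i \oc (f i \oc y) = 0 -> cdiff T i \oc y = 0.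
Proof.
move=> tf d; apply: (truncation_mono tf).
by rewrite kcompf0 kcompA cfun_diff -kcompA.
Qed.

Lemma truncation_exact_low a T X (f : cmap T X) i :
  truncation a f -> i < a -> exact_at X i -> exact_at T i.
Proof.
move=> tf ia eX W x dx; have [|W1 [e1 [y [ee1 dy]]]] := eX W (f (succz i) \oc x).
  by rewrite kcompA -cfun_diff -kcompA dx kcompf0.
have [z fz] := truncation_lift_lt y tf ia; exists W1, e1, z; split=> //.
by apply: (truncation_mono tf); rewrite !kcompA cfun_diff -kcompA fz.
Qed.

Lemma truncation_exact_high a T X (f : cmap T X) i :
  truncation a f -> a <= i -> exact_at T i.
Proof.
move=> [_ _ zT] ai W x dx; exists W, (kid W), 0; split; first exact: is_epi_id.
by rewrite kcompf0 [x]is_zero_to ?kcomp0f //; apply: zT; slia.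
Qed.

(** Since [exact_at X i] concerns degree i + 1, the hypothesis is that the cohomology vanishes in
    all degrees above [a], the only ones that truncation affects. *)
Lemma truncation_coh_iso a T X (f : cmap T X) :
  truncation a f -> (forall i, a <= i -> exact_at X i) -> coh_iso f.
Proof.
move=> tf eX i; have [ia|ai] := ltP i a; split.
- move=> W x y dx fx; have [z fz] := truncation_lift_lt y tf ia.
  exists W, (kid W), z; split; first exact: is_epi_id.
  apply: (truncation_mono tf); rewrite kcompf1 fx.
  by rewrite kcompA cfun_diff -kcompA fz.
- move=> W y dy; have [|z fz] := truncation_lift tf _ dy; first by slia.
  exists W, (kid W), z, 0; split; first exact: is_epi_id.
    by apply: (truncation_lift0 tf); rewrite fz.
  by rewrite fz kcompf0 addr0 kcompf1.
- by move=> W x y dx _; apply: (truncation_exact_high tf ai).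
- move=> W y dy; have [W1 [e1 [z [ee1 dz]]]] := eX i ai W y dy.
  by exists W1, e1, 0, z; split; rewrite ?kcompf0 ?add0r.
Qed.

Lemma truncation_map a T X (f : cmap T X) T' Y (g : cmap T' Y) (t : cmap X Y) :
  truncation a f -> truncation a g ->
  exists t' : cmap T T', forall i, g i \oc t' i = t i \oc f i.
Proof.
move=> tf tg.
have h i : exists t' : khom (T i) (T' i), g i \oc t' = t i \oc f i.
  have [ia|ai] := leP i a; last first.
    case: tf => _ _ /(_ i ai) z; exists 0.
    by rewrite kcompf0 (is_zero_from (_ \oc _) z).
  move: ia; rewrite le_eqVlt => /predU1P[ia|ia]; last exact: truncation_lift_lt tg ia.
  apply: (truncation_lift tg); first by rewrite ia.
  rewrite kcompA -cfun_diff -kcompA ia; case: tf => _ [-> _] _.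
  by rewrite kcompf0.
have [t' ht] := dep_choice h.
have td i : t' (succz i) \oc cdiff T i = cdiff T' i \oc t' i.
  apply: (truncation_mono tg).
  by rewrite !kcompA ht cfun_diff -kcompA cfun_diff kcompA cfun_diff -!kcompA ht.
by exists (CMap td).
Qed.

Lemma truncation_map_coh_iso a T X (f : cmap T X) T' Y (g : cmap T' Y) (t : cmap X Y)
    (t' : cmap T T') : truncation a f -> truncation a g ->
  (forall i, g i \oc t' i = t i \oc f i) -> coh_iso t -> coh_iso t'.
Proof.
move=> tf tg E qt i; have [ia|ai] := ltP i a; split.
- move=> W x y dx tx.
  have [||W1 [e1 [x1 [ee1 dx1]]]] := (qt i).1 W (f (succz i) \oc x) (g i \oc y).
  + by rewrite kcompA -cfun_diff -kcompA dx kcompf0.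
  + by rewrite kcompA -E -kcompA tx !kcompA cfun_diff.
  have [z fz] := truncation_lift_lt x1 tf ia; exists W1, e1, z; split=> //.
  by apply: (truncation_mono tf); rewrite !kcompA cfun_diff -kcompA fz.
- move=> W y dy; have [|W1 [e1 [x1 [y1 [ee1 dx1 E1]]]]] := (qt i).2 W (g (succz i) \oc y).
    by rewrite kcompA -cfun_diff -kcompA dy kcompf0.
  have [|x2 fx2] := truncation_lift tf _ dx1; first by slia.
  have [y2 gy2] := truncation_lift_lt y1 tg ia.
  exists W1, e1, x2, y2; split=> //.
    by apply: (truncation_lift0 tf); rewrite fx2.
  apply: (truncation_mono tg).
  by rewrite kcompDr !kcompA E cfun_diff -!kcompA fx2 gy2 E1 kcompA.
- by move=> W x y dx _; apply: (truncation_exact_high tf ai).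
- move=> W y dy; have [W1 [e1 [z [ee1 dz]]]] := truncation_exact_high tg ai dy.
  by exists W1, e1, 0, z; split; rewrite ?kcompf0 ?add0r.
Qed.

Hypothesis abC : abelian_kcat C.

Lemma ex_truncation a X : exists T (f : cmap T X), truncation a f.
Proof.
have h i : exists p : {M : C & khom M (X i)},
  [/\ i < a -> is_iso (projT2 p), i = a -> is_kernel (cdiff X i) (projT2 p)
    & a < i -> is_zero (projT1 p)].
  have [ia|ai|ia] := ltgtP i a.
  - exists (existT _ (X i) (kid (X i))); split=> //=; last by slia.
    by exists (kid (X i)); rewrite !kcomp1f.
  - exists (existT _ (kzero C) (0 : khom (kzero C) (X i))); split=> //=; last by move=> _; apply: kid_zero.
    by slia.
  - have [M [k kk]] := ex_kernel abC (cdiff X i).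
    by exists (existT _ M k); split=> //=; slia.
have {h}[p hp] := dep_choice h.
have mp i : is_mono (projT2 (p i)).
  case: (hp i) => h1 h2 h3; have [ia|ai|ia] := ltgtP i a.
  - by apply: is_iso_mono; apply: h1.
  - by move=> W u v _; rewrite [u](is_zero_to _ (h3 _)) // [v](is_zero_to _ (h3 _)).
  - exact: is_kernel_mono (h2 _).
have [i|D [h1 [h2 [f hf]]]] := ex_subcx mp.
  have [sa|sa] := leP (succz i) a.
    have [_ _ _] := hp i.
    have [l1 l2 _] := hp (succz i); move: sa; rewrite le_eqVlt => /predU1P[/l2 sa|/l1 sa].
      by apply: is_kernel_lift sa _; rewrite kcompA cdiff2 kcomp0f.
    case: sa => g [_ pg]; exists (g \oc (cdiff X i \oc projT2 (p i))).
    by rewrite kcompA pg kcomp1f.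
  exists 0; rewrite kcompf0; case: (hp i) => _ h2 h3.
  have [ia|ia|ia] := ltgtP i a; first by slia.
    by rewrite (is_zero_from (_ \oc _) (h3 ia)).
  by case: (h2 ia).
exists (BCx h1 h2), f; split=> [i ia||i ai].
- by rewrite hf; case: (hp i) => + _ _; apply.
- by rewrite hf; case: (hp a) => _ + _; apply.
- by case: (hp i) => _ _; apply.
Qed.

(** Functoriality of truncation on zigzags. A formal inverse truncates to a formal inverse by
    [truncation_map_coh_iso], and the middle object of a composite is truncated afresh. *)
Lemma truncation_dmor a T X (f : cmap T X) T' Y (g : cmap T' Y) (t : dmor X Y) :
  truncation a f -> truncation a g ->
  exists t' : dmor T T', deq (dcomp (dof g) t') (dcomp t (dof f)).
Proof.
elim: t T T' f g => {X Y} [X Y t|X Y s qs|X Y Z b IHb c IHc] T T' f g tf tg.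
- have [t' ht] := truncation_map t tf tg; exists (dof t').
  by rewrite -!deq_of_comp; apply: deq_of.
- have [s' hs] := truncation_map s tg tf.
  have qs' : quasi_iso s'.
    apply/(quasi_isoP abC); apply: truncation_map_coh_iso tg tf hs _.
    exact/(quasi_isoP abC).
  exists (dinv qs'); apply: deq_sym; apply: dinv_square; rewrite -!deq_of_comp.
  by apply: deq_of.
- have [U [h th]] := ex_truncation a Y.
  have [c' hc] := IHc _ _ f h tf th; have [b' hb] := IHb _ _ h g th tg.
  by exists (dcomp b' c'); rewrite deq_compA hb -deq_compA hc deq_compA.
Qed.

(** The cohomology of [X] lies in degrees at most [a], that of [Y] in degrees above [a]. A morphism
    thus factors through the truncation of [Y], which is acyclic. *)
Lemma hom0_orthogonal a X Y :
  (forall i, a <= i -> exact_at X i) -> (forall i, i < a -> exact_at Y i) -> hom0 X Y.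
Proof.
move=> hX hY t; have [T [f tf]] := ex_truncation a X.
have [T' [g tg]] := ex_truncation a Y; have [t' ht] := truncation_dmor t tf tg.
apply: (coh_iso_mono_deq abC (truncation_coh_iso tf hX)); rewrite -ht dcomp0l.
have aT' : acyclic T'.
  move=> i; have [ia|ai] := ltP i a; last exact: truncation_exact_high tg ai.
  by apply: (truncation_exact_low tg) => //; apply: hY.
by rewrite (hom0_idr (acyclic_d0 abC aT') t') dcomp0r.
Qed.

(** If [T] is a truncation at b + 1, its term in that degree consists of cocycles, and [S] is the
    stalk of its top cohomology. *)
Definition coh_quotient b T S (p : cmap T S) :=
  stalk_at (succz b) S /\ is_cokernel (cdiff T b) (p (succz b)).

Lemma ex_coh_quotient b T : exists S (p : cmap T S), coh_quotient b p.
Proof.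
have [Q [c cc]] := ex_cokernel abC (cdiff T b).
have [S0 [S0b S0n]] := dep_update (fun i : int => kzero C) (n := succz b) Q.
have zD i : is_zero (S0 i) \/ is_zero (S0 (succz i)).
  have [ib|ib] := eqVneq i (succz b); last by left; rewrite S0n //; apply: kid_zero.
  by right; rewrite S0n; [apply: kid_zero|apply/eqP; slia].
pose D i : khom (S0 i) (S0 (succz i)) := 0.
have D2 i : D (succz i) \oc D i = 0 by rewrite kcomp0f.
have Db : exists n : nat, forall i : int, (n < `|i|)%N -> is_zero (S0 i).
  exists `|succz b|%N => i hi; rewrite S0n; first exact: kid_zero.
  by apply/eqP => E; rewrite E ltnn in hi.
pose S := @BCx K C S0 D D2 Db.
have sS : stalk_at (succz b) S by move=> i ni /=; rewrite /= S0n //; apply: kid_zero.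
have [c' cc'] : exists c' : khom (T (succz b)) (S (succz b)), is_cokernel (cdiff T b) c'.
  by rewrite /= S0b; exists c.
have [|p pE] := ex_map_to_stalk (f := c') sS; first by case: cc'.
by exists S, p; split=> //; rewrite pE.
Qed.

Lemma coh_quotient_coh_iso b T S (p : cmap T S) : coh_quotient b p ->
  is_zero (T (succz (succz b))) -> (forall i, i != b -> exact_at T i) -> coh_iso p.
Proof.
move=> [sS cp] zT eT i; split.
- move=> W x y dx px; have [ib|/eT] := eqVneq i b; last exact.
  rewrite ib in x y dx px *; apply: (coker_lift abC cp).
  by rewrite px (stalk_diff0 _ sS) kcomp0f.
- move=> W y dy; have [ib|ib] := eqVneq i b.
    rewrite ib in y dy *.
    have [W1 [e1 [x [ee1 px]]]] := epi_lift abC y (is_cokernel_epi cp).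
    exists W1, e1, x, 0; split=> //; last by rewrite px kcompf0 addr0.
    by rewrite (is_zero_to (cdiff T _) zT) kcomp0f.
  exists W, (kid W), 0, 0; split; rewrite ?kcompf0 //; first exact: is_epi_id.
  rewrite addr0 [y](is_zero_to _ (sS _ _)) ?kcomp0f //.
  by apply/eqP => /succz_inj/eqP; rewrite (negbTE ib).
Qed.

(* X has at most one nonzero cohomology object, in degree p. *)
Definition concentrated (p : int) X := forall i, succz i != p -> exact_at X i.

Lemma stalk_concentrated p X : stalk_at p X -> concentrated p X.
Proof.
move=> sX i ni W x dx; exists W, (kid W), 0; split; first exact: is_epi_id.
by rewrite kcompf0 [x](is_zero_to _ (sX _ ni)) kcomp0f.
Qed.

(** Truncation at [p] followed by passage to the cohomology in degree [p] gives two
    quasi-isomorphisms connecting [X] with a stalk. *)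
Lemma concentrated_stalk p X : concentrated p X -> exists S, stalk_at p S /\ diso X S.
Proof.
elim/succz_ind: p => b cX; have [T [f tf]] := ex_truncation (succz b) X.
have [S [p hp]] := ex_coh_quotient b T; exists S; split; first by case: hp.
have qf : coh_iso f.
  by apply: (truncation_coh_iso tf) => i ib; apply: cX; apply/eqP; slia.
apply: diso_trans (diso_sym (diso_coh_iso abC qf)) _; apply: (diso_coh_iso abC (f := p)).
apply: (coh_quotient_coh_iso hp).
  by case: tf => _ _; apply; slia.
move=> i ib; have [ii|ii] := ltP i (succz b); last exact: truncation_exact_high tf ii.
apply: (truncation_exact_low tf) => //; apply: cX.
by apply/eqP => /succz_inj/eqP; rewrite (negbTE ib).
Qed.

Lemma coh_quotient_map b T X (f : cmap T X) S (p : cmap T S)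
    T' Y (g : cmap T' Y) S' (p' : cmap T' S') (t : cmap X Y) (t' : cmap T T') :
  truncation (succz b) f -> truncation (succz b) g ->
  coh_quotient b p -> coh_quotient b p' ->
  (forall i, g i \oc t' i = t i \oc f i) ->
  exists h : cmap S S', (forall i, h i \oc p i = p' i \oc t' i) /\
    (quasi_iso t -> forall i, is_iso (h i)).
Proof.
move=> tf tg [sS cp] [sS' cp'] E.
have [h0 h0E] : exists h0, h0 \oc p (succz b) = p' (succz b) \oc t' (succz b).
  apply: is_cokernel_desc cp _; rewrite -kcompA cfun_diff kcompA.
  by case: cp' => -> _; rewrite kcomp0f.
have [|h hb] := ex_map_from_stalk (f := h0) sS.
  by rewrite (stalk_diff0 _ sS') kcomp0f.
exists h; split=> [i|qt].
  have [->|ni] := eqVneq i (succz b); first by rewrite hb.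
  by rewrite (is_zero_to (_ \oc _) (sS' i ni)) (is_zero_to (p' i) (sS' i ni)) kcomp0f.
have bb : b < succz b by slia.
(* In degree b + 1 the maps [f1] and [p1] present the cohomology of [X1] in the sense of
   [is_cohomology], so [quasi_iso] can be applied to them as it stands. *)
have coh T1 X1 (f1 : cmap T1 X1) S1 (p1 : cmap T1 S1) :
    truncation (succz b) f1 -> is_cokernel (cdiff T1 b) (p1 (succz b)) ->
    exists b1, @is_cohomology K C X1 b (T1 (succz b)) (S1 (succz b))
      (f1 (succz b)) b1 (p1 (succz b)).
  move=> [/(_ b bb) [k [kf fk]] kf1 _] [cd cu]; exists (cdiff T1 b \oc k); split=> //.
    by rewrite kcompA cfun_diff -kcompA fk kcompf1.
  split; first by rewrite kcompA cd kcomp0f.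
  move=> W u ud; apply: cu.
  by rewrite -[cdiff T1 b]kcompf1 -kf !kcompA -(kcompA u) ud kcomp0f.
have [b1 H1] := coh _ _ _ _ _ tf cp; have [b2 H2] := coh _ _ _ _ _ tg cp'.
have [u [v [hu hv vi]]] := qt _ _ _ _ _ _ _ _ _ _ _ H1 H2.
have ut : u = t' (succz b) by apply: (truncation_mono tg); rewrite hu E.
have vh : v = h (succz b).
  by apply: (is_cokernel_epi cp); rewrite hv ut hb h0E.
by apply: (stalk_map_iso sS sS'); rewrite -vh.
Qed.

(** The induced [h] is an honest chain map even for a zigzag, because a quasi-isomorphism induces a
    map of stalks that is invertible degree by degree. This is what [stalk_full] relies on. *)
Lemma coh_quotient_dmor b T X (f : cmap T X) S (p : cmap T S)
    T' Y (g : cmap T' Y) S' (p' : cmap T' S') (t : dmor X Y) :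
  truncation (succz b) f -> truncation (succz b) g ->
  coh_quotient b p -> coh_quotient b p' ->
  exists (t' : dmor T T') (h : cmap S S'),
    deq (dcomp (dof g) t') (dcomp t (dof f)) /\
    deq (dcomp (dof p') t') (dcomp (dof h) (dof p)).
Proof.
elim: t T T' f g S S' p p' => {X Y} [X Y t|X Y s qs|X Y Z d IHd c IHc]
  T T' f g S S' p p' tf tg hp hp'.
- have [t' ht] := truncation_map t tf tg.
  have [h [hE _]] := coh_quotient_map tf tg hp hp' ht.
  by exists (dof t'), h; rewrite -!deq_of_comp; split; apply: deq_of => // i; rewrite /= hE.
- have [s' hs] := truncation_map s tg tf.
  have qs' : quasi_iso s'.
    apply/(quasi_isoP abC); apply: truncation_map_coh_iso tg tf hs _.
    exact/(quasi_isoP abC).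
  have [h [hE /(_ qs)/levelwise_iso [k [kh hk]]]] := coh_quotient_map tg tf hp' hp hs.
  exists (dinv qs'), k; split.
    apply: deq_sym; apply: dinv_square; rewrite -!deq_of_comp.
    by apply: deq_of.
  apply: (coh_iso_mono_deq abC (s := s')); first exact/(quasi_isoP abC).
  rewrite -deq_compA deq_inv_l -!deq_of_comp; apply: deq_of => i /=.
  by rewrite kcompf1 -kcompA -hE kcompA kh kcomp1f.
- have [U [l tl]] := ex_truncation (succz b) Y.
  have [R [q hq]] := ex_coh_quotient b U.
  have [c' [hc [c1 c2]]] := IHc _ _ f l _ _ _ _ tf tl hp hq.
  have [d' [hd [d1 d2]]] := IHd _ _ l g _ _ _ _ tl tg hq hp'.
  exists (dcomp d' c'), (ccomp hd hc); split.
    by rewrite deq_compA d1 -deq_compA c1 deq_compA.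
  by rewrite deq_compA d2 -deq_compA c2 deq_compA deq_of_comp.
Qed.

(** For stalks both the truncation and the passage to cohomology are isomorphisms of complexes, so
    the chain map of [coh_quotient_dmor] recovers [t]. *)
Lemma stalk_full p X Y (t : dmor X Y) : stalk_at p X -> stalk_at p Y ->
  exists f : cmap X Y, deq t (dof f).
Proof.
elim/succz_ind: p => b sX sY.
have key Z : stalk_at (succz b) Z -> exists T (f : cmap T Z) S (q : cmap T S),
    [/\ truncation (succz b) f, coh_quotient b q, forall i, is_iso (f i)
      & forall i, is_iso (q i)].
  move=> sZ; have [T [f tf]] := ex_truncation (succz b) Z.
  have fi : is_iso (f (succz b)).
    have [g fg] := truncation_lift (x := kid _) tf (lexx _)
      ltac:(by rewrite (stalk_diff0 _ sZ) kcomp0f).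
    exists g; split=> //; apply: (truncation_mono tf).
    by rewrite kcompA fg kcomp1f kcompf1.
  have sT : stalk_at (succz b) T.
    move=> i ni; apply: (truncation_mono tf).
    by rewrite kcompf0 kcompf1 (is_zero_to (f i) (sZ i ni)).
  have [S [q hq]] := ex_coh_quotient b T; exists T, f, S, q; split=> //.
    exact: stalk_map_iso sT sZ fi.
  case: (hq) => sS cq; apply: (stalk_map_iso sT sS); apply: (balanced abC).
    apply/is_monoP => W x qx; have [W1 [e1 [y [ee1 dy]]]] := coker_lift abC cq qx.
    move/is_epiP: ee1; apply; by rewrite -dy (stalk_diff0 _ sT) kcomp0f.
  exact: is_cokernel_epi cq.
have [T [f [S [q [tf hq fi qi]]]]] := key X sX.
have [T' [g [S' [q' [tg hq' gi qi']]]]] := key Y sY.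
have [t' [h [E1 E2]]] := coh_quotient_dmor t tf tg hq hq'.
have [f' [_ ff']] := levelwise_iso fi; have [r [rq' qr']] := levelwise_iso qi'.
exists (ccomp (ccomp g (ccomp r (ccomp h q))) f').
apply: (coh_iso_mono_deq abC (levelwise_coh_iso fi)).
rewrite -E1.
have -> : deq t' (dof (ccomp r (ccomp h q))).
  apply: (coh_iso_epi_deq abC (levelwise_coh_iso qi')).
  rewrite E2 -!deq_of_comp; apply: deq_of => i /=.
  by rewrite !kcompA qr' kcomp1f.
have [k [kf fk]] := levelwise_iso fi.
have f'f i : f' i \oc f i = kid (T i).
  by apply: (is_iso_mono (fi i)); rewrite kcompA ff' kcomp1f kcompf1.
rewrite -!deq_of_comp; apply: deq_of => i /=.
by rewrite -!kcompA f'f kcompf1.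
Qed.

End Truncation.

(** * Splitting in the derived category of a hereditary category *)

Section Hereditary.
Context {K : fieldType} {C : kcat K}.
Implicit Types X Y Z S T : bcx C.
#[local] Hint Resolve deq_refl : core.
Hypothesis abC : abelian_kcat C.

Definition idem_trivial X := forall e : dmor X X,
  deq (dcomp e e) e -> deq e (d0 X X) \/ deq e (did X).

Lemma idem_trivial_diso X Y : diso X Y -> idem_trivial X -> idem_trivial Y.
Proof.
move=> [a [b [ba ab]]] h e ee.
have E : deq e (dcomp a (dcomp (dcomp b (dcomp e a)) b)).
  by rewrite -!deq_compA ab deq_id_r deq_compA ab deq_id_l.
have [|e0|e1] := h (dcomp b (dcomp e a)).
- rewrite -deq_compA [dcomp (dcomp e a) _]deq_compA -[dcomp (dcomp e a) b]deq_compA.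
  by rewrite ab deq_id_r [dcomp e (dcomp e a)]deq_compA ee.
- by left; rewrite E e0 dcomp0l dcomp0r.
- by right; rewrite E e1 deq_id_l ab.
Qed.

(** If the identity vanishes in the localization, some quasi-isomorphism [t] out of [X] is
    null-homotopic, while it is injective on cohomology. *)
Lemma did0_acyclic X : deq (did X) (d0 X X) -> acyclic X.
Proof.
move/(deq_dof abC) => [Q [t [qt /homotopic_subP/homotopic0P [h hE]]]] i W x dx.
apply: ((qt i).1 W x (h i \oc x) dx).
have := congr1 (fun f => f \oc x) (hE i).
by rewrite csubE /= kcompf1 kcompf0 subr0 kcompDl -!kcompA dx kcompf0 addr0.
Qed.

(** Brings a stalk to the form in which [ext_vanishes] is stated. *)
Lemma stalk_iter_cshift (k : nat) Y : stalk_at (- k%:Z) Y ->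
  exists N : C, diso Y (iter k cshift (cstalk N)).
Proof.
elim: k Y => [|k IH] Y sY.
  exists (Y 0); apply: (@stalk_diso _ _ 0 Y (cstalk (Y 0)) (kid (Y 0))) => //.
  - by move=> i /negbTE i0 /=; rewrite i0; apply: kid_zero.
  - by exists (kid (Y 0)); rewrite !kcomp1f.
have [|N hN] := IH (cunshift Y).
  by move=> i ni; apply: sY; apply/eqP => E; move/eqP: ni; apply; lia.
exists N; rewrite iterS; apply: diso_trans (diso_cshift hN).
exact: diso_sym (diso_shunsh _).
Qed.

Lemma stalk_at_cshift p X : stalk_at p X -> stalk_at (p - 1) (cshift X).
Proof. by move=> sX i ni; apply: sX; apply/eqP => E; move/eqP: ni; apply; slia. Qed.

Lemma stalk_at_cunshift p X : stalk_at p X -> stalk_at (p + 1) (cunshift X).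
Proof. by move=> sX i ni; apply: sX; apply/eqP => E; move/eqP: ni; apply; slia. Qed.

Hypothesis heC : hereditary C.

(** Shifting moves [p] to 0; there the morphisms form Ext^n(M, N) with n = -q at least 2. *)
Lemma hom0_ext2 p q X Y : stalk_at p X -> stalk_at q Y -> q + 2 <= p -> hom0 X Y.
Proof.
have [n] := ubnP `|p|%N; elim: n p q X Y => // n IH p q X Y pn sX sY pq.
have [p0|p0|p0] := ltgtP p 0.
- apply: (hom0_of_cunshift abC).
  apply: IH (stalk_at_cunshift sX) (stalk_at_cunshift sY) _; lia.
- apply: hom0_of_cshift abC _ _ _.
  apply: IH (stalk_at_cshift sX) (stalk_at_cshift sY) _; lia.
- rewrite {}p0 in sX pq.
  have [M hM] := @stalk_iter_cshift 0 X sX.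
  have [N hN] := @stalk_iter_cshift `|q|%N Y ltac:(by move: sY; rewrite (_ : - _ = q) //; lia).
  apply: hom0_diso (diso_sym hM) (diso_sym hN) _.
  by apply: heC; lia.
Qed.

(** For p < q this is orthogonality of truncations; otherwise p is at least q + 2 and heredity
    applies. *)
Lemma hom0_concentrated p q X Y : concentrated p X -> concentrated q Y ->
  (p != q) && (p != q + 1) -> hom0 X Y.
Proof.
move=> cX cY /andP[n1 n2]; have [pq|pq] := ltP p q.
  apply: (hom0_orthogonal abC (a := p)) => i ip; first by apply: cX; apply/eqP; slia.
  by apply: cY; apply/eqP; slia.
have [S [sS dS]] := concentrated_stalk abC cX.
have [T [sT dT]] := concentrated_stalk abC cY.
apply: hom0_diso (diso_sym dS) (diso_sym dT) _; apply: hom0_ext2 sS sT _.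
by lia.
Qed.

Lemma ex_brutal d X : exists S (e : cmap X S),
  (forall i, i <= d -> is_iso (e i)) /\ (forall i, d < i -> is_zero (S i)).
Proof.
have h i : exists p : {M : C & khom (X i) M},
  (i <= d -> is_iso (projT2 p)) /\ (d < i -> is_zero (projT1 p)).
  have [id|di] := leP i d.
    exists (existT _ (X i) (kid (X i))); split=> //= _.
    by exists (kid (X i)); rewrite !kcomp1f.
  exists (existT _ (kzero C) (0 : khom (X i) (kzero C))); split=> //= _.
  exact: kid_zero.
have {h}[p hp] := dep_choice h.
have ep i : is_epi (projT2 (p i)).
  case: (hp i) => h1 h2; have [id|di] := leP i d; first exact: is_iso_epi (h1 id).
  by move=> W u v _; rewrite [u](is_zero_from _ (h2 _)) // [v](is_zero_from _ (h2 _)).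
have [i|D [h1 [h2 [f hf]]]] := ex_quotcx ep.
  have [sd|sd] := leP (succz i) d.
    case: (hp i) => /(_ ltac:(slia)) [g [gp _]] _.
    exists (projT2 (p (succz i)) \oc cdiff X i \oc g).
    by rewrite -kcompA gp kcompf1.
  exists 0; rewrite kcomp0f; case: (hp (succz i)) => _ /(_ sd) z.
  by rewrite (is_zero_to (_ \oc _) z).
exists (BCx h1 h2), f; split=> [i ia|i ai].
- by rewrite hf; case: (hp i) => + _; apply.
- by case: (hp i) => _; apply.
Qed.

Lemma levelwise_exact_at X S (e : cmap X S) i : is_iso (e (succz i)) ->
  is_mono (e (succz (succz i))) -> exact_at X i -> exact_at S i.
Proof.
move=> [g [ge eg]] me eX W x dx.
have [|W1 [e1 [y [ee1 dy]]]] := eX W (g \oc x).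
  apply: me; rewrite kcompf0 kcompA cfun_diff -kcompA (kcompA _ g) eg kcomp1f //.
exists W1, e1, (e i \oc y); split=> //.
by rewrite kcompA -cfun_diff -kcompA dy !kcompA eg kcomp1f.
Qed.

(** * Splitting off the lowest cohomology of a complex *)

Section BottomSplitting.
Variables (Z : bcx C) (D : int).
Hypothesis Z_low : forall i, i < D -> exact_at Z i.
Variables (T : bcx C) (iota : cmap T Z).
Hypothesis tT : truncation (succz D) iota.

Lemma bottom_concentrated : concentrated (succz D) T.
Proof.
move=> i ni; have [iD|Di] := ltP i (succz D); last exact: truncation_exact_high tT Di.
by apply: (truncation_exact_low tT) => //; apply: Z_low; move/eqP: ni; slia.
Qed.

(* The cohomology of Z in its lowest degree D + 1 splits off: the obstruction is
   an element of Ext^2 of the cokernel of Z^(D+1) -> Z^(D+2), realized here by the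
   inclusion of that cokernel in the cone of the brutal truncation of Z onto it. *)
Lemma bottom_retraction : exists r : dmor (cshift Z) (cshift T),
  deq (dcomp r (dof (cshiftf iota))) (did (cshift T)).
Proof.
(* As [B] stops in degree D + 2, its cohomology lies in degree D + 1, where it agrees with that of
   [Z], and in degree D + 2, where it is the cokernel [S]. *)
have [B [e [eiso eB]]] := ex_brutal (succz (succz D)) Z.
have [S [q [sS cq]]] := ex_coh_quotient abC (succz D) B.
have [Q [u [v [j [p cQ]]]]] := ex_cone abC q; have [bQ Ej Ep] := cQ.
have qd i : q (succz i) \oc cdiff B i = 0.
  by rewrite cfun_diff (stalk_diff0 _ sS) kcomp0f.
have Bexact i : i < D -> exact_at B i.
  move=> iD; apply: (@levelwise_exact_at Z B e) (Z_low iD); first by apply: eiso; slia.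
  by apply: is_iso_mono; apply: eiso; slia.
(* On cohomology [q] is an isomorphism in degree D + 2, so its cone retains only the cohomology of
   [B] in degree D + 1, moved to degree D. *)
have Qexact : concentrated D Q.
  move=> i iD W x dx.
  have da : cdiff B (succz (succz i)) \oc (v (succz i) \oc x) = 0.
    by apply: oppr_inj; rewrite oppr0 kcompA -kcompNf -(cone_diffv _ cQ) -kcompA dx kcompf0.
  have qa : q (succz (succz i)) \oc (v (succz i) \oc x) = 0.
    have : p (succz (succz i)) \oc (cdiff Q (succz i) \oc x) = 0 by rewrite dx kcompf0.
    by rewrite kcompA Ep (stalk_diff0 _ sS) kcomp0f addr0 -kcompA.
  (* With such an [a], the element -(j a) of the cone has differential [x]. *)
  have [W1 [e1 [a [ee1 da1 qa1]]]] : exists W1 (e1 : khom W1 W) (a : khom W1 (B (succz i))),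
      [/\ is_epi e1, cdiff B (succz i) \oc a = v (succz i) \oc x \oc e1
        & q (succz i) \oc a = - (p (succz i) \oc x \oc e1)].
    have [lt|gt|E] := ltgtP (succz i) (succz (succz D)); last 1 first.
    - have Ei : i = succz D by apply: succz_inj.
      subst i.
      have [W1 [e1 [a [ee1 qa1]]]] :=
        epi_lift abC (- (p (succz (succz D)) \oc x)) (is_cokernel_epi cq).
      exists W1, e1, a; split=> //; last by rewrite qa1 kcompNf.
      have zB : is_zero (B (succz (succz (succz D)))) by apply: eB; slia.
      by rewrite (is_zero_to (_ \oc a) zB) (is_zero_to (_ \oc e1) zB).
    - have zS : is_zero (S (succz i)) by apply: sS; apply/eqP; slia.
      have [iD'|iD'] := eqVneq i D.
        subst i; have [W1 [e1 [a [ee1 da1]]]] := coker_lift abC cq qa.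
        exists W1, e1, a; split=> //.
        by rewrite (is_zero_to (_ \oc a) zS) (is_zero_to (_ \oc e1) zS) oppr0.
      have [|W1 [e1 [a [ee1 da1]]]] := Bexact (succz i) _ _ _ da.
        by move/eqP: iD; move/eqP: iD'; slia.
      exists W1, e1, a; split=> //.
      by rewrite (is_zero_to (_ \oc a) zS) (is_zero_to (_ \oc e1) zS) oppr0.
    - have zS : is_zero (S (succz i)) by apply: sS; apply/eqP; slia.
      have zB : is_zero (B (succz (succz i))) by apply: eB; slia.
      exists W, (kid W), 0; split; first exact: is_epi_id.
        by rewrite kcompf0 (is_zero_to (_ \oc kid W) zB).
      by rewrite kcompf0 (is_zero_to (_ \oc kid W) zS) oppr0.
  exists W1, e1, (- (j i \oc a)); split=> //.
  rewrite kcompfN kcompA Ej kcompBl -!kcompA da1 qa1 kcompfN opprB opprK.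
  case: (bQ (succz i)) => _ _ _ _ id1.
  by rewrite -[x in RHS]kcomp1f -id1 !kcompDl -!kcompA.
(* From degree D + 2 to degree D: this is the Ext^2 that vanishes. *)
have u0 : deq (dof u) (dof (czero S Q)).
  apply: (hom0_concentrated (stalk_concentrated sS) Qexact).
  by apply/andP; split; apply/eqP; slia.
have [Y [t [qt]]] := deq_dof abC u0.
move/homotopic_subP/homotopic0P => [h hE].
have tu i : t (succz i) \oc u (succz i) = cdiff Y i \oc h i.
  by have := hE i; rewrite csubE /= kcompf0 subr0 (stalk_diff0 _ sS) kcompf0 addr0.
(* By itself [t j] misses being a chain map on the shift of [B] by the term t u q, and [h q] has
   exactly this differential. *)
pose phi i := t i \oc j i - h i \oc q (succz i).
have phid i : phi (succz i) \oc cdiff (cshift B) i = cdiff Y i \oc phi i.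
  rewrite /= kcompfN kcompBl -!kcompA qd kcompf0 subr0 kcompBr !kcompA -cfun_diff.
  by rewrite -!kcompA Ej kcompBr !kcompA tu -!kcompA addrAC subrr add0r.
pose Phi := @CMap K C (cshift B) Y phi phid.
(* [S] lives in degree D + 2 only, and there [T] is zero. *)
have qei i : q i \oc (e i \oc iota i) = 0.
  have [->|ni] := eqVneq i (succz (succz D)).
    by apply: is_zero_from; case: tT => _ _; apply; slia.
  by apply: is_zero_to; apply: sS.
pose lam i := j i \oc (e (succz i) \oc iota (succz i)).
have lamd i : lam (succz i) \oc cdiff (cshift T) i = cdiff Q i \oc lam i.
  rewrite /= kcompfN /lam (kcompA (cdiff Q i)) Ej kcompBl -!kcompA qei kcompf0 sub0r.
  by rewrite cfun_diff (kcompA (e _)) cfun_diff -kcompA.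
pose Lam := @CMap K C (cshift T) Q lam lamd.
(* Both sides have as only cohomology, in degree D, that of [Z] in degree D + 1. *)
have qLam : coh_iso Lam.
  move=> i; split.
  - move=> W x y dx lx.
    have dx' : cdiff T (succz (succz i)) \oc x = 0.
      by apply: oppr_inj; rewrite oppr0 -kcompNf.
    have [iD|iD] := eqVneq (succz i) D; last first.
      have [|W1 [e1 [z [ee1 dz]]]] := bottom_concentrated _ dx'.
        by apply/eqP => /succz_inj/eqP; rewrite (negbTE iD).
      by exists W1, e1, (- z); split=> //=; rewrite kcompNf kcompfN opprK.
    have [g [_ eg]] : is_iso (e (succz i)) by apply: eiso; slia.
    have [z iz] := truncation_lift_lt (g \oc (v i \oc y)) tT (i := succz i) ltac:(slia).
    exists W, (kid W), z; split; first exact: is_epi_id.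
    rewrite kcompf1; apply: (truncation_mono tT).
    have me : is_mono (e (succz (succz i))) by apply: is_iso_mono; apply: eiso; slia.
    apply: me; rewrite /= kcompNf !kcompfN !kcompA -(kcompA (e _)) cfun_diff.
    rewrite kcompA cfun_diff -!kcompA iz (kcompA (e _) g) eg kcomp1f.
    have := congr1 (fun w => v (succz i) \oc w) lx.
    rewrite (kcompA _ _ y) (cone_diffv _ cQ) kcompNf -(kcompA (cdiff B _)) => <-.
    by rewrite /= /lam !kcompA; case: (bQ (succz i)) => -> _ _ _ _; rewrite kcomp1f.
  - move=> W y dy; have [iD|iD] := eqVneq (succz i) D; last first.
      have [W1 [e1 [z [ee1 dz]]]] := Qexact i iD W y dy.
      by exists W1, e1, 0, z; split; rewrite ?kcompf0 ?add0r.
    have me : is_mono (e (succz (succz (succz i)))).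
      by apply: is_iso_mono; apply: eiso; slia.
    have [g [_ eg]] : is_iso (e (succz (succz i))) by apply: eiso; slia.
    have da : cdiff B (succz (succz i)) \oc (v (succz i) \oc y) = 0.
      by apply: oppr_inj; rewrite oppr0 kcompA -kcompNf -(cone_diffv _ cQ) -kcompA dy kcompf0.
    have dg : cdiff Z (succz (succz i)) \oc (g \oc (v (succz i) \oc y)) = 0.
      by apply: me; rewrite kcompf0 kcompA cfun_diff -kcompA (kcompA _ g) eg kcomp1f.
    have [|x ix] := truncation_lift tT _ dg; first by slia.
    exists W, (kid W), x, 0; split; first exact: is_epi_id.
      by rewrite /= kcompNf (truncation_lift0 tT) ?oppr0 // ix.
    rewrite kcompf0 kcompf1 addr0 /= /lam -!kcompA ix (kcompA _ g) eg kcomp1f.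
    case: (bQ (succz i)) => _ _ _ _ id1.
    rewrite -[y in RHS]kcomp1f -id1 kcompDl -!kcompA.
    rewrite (is_zero_to (p _ \oc y)) ?kcompf0 ?addr0 //.
    by apply: sS; apply/eqP; slia.
pose R := ccomp Phi (cshiftf e).
have qtl : quasi_iso (ccomp t Lam) by apply/(quasi_isoP abC); apply: coh_iso_comp.
exists (dcomp (dinv qtl) (dof R)).
have RE : deq (dcomp (dof R) (dof (cshiftf iota))) (dof (ccomp t Lam)).
  rewrite -deq_of_comp; apply: deq_of => i /=.
  by rewrite /phi /lam !kcompBl -!kcompA qei kcompf0 subr0.
by rewrite -deq_compA RE deq_inv_l.
Qed.

End BottomSplitting.

(** Composing the retraction with the inclusion of the truncation gives an idempotent. Were it 0,
    the truncation would be acyclic, against the choice of [D]; hence it is the identity and the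
    truncation is all of [X]. *)
Theorem idem_trivial_concentrated X : idem_trivial X ->
  exists p Y, concentrated p Y /\ diso X Y.
Proof.
(* The retraction of [bottom_retraction] lives on shifted complexes, so the splitting is applied to
   the inverse shift of [X]. *)
move=> hX; pose Z := cunshift X.
have dZ : diso X (cshift Z) by apply: diso_sym; apply: diso_shunsh.
have hZ := idem_trivial_diso dZ hX.
have [aZ|/existsNP [i0 ni0]] := pselect (acyclic Z).
  exists 0, (cshift Z); split=> // i _; apply/exact_at_cshift; exact: aZ.
have [n hn] := cbounded Z.
have low i : i < - n.+2%:Z -> exact_at Z i.
  move=> il W x dx; exists W, (kid W), 0; split; first exact: is_epi_id.
  rewrite kcompf0 [x]is_zero_to ?kcomp0f //.
  by apply: hn; slia.
(* To minimize over the naturals, degrees are counted from -(n + 2), below which [Z] is exact. *)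
have ex : exists k : nat, `[< ~ exact_at Z (k%:Z - n.+2%:Z) >].
  exists (absz (i0 + n.+2%:Z)); apply/asboolP.
  suff -> : (absz (i0 + n.+2%:Z))%:Z - n.+2%:Z = i0 by [].
  have : - n.+2%:Z <= i0 by rewrite leNgt; apply/negP => /low.
  lia.
case: (ex_minnP ex) => k /asboolP nk mink; pose D := k%:Z - n.+2%:Z.
have ZD i : i < D -> exact_at Z i.
  move=> iD; have [il|il] := ltP i (- n.+2%:Z); first exact: low.
  apply: contrapT => ni; have /mink : `[< ~ exact_at Z ((absz (i + n.+2%:Z))%:Z - n.+2%:Z) >].
    by apply/asboolP; rewrite (_ : _ - _ = i) //; lia.
  by rewrite /D in iD; lia.
have [T [iota tT]] := ex_truncation abC (succz D) Z.
have [r rE] := bottom_retraction ZD tT.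
exists D, (cshift T); split.
  move=> i iD; apply/exact_at_cshift; apply: (bottom_concentrated ZD tT).
  by apply/eqP => /succz_inj/eqP; rewrite (negbTE iD).
apply: diso_trans dZ _.
have [|e0|e1] := hZ (dcomp (dof (cshiftf iota)) r).
- by rewrite -deq_compA [dcomp r _]deq_compA rE deq_id_l.
- case: nk; have aT : acyclic (cshift T).
    apply: did0_acyclic; rewrite -rE -[r in X in deq X _]deq_id_l -/(did _) -[in X in deq X _]rE.
    by rewrite -[dcomp (dcomp r _) r]deq_compA e0 dcomp0r dcomp0l.
  have {aT} aT : forall i, exact_at T i by apply: succz_ind => i; apply/exact_at_cshift.
  move=> W x dx; have [z iz] := truncation_lift tT (lexx _) dx.
  have [|W1 [e1 [y [ee1 dy]]]] := aT D W z.
    by apply: (truncation_lift0 tT); rewrite iz.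
  exists W1, e1, (iota D \oc y); split=> //.
  by rewrite kcompA -cfun_diff -kcompA dy kcompA iz.
- by exists r, (dof (cshiftf iota)); split; rewrite ?e1 ?rE.
Qed.

End Hereditary.

(** * Modules form an abelian category *)

Section ModulesAbelian.
Context {K : fieldType} {A : algType K}.
Implicit Types M N P : rmodule A.

Lemma rhom_ext M N (f g : rhom M N) : (forall v, rhom_val f v = rhom_val g v) -> f = g.
Proof. by move=> h; apply: val_inj; apply/lfunP. Qed.

Lemma rhom_compE M N P (g : @khom _ (mod_kcat A) N P) (f : @khom _ (mod_kcat A) M N) v :
  rhom_val (g \oc f) v = rhom_val g (rhom_val f v).
Proof. by rewrite /= comp_lfunE. Qed.

Lemma rhom_idE M v : rhom_val (@kid _ (mod_kcat A) M) v = v.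
Proof. by rewrite /= id_lfunE. Qed.

Lemma rhom_zeroE M N v : rhom_val (0 : rhom M N) v = 0.
Proof. by rewrite -[rhom_val _]/(val (0 : rhom M N)) raddf0 zero_lfunE. Qed.

Lemma rhom_addE M N (f g : rhom M N) v : rhom_val (f + g) v = rhom_val f v + rhom_val g v.
Proof. by rewrite -[rhom_val (f + g)]/(val (f + g)) raddfD add_lfunE. Qed.

Lemma rhom_scaleE M N c (f : rhom M N) v : rhom_val (c *: f) v = c *: rhom_val f v.
Proof. by rewrite -[rhom_val (c *: f)]/(val (c *: f)) linearZ scale_lfunE. Qed.

Lemma rhom_linear M N (f : rhom M N) c v w :
  rhom_val f (c *: v + w) = c *: rhom_val f v + rhom_val f w.
Proof. exact: linearP. Qed.

Lemma rhom_sub M N (f : rhom M N) v w :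
  rhom_val f (v - w) = rhom_val f v - rhom_val f w.
Proof. exact: linearB. Qed.

Lemma rhom_add M N (f : rhom M N) v w :
  rhom_val f (v + w) = rhom_val f v + rhom_val f w.
Proof. exact: linearD. Qed.

Lemma rhom_scale M N (f : rhom M N) c v : rhom_val f (c *: v) = c *: rhom_val f v.
Proof. exact: linearZ. Qed.

Lemma rhom_sumZ M N (f : rhom M N) (I : finType) (c : I -> K) (u : I -> M) :
  rhom_val f (\sum_i c i *: u i) = \sum_i c i *: rhom_val f (u i).
Proof. by rewrite linear_sum; apply: eq_bigr => i _; rewrite linearZ. Qed.

Lemma ex_rhom M N (f : M -> N) : linear f ->
  (forall v a, f (ract M v a) = ract N (f v) a) ->
  exists F : rhom M N, forall v, rhom_val F v = f v.
Proof.
move=> lf hf; pose L : {linear M -> N} := HB.pack f (GRing.isLinear.Build K M N _ f lf).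
have h : linfun L \in rlinear (N := N).
  by apply/asboolP => v a; rewrite !lfunE /= hf.
by exists (RHom h) => v; exact: (lfunE L).
Qed.

Lemma ractB M v w a : ract M (v - w) a = ract M v a - ract M w a.
Proof. by rewrite ractDl -scaleN1r ractZl scaleN1r. Qed.

Lemma submodule_ker M N (f : rhom M N) : submodule (lker (rhom_val f)).
Proof.
by move=> v a; rewrite !memv_ker => /eqP fv; rewrite rhomP fv ract0.
Qed.

Lemma submodule_img M N (f : rhom M N) : submodule (limg (rhom_val f)).
Proof.
by move=> v a /memv_imgP[w _ ->]; rewrite -rhomP; apply: memv_img; apply: memvf.
Qed.

Lemma ex_submod M (U : {vspace M}) : submodule U ->
  exists N (i : rhom N M), injective (rhom_val i) /\
    forall v, v \in U <-> exists n, rhom_val i n = v.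
Proof.
move=> hU.
have sU (n : subvs_of U) a : ract M (vsval n) a \in U by apply: hU; apply: subvsP.
pose act (n : subvs_of U) a : subvs_of U := Subvs (sU n a).
have h1 v w a : act (v + w) a = act v a + act w a.
  by apply: val_inj; rewrite /= ractDl.
have h2 v a b : act v (a + b) = act v a + act v b.
  by apply: val_inj; rewrite /= ractDr.
have h3 c v a : act (c *: v) a = c *: act v a by apply: val_inj; rewrite /= ractZl.
have h4 c v a : act v (c *: a) = c *: act v a by apply: val_inj; rewrite /= ractZr.
have h5 v a b : act v (a * b) = act (act v a) b by apply: val_inj; rewrite /= ractM.
have h6 v : act v 1 = v by apply: val_inj; rewrite /= ract1.
pose N := @RModule K A (subvs_of U : vectType K) act h1 h2 h3 h4 h5 h6.
have [i hi] : exists i : rhom N M, forall v, rhom_val i v = vsval v.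
  by apply: ex_rhom => // c v w; rewrite linearP.
exists N, i; split=> [v w|v].
  by rewrite !hi; apply: val_inj.
split=> [vU|[n <-]]; first by exists (Subvs vU); rewrite hi.
by rewrite hi; apply: subvsP.
Qed.

(** The quotient is carried by a complement of [U], the action being projected onto it along [U]. *)
Lemma ex_quotmod M (U : {vspace M}) : submodule U ->
  exists N (p : rhom M N), (forall n, exists v, rhom_val p v = n) /\
    forall v, v \in U <-> rhom_val p v = 0.
Proof.
move=> hU; pose V := (U^C)%VS; pose pr := daddv_pi V U.
have VU : (V :&: U = 0)%VS by rewrite capvC; apply: capv_compl.
have prV v : pr v \in V by apply: memv_pi.
pose p v : subvs_of V := Subvs (prV v).
have prE v : v - pr v \in U.
  have := memvf v; rewrite -(addv_complf U) addvC => hv.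
  have := daddv_pi_add VU hv; rewrite -/V -/pr => E.
  by rewrite -{1}E addrC addKr; apply: memv_pi.
have prU v : v \in U -> pr v = 0.
  move=> vU; have : pr v \in (V :&: U)%VS.
    rewrite memv_cap prV /= -[pr v](subKr v); apply: rpredB => //.
  by rewrite VU memv0 => /eqP.
have prid (v : subvs_of V) : p (vsval v) = v.
  by apply: val_inj; rewrite /= /pr daddv_pi_id //; apply: subvsP.
have lp : linear p by move=> c v w; apply: val_inj; rewrite /= /pr linearP.
have pU v w : v - w \in U -> p v = p w.
  by move=> h; apply/eqP; rewrite -subr_eq0; apply/eqP/val_inj;
    rewrite /= -raddfB; apply: prU.
pose act (n : subvs_of V) a : subvs_of V := p (ract M (vsval n) a).
have pact v a : p (ract M v a) = act (p v) a.
  by apply: pU; rewrite -ractB; apply: hU; apply: prE.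
have pD v w : p (v + w) = p v + p w by apply: val_inj; rewrite /= /pr linearD.
have pZ c v : p (c *: v) = c *: p v by apply: val_inj; rewrite /= /pr linearZ.
have h1 v w a : act (v + w) a = act v a + act w a.
  by rewrite /act [vsval _]linearD ractDl pD.
have h3 c v a : act (c *: v) a = c *: act v a.
  by rewrite /act [vsval _]linearZ ractZl pZ.
have h2 v a b : act v (a + b) = act v a + act v b by rewrite /act ractDr pD.
have h4 c v a : act v (c *: a) = c *: act v a by rewrite /act ractZr pZ.
have h5 v a b : act v (a * b) = act (act v a) b by rewrite {1}/act ractM pact.
have h6 v : act v 1 = v by rewrite /act ract1 prid.
pose N := @RModule K A (subvs_of V : vectType K) act h1 h2 h3 h4 h5 h6.
have [q hq] : exists q : rhom M N, forall v, rhom_val q v = p v by apply: ex_rhom.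
exists N, q; split=> [n|v]; first by exists (vsval n); rewrite hq prid.
rewrite hq; split=> [/prU h|h]; first by apply: val_inj; rewrite /= h.
by have := prE v; rewrite -[pr v]/(vsval (p v)) h subr0.
Qed.

Lemma rhom_factor_inj M N P (i : rhom N M) (g : rhom P M) :
  injective (rhom_val i) -> (forall v, exists n, rhom_val i n = rhom_val g v) ->
  exists h : rhom P N, rcomp i h = g.
Proof.
move=> ii /choice [h hh]; have [||H hH] := ex_rhom (f := h : P -> N).
- by move=> c v w; apply: ii; rewrite rhom_linear !hh rhom_linear.
- by move=> v a; apply: ii; rewrite rhomP !hh rhomP.
by exists H; apply: rhom_ext => v; rewrite /= comp_lfunE hH hh.
Qed.

Lemma rhom_factor_surj M N P (p : rhom M N) (g : rhom M P) :
  (forall n, exists v, rhom_val p v = n) ->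
  (forall v, rhom_val p v = 0 -> rhom_val g v = 0) ->
  exists h : rhom N P, rcomp h p = g.
Proof.
move=> /choice [s hs] pg.
have E v w : rhom_val p v = rhom_val p w -> rhom_val g v = rhom_val g w.
  move=> h; apply/eqP; rewrite -subr_eq0 -rhom_sub; apply/eqP/pg.
  by rewrite rhom_sub h subrr.
have [||H hH] := ex_rhom (f := (fun n => rhom_val g (s n)) : N -> P).
- by move=> c v w; rewrite -rhom_linear; apply: E; rewrite hs rhom_linear !hs.
- by move=> v a; rewrite -rhomP; apply: E; rewrite hs rhomP hs.
by exists H; apply: rhom_ext => v; rewrite /= comp_lfunE hH; apply: E; rewrite hs.
Qed.

Lemma is_kernel_inj M N P (f : @khom _ (mod_kcat A) M P) (i : @khom _ (mod_kcat A) N M) :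
  injective (rhom_val i) ->
  (forall v, rhom_val f v = 0 <-> exists n, rhom_val i n = v) -> is_kernel f i.
Proof.
move=> ii fi; split.
  by apply: rhom_ext => n; rewrite rhom_compE rhom_zeroE; apply/fi; exists n.
move=> W g fg; have [|h ih] := @rhom_factor_inj M N W i g ii.
  by move=> v; apply/fi; rewrite -rhom_compE fg rhom_zeroE.
exists h; split=> // h' ih'; apply: rhom_ext => v; apply: ii.
have := congr1 (fun u => rhom_val u v) ih; have := congr1 (fun u => rhom_val u v) ih'.
by rewrite /= !comp_lfunE => -> ->.
Qed.

Lemma is_cokernel_surj M N P (f : @khom _ (mod_kcat A) P M) (p : @khom _ (mod_kcat A) M N) :
  (forall n, exists v, rhom_val p v = n) ->
  (forall v, rhom_val p v = 0 <-> exists n, rhom_val f n = v) -> is_cokernel f p.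
Proof.
move=> sp pf; split.
  by apply: rhom_ext => n; rewrite rhom_compE rhom_zeroE; apply/pf; exists n.
move=> W g gf; have [|h hp] := @rhom_factor_surj M N W p g sp.
  by move=> v /pf [n <-]; rewrite -rhom_compE gf rhom_zeroE.
exists h; split=> // h' hp'; apply: rhom_ext => n; have [v <-] := sp n.
have := congr1 (fun u => rhom_val u v) hp; have := congr1 (fun u => rhom_val u v) hp'.
by rewrite /= !comp_lfunE => -> ->.
Qed.

Lemma mod_ex_kernel M N (f : @khom _ (mod_kcat A) M N) :
  exists P (k : @khom _ (mod_kcat A) P M), injective (rhom_val k) /\ is_kernel f k.
Proof.
have [P [k [ik hk]]] := ex_submod (@submodule_ker M N f); exists P, k; split=> //.
apply: is_kernel_inj => // v; rewrite -hk memv_ker.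
by split=> [->|/eqP].
Qed.

Lemma mod_ex_cokernel M N (f : @khom _ (mod_kcat A) M N) :
  exists P (c : @khom _ (mod_kcat A) N P),
    (forall n, exists v, rhom_val c v = n) /\ is_cokernel f c.
Proof.
have [P [c [sc hc]]] := ex_quotmod (@submodule_img M N f); exists P, c; split=> //.
apply: is_cokernel_surj => // v; rewrite -hc.
by split=> [/memv_imgP[w _ ->]|[n <-]]; [exists w|apply: memv_img; apply: memvf].
Qed.

Lemma mod_mono_inj M N (f : @khom _ (mod_kcat A) M N) : is_mono f -> injective (rhom_val f).
Proof.
move/is_monoP => mf; have [P [k [ik [fk uk]]]] := mod_ex_kernel f.
move: fk uk => /mf k0 uk v w fvw; apply/eqP; rewrite -subr_eq0.
have [n <-] : exists n, rhom_val k n = v - w; last by rewrite k0 rhom_zeroE.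
have [P' [k' [ik' hk']]] := ex_submod (@submodule_ker M N f).
have [|h [kh _]] := uk _ (k' : @khom _ (mod_kcat A) P' M).
  apply: rhom_ext => n; rewrite rhom_compE rhom_zeroE; apply/eqP.
  by rewrite -memv_ker; apply/hk'; exists n.
have /hk' [n kn] : v - w \in lker (rhom_val f) by rewrite memv_ker rhom_sub fvw subrr.
by exists (rhom_val h n); rewrite -rhom_compE kh.
Qed.

Lemma mod_epi_surj M N (f : @khom _ (mod_kcat A) M N) :
  is_epi f -> forall n, exists v, rhom_val f v = n.
Proof.
move/is_epiP => ef n; have [P [c [sc hc]]] := ex_quotmod (@submodule_img M N f).
have c0 : c = 0.
  apply: ef; apply: rhom_ext => v; rewrite rhom_compE rhom_zeroE; apply/hc.
  by apply: memv_img; apply: memvf.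
have /memv_imgP[v _ ->] : n \in limg (rhom_val f) by apply/hc; rewrite c0 rhom_zeroE.
by exists v.
Qed.

Lemma mod_surj_epi M N (f : @khom _ (mod_kcat A) M N) :
  (forall n, exists v, rhom_val f v = n) -> is_epi f.
Proof.
move=> sf; apply/is_epiP => P g gf; apply: rhom_ext => n; have [v <-] := sf n.
by rewrite -rhom_compE gf !rhom_zeroE.
Qed.

Lemma ex_mod_biproduct M N : exists P (i1 : @khom _ (mod_kcat A) M P) (i2 : @khom _ (mod_kcat A) N P)
  (p1 : @khom _ (mod_kcat A) P M) (p2 : @khom _ (mod_kcat A) P N), is_biproduct i1 i2 p1 p2.
Proof.
pose act (v : (M * N)%type) a := (ract M v.1 a, ract N v.2 a).
have h1 v w a : act (v + w) a = act v a + act w a by rewrite /act !ractDl.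
have h2 v a b : act v (a + b) = act v a + act v b by rewrite /act !ractDr.
have h3 c v a : act (c *: v) a = c *: act v a by rewrite /act !ractZl.
have h4 c v a : act v (c *: a) = c *: act v a by rewrite /act !ractZr.
have h5 v a b : act v (a * b) = act (act v a) b by rewrite /act !ractM.
have h6 v : act v 1 = v by rewrite /act !ract1 -surjective_pairing.
pose P := @RModule K A ((M * N)%type : vectType K) act h1 h2 h3 h4 h5 h6.
have [||i1 E1] := @ex_rhom M P (fun v => (v, 0)).
- by move=> c v w; congr (_, _); rewrite /= scaler0 addr0.
- by move=> v a; rewrite /= /act ract0.
have [||i2 E2] := @ex_rhom N P (fun v => (0, v)).
- by move=> c v w; congr (_, _); rewrite /= scaler0 addr0.
- by move=> v a; rewrite /= /act ract0.
have [//|//|p1 E3] := @ex_rhom P M (fun v => v.1).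
have [//|//|p2 E4] := @ex_rhom P N (fun v => v.2).
exists P, i1, i2, p1, p2; split; apply: rhom_ext => v;
  rewrite ?rhom_addE ?rhom_compE ?rhom_idE ?rhom_zeroE ?E1 ?E2 ?E3 ?E4 //=.
by case: v => v w; congr (_, _); rewrite /= ?addr0 ?add0r.
Qed.

Lemma mod_abelian : abelian_kcat (mod_kcat A).
Proof.
split.
- exact: ex_mod_biproduct.
- move=> M N f; split.
    by have [P [k [_ hk]]] := mod_ex_kernel f; exists P, k.
  by have [P [c [_ hc]]] := mod_ex_cokernel f; exists P, c.
- move=> M N f /mod_mono_inj jf.
  have [P [c [sc hc]]] := ex_quotmod (@submodule_img M N f); exists P, c.
  apply: is_kernel_inj => // v; rewrite -hc.
  by split=> [/memv_imgP[w _ ->]|[n <-]]; [exists w|apply: memv_img; apply: memvf].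
- move=> M N f /mod_epi_surj sf.
  have [P [k [ik hk]]] := ex_submod (@submodule_ker M N f); exists P, k.
  apply: is_cokernel_surj => // v; rewrite -hk memv_ker.
  by split=> [->|/eqP].
Qed.

End ModulesAbelian.

(** * Complexes of projectives *)

Section ProjectiveComplexes.
Context {K : fieldType} {C : kcat K}.
Implicit Types X Y Z W P : bcx C.
#[local] Hint Resolve deq_refl : core.
Hypothesis abC : abelian_kcat C.

Lemma projective_split (M N : C) (e : khom M N) : is_projective N -> is_epi e ->
  exists s, e \oc s = kid N.
Proof. by move=> pN /(pN _ _ e (kid N)). Qed.

Lemma projective_exact_lift (M : C) X i (x : khom M (X (succz i))) :
  is_projective M -> exact_at X i -> cdiff X (succz i) \oc x = 0 ->
  exists y, cdiff X i \oc y = x.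
Proof.
move=> pM eX /eX [W [e [y [ee dy]]]]; have [s es] := projective_split pM ee.
by exists (y \oc s); rewrite kcompA dy -kcompA es kcompf1.
Qed.

(** The homotopy is built downwards from the top degree of [P]: its value in degree i + 1 turns the
    next component of [f] into the cocycle f - h d, which lifts by projectivity. *)
Lemma projective_null P W (f : cmap P W) : (forall i, is_projective (P i)) ->
  acyclic W -> exists h, null_htpy f h.
Proof.
move=> pP aW; have [n zP] := cbounded P.
have step (k : nat) : exists h : forall i, khom (P (succz i)) (W i),
  forall i, n%:Z - k%:Z <= i ->
    f (succz i) = cdiff W i \oc h i + h (succz i) \oc cdiff P (succz i).
  elim: k => [|k [h hE]].
    exists (fun=> 0) => i ni.
    have z : is_zero (P (succz i)) by apply: zP; slia.
    by rewrite (is_zero_from (f _) z) (is_zero_from (_ + _) z).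
  pose i0 := n%:Z - k.+1%:Z.
  have [|y dy] := projective_exact_lift
      (x := f (succz i0) - h (succz i0) \oc cdiff P (succz i0)) (pP _) (aW i0).
    rewrite kcompBr kcompA -cfun_diff (hE (succz i0)); last by rewrite /i0; slia.
    by rewrite kcompDl -!kcompA cdiff2 !kcompf0 addr0 subrr.
  have [h' [h'0 h'E]] := dep_update h y; exists h' => i ik.
  have [->|ni] := eqVneq i i0.
    rewrite h'0 h'E; last by apply/eqP; slia.
    by rewrite dy subrK.
  rewrite !h'E //; last by apply/eqP; rewrite /i0 in ni *; slia.
  by apply: hE; move/eqP: ni; rewrite /i0; slia.
(* This many steps go from degree [n] to below -n, where [P] vanishes. *)
have [h hE] := step (n + n).+2; exists h => i.
have [il|il] := leP (n%:Z - (n + n).+2%:Z) i; first exact: hE.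
have z : is_zero (P (succz i)) by apply: zP; slia.
by rewrite (is_zero_from (f _) z) (is_zero_from (_ + _) z).
Qed.

(** The composite of [f] with the inclusion in the acyclic cone of [s] is null-homotopic. The
    component of the homotopy along [v] is the lift, the one along [q] the homotopy between its
    image and [f]. *)
Lemma projective_lift P Y Z (s : cmap Y Z) (f : cmap P Z) :
  (forall i, is_projective (P i)) -> coh_iso s ->
  exists g : cmap P Y, homotopic (ccomp s g) f.
Proof.
move=> pP qs; have [D [u [v [j [q cD]]]]] := ex_cone abC s; have [bD Ej Eq] := cD.
have [h hE] := projective_null (ccomp u f) pP (cone_acyclic cD qs).
have [g gE] := dep_succz (T := fun i => khom (P i) (Y i)) (fun i => v i \oc h i).
have gd : forall i, g (succz i) \oc cdiff P i = cdiff Y i \oc g i.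
  apply: succz_ind => i; rewrite !gE.
  have := congr1 (fun w => v (succz i) \oc w) (hE i); rewrite /= kcompDr !kcompA.
  rewrite (cone_diffv _ cD) kcompNf; case: (bD (succz i)) => _ _ _ -> _.
  by rewrite kcomp0f => /esym/eqP; rewrite addrC subr_eq0 => /eqP.
exists (CMap gd); apply: homotopic_sym; exists (fun i => q i \oc h i) => i /=.
rewrite gE; have := congr1 (fun w => q (succz i) \oc w) (hE i).
rewrite /= kcompDr !kcompA Eq kcompDl; case: (bD (succz i)) => _ -> _ _ _.
rewrite kcomp1f => ->; rewrite -!kcompA; apply/eqP; rewrite subr_eq.
by rewrite [eqbRHS]addrC addrA.
Qed.

(** A null-homotopy [h] of t f makes (f, -h) a chain map from the shift of [P] to the acyclic cone
    of [t]. It is null-homotopic, and up to sign its homotopy has a null-homotopy of [f] as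
    component along [v]. *)
Lemma projective_htpy0 P Y Y' (t : cmap Y Y') (f : cmap P Y) :
  (forall i, is_projective (P i)) -> coh_iso t ->
  homotopic (ccomp t f) (czero P Y') -> homotopic f (czero P Y).
Proof.
move=> pP qt /homotopic0P [h hE].
have [D [u [v [j [q cD]]]]] := ex_cone abC t; have [bD Ej Eq] := cD.
pose F i : khom (cshift P i) (D i) := j i \oc f (succz i) - u i \oc h i.
have Fd i : F (succz i) \oc cdiff (cshift P) i = cdiff D i \oc F i.
  rewrite /F /= kcompfN kcompBl kcompBr !kcompA Ej -cfun_diff kcompBl -!kcompA.
  have := hE i; rewrite /= => ->; rewrite kcompDr cfun_diff opprB.
  by rewrite [in RHS](addrC (_ \oc (_ \oc h i))) -!addrA; congr (_ + _); rewrite addrCA subrr addr0.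
have [|k kE] := projective_null (@CMap K C (cshift P) D F Fd) _ (cone_acyclic cD qt).
  by move=> i; apply: pP.
have [H HE] := dep_succz (T := fun i => khom (P (succz i)) (Y i))
  (fun i => - (v i \oc k i)).
apply/homotopic0P; exists H; apply: succz_ind => i; rewrite !HE.
have := congr1 (fun w => v (succz i) \oc w) (kE i).
rewrite /= /F kcompBr kcompDr !kcompA (cone_diffv _ cD).
case: (bD (succz i)) => -> _ _ -> _.
rewrite kcomp1f kcomp0f subr0 => ->.
by rewrite !kcompfN !kcompNf -!kcompA.
Qed.

(** With [projective_full], this says that out of a complex of projectives the morphisms of D^b are
    the homotopy classes of chain maps. *)
Lemma projective_deq_homotopic P Y (f g : cmap P Y) :
  (forall i, is_projective (P i)) -> deq (dof f) (dof g) -> homotopic f g.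
Proof.
move=> pP /(deq_dof abC) [Q [t [qt /homotopic_subP E]]]; apply/homotopic_subP.
apply: (projective_htpy0 pP qt); apply: homotopic_trans E.
by apply: homotopic_ext => i; rewrite csubE /= scaleN1r kcompBr.
Qed.

Lemma projective_full P X Y (a : dmor X Y) (f : cmap P X) :
  (forall i, is_projective (P i)) ->
  exists g : cmap P Y, deq (dcomp a (dof f)) (dof g).
Proof.
move=> pP; elim: a f => {X Y} [X Y g|X Y s qs|X Y Z b IHb a IHa] f.
- by exists (ccomp g f); rewrite -deq_of_comp.
- have [g hg] := projective_lift f pP ((quasi_isoP abC s).1 qs); exists g.
  by rewrite -(homotopic_deq abC hg) deq_of_comp deq_compA deq_inv_l deq_id_l.
- have [g hg] := IHa f; have [k hk] := IHb g; exists k.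
  by rewrite -deq_compA hg hk.
Qed.

Lemma idem_split (X : C) (e : khom X X) : e \oc e = e ->
  exists (Y : C) (r : khom X Y) (s : khom Y X), s \oc r = e /\ r \oc s = kid Y.
Proof.
move=> ee; have [Y [k kk]] := ex_kernel abC (kid X - e).
have ms := is_kernel_mono kk.
have [r kr] : exists r, k \oc r = e.
  by apply: is_kernel_lift kk _; rewrite kcompBl kcomp1f ee subrr.
exists Y, r, k; split=> //; apply: ms; rewrite kcompA kr kcompf1.
case: kk => /eqP + _; rewrite kcompBl kcomp1f subr_eq0 => /eqP.
by move/esym.
Qed.

Lemma cidem_split X (e : cmap X X) : (forall i, e i \oc e i = e i) ->
  exists Y (r : cmap X Y) (s : cmap Y X),
    (forall i, s i \oc r i = e i) /\ (forall i, r i \oc s i = kid (Y i)).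
Proof.
move=> ee.
have [T hT] := dep_choice (fun i => idem_split (ee i)).
have [r hr] := dep_choice hT; have [s hs] := dep_choice hr.
have ms i : is_mono (s i).
  by move=> W u w E; rewrite -(kcomp1f u) -(kcomp1f w) -(hs i).2 -!kcompA E.
have [i|D [h1 [h2 [s' s'E]]]] := ex_subcx ms.
  exists (r (succz i) \oc (cdiff X i \oc s i)).
  rewrite kcompA (hs _).1 kcompA cfun_diff -kcompA -[in LHS](hs i).1 -kcompA.
  by rewrite (hs i).2 kcompf1.
have rd i : r (succz i) \oc cdiff X i = cdiff (BCx h1 h2) i \oc r i.
  apply: ms; rewrite kcompA (hs _).1 cfun_diff -{1}(hs i).1.
  have := cfun_diff s' i; rewrite !s'E => E.
  by rewrite (kcompA (s _)) E -kcompA.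
exists (BCx h1 h2), (@CMap _ _ X (BCx h1 h2) r rd), s'.
by split=> i; rewrite s'E; case: (hs i).
Qed.

Lemma cidem_biproduct X (f : cmap X X) : (forall i, f i \oc f i = f i) ->
  exists Y Y' (s : cmap Y X) (s' : cmap Y' X) (r : cmap X Y) (r' : cmap X Y'),
  (forall i, is_biproduct (s i) (s' i) (r i) (r' i)) /\
  (forall i, s i \oc r i = f i).
Proof.
move=> ff; pose f' := csub (cid X) f.
have f'E i : f' i = kid (X i) - f i by exact: csubE.
have ff' i : f i \oc f' i = 0 by rewrite f'E kcompBr kcompf1 ff subrr.
have f'f i : f' i \oc f i = 0 by rewrite f'E kcompBl kcomp1f ff subrr.
have f'f' i : f' i \oc f' i = f' i by rewrite {1}f'E kcompBl kcomp1f ff' subr0.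
have [Y [r [s [sr rs]]]] := cidem_split ff.
have [Y' [r' [s' [sr' rs']]]] := cidem_split f'f'.
exists Y, Y', s, s', r, r'; split=> // i; split=> //.
- rewrite -(kcompf1 (r' i \oc _)) -(rs i) -(kcomp1f (r' i)) -(rs' i) -!kcompA.
  by rewrite (kcompA (s i)) sr (kcompA (s' i)) sr' (kcompA _ (f i)) f'f kcomp0f kcompf0.
- rewrite -(kcompf1 (r i \oc _)) -(rs' i) -(kcomp1f (r i)) -(rs i) -!kcompA.
  by rewrite (kcompA (s' i)) sr' (kcompA (s i)) sr (kcompA _ (f' i)) ff' kcomp0f kcompf0.
- by rewrite sr sr' f'E addrC subrK.
Qed.

Lemma homotopic_factor0 X Y (r : cmap X Y) (s : cmap Y X) (f : cmap X X) :
  (forall i, s i \oc r i = f i) -> homotopic (cid Y) (czero Y Y) ->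
  homotopic f (czero X X).
Proof.
move=> sr z; have h := homotopic_comp (homotopic_refl s) (homotopic_comp z (homotopic_refl r)).
apply: homotopic_trans (homotopic_trans h _); apply: homotopic_ext => i /=.
  by rewrite kcomp1f sr.
by rewrite kcomp0f kcompf0.
Qed.

Lemma projective_retract (M N : C) (r : khom M N) (s : khom N M) :
  r \oc s = kid N -> is_projective M -> is_projective N.
Proof.
move=> rs pM U V e f ee; have [g eg] := pM _ _ e (f \oc r) ee.
by exists (g \oc s); rewrite kcompA eg -kcompA rs kcompf1.
Qed.

End ProjectiveComplexes.

(** * Polynomials in an endomorphism of a complex *)

Section PolynomialEvaluation.
Context {K : fieldType} {C : kcat K}.

Definition kpow (X : C) (e : khom X X) n : khom X X := iter n (kcomp e) (kid X).

Definition keval (X : C) (e : khom X X) (p : {poly K}) : khom X X :=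
  \sum_(k < size p) p`_k *: kpow e k.

Section Fixed.
Variables (X : C) (e : khom X X).

Lemma kpowSr n : kpow e n.+1 = kpow e n \oc e.
Proof.
elim: n => [|n IH]; first by rewrite /kpow /= kcompf1 kcomp1f.
by rewrite -[LHS]/(e \oc kpow e n.+1) {1}IH kcompA.
Qed.

Lemma keval_widen (p : {poly K}) n : (size p <= n)%N -> keval e p = \sum_(k < n) p`_k *: kpow e k.
Proof.
move=> pn; rewrite /keval (big_ord_widen n (fun k => p`_k *: kpow e k) pn).
rewrite big_mkcond; apply: eq_bigr => k _; case: ltnP => // kp.
by rewrite nth_default // scale0r.
Qed.

Lemma kcomp_sumr (Y Z : C) (g : khom Y Z) (I : finType) (F : I -> khom X Y) :
  g \oc (\sum_i F i) = \sum_i g \oc F i.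
Proof.
by apply: (big_morph (fun f => g \oc f)) => [f f'|]; rewrite (kcompDr, kcompf0).
Qed.

Lemma kcomp_suml (Y Z : C) (g : khom X Y) (I : finType) (F : I -> khom Y Z) :
  (\sum_i F i) \oc g = \sum_i F i \oc g.
Proof.
by apply: (big_morph (fun f => f \oc g)) => [f f'|]; rewrite (kcompDl, kcomp0f).
Qed.

Lemma kevalD (p q : {poly K}) : keval e (p + q) = keval e p + keval e q.
Proof.
pose n := maxn (size p) (size q).
rewrite !(@keval_widen _ n) ?leq_maxl ?leq_maxr //; last exact: size_polyD.
by rewrite -big_split /=; apply: eq_bigr => k _; rewrite coefD scalerDl.
Qed.

Lemma kevalZ c (p : {poly K}) : keval e (c *: p) = c *: keval e p.
Proof.
rewrite (@keval_widen _ (size p)) ?size_scale_leq // scaler_sumr.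
by apply: eq_bigr => k _; rewrite coefZ scalerA.
Qed.

Lemma kevalN (p : {poly K}) : keval e (- p) = - keval e p.
Proof. by rewrite -(scaleN1r p) kevalZ scaleN1r. Qed.

Lemma kevalC c : keval e c%:P = c *: kid X.
Proof.
rewrite (@keval_widen _ 1) ?size_polyC ?leq_b1 // big_ord1 coefC eqxx.
by [].
Qed.

Lemma keval0 : keval e 0 = 0.
Proof. by rewrite /keval size_poly0 big_ord0. Qed.

Lemma kevalMX (p : {poly K}) : keval e (p * 'X) = keval e p \oc e.
Proof.
rewrite (@keval_widen _ (size p).+1); last first.
  by have [->|p0] := eqVneq p 0; rewrite ?mul0r ?size_poly0 // size_mulX.
rewrite big_ord_recl coefMX eqxx scale0r add0r kcomp_suml.
by apply: eq_bigr => k _; rewrite coefMX /= kcompZl -kpowSr.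
Qed.

Lemma kevalM (p q : {poly K}) : keval e (p * q) = keval e p \oc keval e q.
Proof.
elim/poly_ind: q => [|q c IH].
  by rewrite mulr0 keval0 kcompf0.
rewrite mulrDr mulrA !kevalD !kevalMX IH [p * c%:P]mulrC mul_polyC kevalZ kevalC.
by rewrite kcompDr kcompZr kcompf1 -kcompA.
Qed.

Lemma kevalX : keval e 'X = e.
Proof. by rewrite -['X]mul1r kevalMX -polyC1 kevalC scale1r kcomp1f. Qed.

End Fixed.

Lemma kpow_nat (X Y : C) (d : khom X Y) e e' n : d \oc e = e' \oc d ->
  d \oc kpow e n = kpow e' n \oc d.
Proof.
move=> E; elim: n => [|n IH]; first by rewrite /kpow /= kcompf1 kcomp1f.
by rewrite kpowSr kcompA IH -kcompA E kcompA -kpowSr.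
Qed.

Lemma keval_nat (X Y : C) (d : khom X Y) e e' (p : {poly K}) : d \oc e = e' \oc d ->
  keval e' p \oc d = d \oc keval e p.
Proof.
move=> E; rewrite /keval kcomp_suml kcomp_sumr; apply: eq_bigr => k _.
by rewrite kcompZl kcompZr (kpow_nat _ E).
Qed.

Lemma ceval_diff (P : bcx C) (e : cmap P P) (p : {poly K}) i :
  keval (e (succz i)) p \oc cdiff P i = cdiff P i \oc keval (e i) p.
Proof. by apply: keval_nat; rewrite cfun_diff. Qed.

Definition ceval (P : bcx C) (e : cmap P P) p : cmap P P := CMap (ceval_diff e p).

(** The polynomial 'X * 'X - 'X evaluates to a null-homotopic map, so polynomials congruent to 'X
    modulo it evaluate to maps homotopic to [e]. *)
Lemma ceval_idem_homotopic (P : bcx C) (e : cmap P P) (w : {poly K}) :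
  homotopic (ccomp e e) e -> homotopic (ceval e ('X + ('X * 'X - 'X) * w)) e.
Proof.
move=> /homotopic_subP h; apply/homotopic_subP.
have := homotopic_compr (ceval e w) h => h'.
apply: homotopic_trans (homotopic_trans h' _); apply: homotopic_ext => i.
  rewrite csubE /= kevalD kevalM kevalD kevalN kevalM !kevalX scaleN1r.
  by rewrite addrAC subrr add0r.
by rewrite /= kcomp0f.
Qed.

End PolynomialEvaluation.

(** * Lifting and splitting idempotents of the homotopy category *)

Section KbIdempotents.
Context {K : fieldType} {A : algType K}.

(** The endomorphism space is finite dimensional, so the first powers of [e], one more than its
    dimension, are linearly dependent. *)
Lemma mod_annihilator (M : mod_kcat A) (e : khom M M) :
  exists2 p : {poly K}, p != 0 & keval e p = 0.
Proof.
pose n := \dim {: 'Hom(rcar M, rcar M)}.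
pose v : n.+1.-tuple 'Hom(rcar M, rcar M) := [tuple rhom_val (kpow e i) | i < n.+1].
have nf : ~~ free v.
  by rewrite /free size_tuple neq_ltn ltnS dimvS ?subvf.
have [k [kv [i ki]]] : exists k : 'I_n.+1 -> K,
    \sum_(i < n.+1) k i *: v`_i = 0 /\ exists i, k i != 0.
  apply: contrapT => h; move/negP: nf; apply; apply/freeP => k kv i.
  by apply/eqP; apply: contrapT => /negP ki; apply: h; exists k; split=> //; exists i.
exists (\poly_(i < n.+1) k (inord i)).
  apply/eqP => /polyP/(_ i); rewrite coef_poly ltn_ord coef0 inord_val => /eqP.
  by rewrite (negbTE ki).
rewrite (keval_widen _ (size_poly _ _)); apply: rhom_ext => w.
have -> : \sum_(i0 < n.+1) (\poly_(i1 < n.+1) k (inord i1))`_i0 *: kpow e i0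
    = \sum_(i0 < n.+1) k i0 *: kpow e i0.
  by apply: eq_bigr => l _; rewrite coef_poly ltn_ord inord_val.
have E : rhom_val (\sum_(l < n.+1) k l *: kpow e l) = 0.
  rewrite -[rhom_val _]/(val _) raddf_sum -[RHS]kv; apply: eq_bigr => l _.
  rewrite (nth_mktuple _ _ l); apply/lfunP => x.
  by rewrite scale_lfunE -rhom_scaleE.
by rewrite E !rhom_zeroE ?zero_lfunE.
Qed.

Lemma bcx_annihilator (P : bcx (mod_kcat A)) (e : cmap P P) :
  exists2 p : {poly K}, p != 0 & forall i, keval (e i) p = 0.
Proof.
have [n zP] := cbounded P.
have step (k : nat) : exists2 p : {poly K}, p != 0 &
    forall i : int, (absz i < k)%N -> keval (e i) p = 0.
  elim: k => [|k [p p0 hp]]; first by exists 1; rewrite ?oner_eq0.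
  have [q q0 hq] := mod_annihilator (e k%:Z).
  have [r r0 hr] := mod_annihilator (e (- k%:Z)).
  exists (p * (q * r)); first by rewrite !mulf_neq0.
  move=> i; rewrite ltnS leq_eqVlt => /orP[/eqP ik|/hp ik].
    rewrite !kevalM; have [->|->] : i = k%:Z \/ i = - k%:Z by lia.
      by rewrite hq kcomp0f kcompf0.
    by rewrite hr !kcompf0.
  by rewrite kevalM ik kcomp0f.
have [p p0 hp] := step n.+1; exists p => // i.
have [ni|/hp //] := ltnP n (absz i); exact: is_zero_to (zP i ni).
Qed.

(* If p annihilates e and p = 'X^k * q with q prime to 'X, the component of a
   Bezout relation divisible by 'X^k evaluates at e to a strict idempotent; it is
   homotopic to e as soon as 'X * ('X - 1) divides p. *)
Lemma idem_lift (P : bcx (mod_kcat A)) (e : cmap P P) : homotopic (ccomp e e) e ->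
  exists e' : cmap P P, (forall i, e' i \oc e' i = e' i) /\ homotopic e' e.
Proof.
move=> he; have [p0 p00 hp0] := bcx_annihilator e.
(* The extra factor makes 0 and 1 roots of [p], whatever the annihilator [p0] is. *)
pose p := p0 * ('X * 'X - 'X).
have XX : ('X * 'X - 'X : {poly K}) = 'X * ('X - 1%:P) by rewrite mulrBr mulr1.
have p_neq0 : p != 0.
  by rewrite mulf_neq0 // XX mulf_neq0 ?polyX_eq0 ?polyXsubC_eq0.
have [k [q qE pE]] := multiplicity_XsubC p 0.
move: qE; rewrite p_neq0 /= => q0; rewrite subr0 in pE.
have k_gt0 : (0 < k)%N.
  rewrite lt0n; apply/eqP => k0; move: q0; rewrite k0 expr0 mulr1 in pE.
  by move/negP; apply; rewrite -pE /p XX !rootM rootX eqxx orbT.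
have q1 : q.[1] = 0.
  have /rootP : root p 1 by rewrite /p XX !rootM root_XsubC eqxx !orbT.
  by rewrite pE hornerM hornerXn expr1n mulr1.
have cop : coprimep ('X ^+ k) q.
  by rewrite coprimep_expl // coprimep_sym -['X]subr0 coprimep_XsubC.
move/Bezout_coprimepP: cop => [[u v] /= /eqpP [[a b] /= /andP[a0 b0] uv]].
pose g := (a / b) *: u * 'X^k; pose w := (a / b) *: v * q.
have gw : g + w = 1.
  rewrite /g /w -!scalerAl -scalerDr -[RHS]scale1r -(mulVf b0) mulrC -!scalerA uv.
  by rewrite !scalerA mulVf // mulrC.
have g0 : root g 0 by rewrite rootE /g hornerM hornerXn expr0n eqn0Ngt k_gt0 mulr0.
have g1 : root (g - 1) 1.
  have -> : g - 1 = - w by rewrite -gw opprD addrA subrr sub0r.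
  by rewrite rootE hornerN hornerM q1 mulr0 oppr0.
(* [g] vanishes at 0 because 'X^k divides it, and takes the value 1 at 1 because [q], hence [w],
   vanishes there; so 'X * ('X - 1) divides g - 'X. *)
have [y gE] : exists y, g = 'X + ('X * 'X - 'X) * y.
  have h1 : root (g - 'X) 1.
    by move: g1; rewrite !rootE !hornerE.
  have h0 : root (g - 'X) 0.
    by move: g0; rewrite !rootE !hornerE subr0.
  have /factor_theorem [z zE] := h1.
  have z0 : root z 0.
    move: h0; rewrite zE rootM root_XsubC; case/orP=> //.
    by rewrite eq_sym oner_eq0.
  have /factor_theorem [y yE] := z0; exists y.
  rewrite XX -[LHS](subrK 'X) zE yE subr0 addrC; congr (_ + _).
  by rewrite [y * _]mulrC mulrAC.
exists (ceval e g); split; last by rewrite gE; apply: ceval_idem_homotopic.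
move=> i; rewrite -[LHS]/(keval (e i) g \oc keval (e i) g) -[RHS]/(keval (e i) g) -kevalM.
(* Here g * w is a multiple of 'X^k * q = p, and g * g = g - g * w. *)
have gg : g * g = g + (- (a / b *: u * (a / b *: v))) * p.
  have -> : g * g = g * (g + w) - g * w by rewrite mulrDr addrK.
  rewrite gw mulr1; congr (_ + _); rewrite pE /g /w mulNr; congr (- _).
  by rewrite -!mulrA; congr (_ * _); rewrite mulrCA [q * _]mulrC.
by rewrite gg kevalD (kevalM _ (- _)) (kevalM _ p0) hp0 kcomp0f kcompf0 addr0.
Qed.

(** The strict idempotent splits the complex into two complexes of projectives, to which
    indecomposability applies. *)
Lemma Kb_idem (P : bcx (mod_kcat A)) (e : cmap P P) : proj_complex P ->
  Kb_indecomposable P -> homotopic (ccomp e e) e ->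
  homotopic e (czero P P) \/ homotopic e (cid P).
Proof.
move=> pP [_ iP] he; have [f [ff fe]] := idem_lift he.
have [X [X' [s [s' [r [r' [bP sr]]]]]]] := cidem_biproduct (mod_abelian (A := A)) ff.
have pX : proj_complex X.
  by move=> i; case: (bP i) => rs _ _ _ _; apply: projective_retract rs (pP i).
have pX' : proj_complex X'.
  by move=> i; case: (bP i) => _ rs _ _ _; apply: projective_retract rs (pP i).
have [|z|z] := iP X X' s s' r r' pX pX'.
- by split; apply: homotopic_ext => i; case: (bP i).
- by left; apply: homotopic_trans (homotopic_sym fe) _; apply: homotopic_factor0 sr z.
- right; apply: homotopic_trans (homotopic_sym fe) _; apply: homotopic_sym.
  apply/homotopic_subP; apply: homotopic_factor0 z => i.
  by have [_ _ _ _ E] := bP i; rewrite csubE -sr -[cid P i]/(kid (P i)) -E addrAC subrr add0r.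
Qed.

Lemma Kb_idem_trivial (P : bcx (mod_kcat A)) : proj_complex P ->
  Kb_indecomposable P -> idem_trivial P.
Proof.
move=> pP iP a aa; have abA := mod_abelian (A := A).
have [f fE] := projective_full abA a (cid P) pP; rewrite deq_id_r in fE.
have ff : homotopic (ccomp f f) f.
  by apply: (projective_deq_homotopic abA pP); rewrite deq_of_comp -fE aa fE; apply: deq_refl.
by have [h|h] := Kb_idem pP iP ff; [left|right]; rewrite fE; apply: homotopic_deq.
Qed.

Lemma Kb_isomorphic_diso (P R : bcx (mod_kcat A)) : Kb_isomorphic P R -> diso P R.
Proof.
move=> [f [g [gf fg]]]; exists (dof f), (dof g).
by split; rewrite -deq_of_comp; apply: (homotopic_deq (mod_abelian (A := A))).
Qed.

End KbIdempotents.

(** * Modules over the incidence algebra *)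

Section IncidenceModules.
Variables (K : fieldType) (d : Order.disp_t) (D : finPOrderType d).
Hypothesis D_gt0 : (0 < #|D|)%N.
Let A : algType K := incidence_algebra K D_gt0.
Local Notation KQ := (path_algebra K D).
Local Notation qp := (@qpi K d D D_gt0 : KQ -> A).
Implicit Types (x y z : D) (a b : A).

Lemma psumD x y (f g : KQ) : psum x y (f + g) = psum x y f + psum x y g.
Proof. by rewrite /psum -big_split; apply: eq_bigr => p _; rewrite ffunE. Qed.

Lemma psumZ x y c (f : KQ) : psum x y (c *: f) = c * psum x y f.
Proof. by rewrite /psum mulr_sumr; apply: eq_bigr => p _; rewrite ffunE. Qed.

Lemma psum1 x y : psum x y (1 : KQ) = (x == y)%:R.
Proof.
rewrite -[1]/(pone K D) /pone /psum.
under eq_bigr => p _ do rewrite sum_ffunE.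
rewrite exchange_big /=.
under eq_bigr => z _ do rewrite -/(psum x y (pbasis K (htriv z))) psum_basis.
rewrite (bigD1 x) //= big1 ?addr0 => [|z /negbTE zx].
  by rewrite /hsrc /htgt /= eqxx.
by rewrite /hsrc /= zx.
Qed.

Lemma hpath_le (p : hpath D) : (hsrc p <= htgt p)%O.
Proof.
rewrite /htgt -/(hsrc p).
elim: (hverts p).2 (hsrc p) (hpath_lt p) => //= y s IH x /andP[/ltW xy /IH].
exact: le_trans.
Qed.

Lemma psum_neq0_le x y (f : KQ) : psum x y f != 0 -> (x <= y)%O.
Proof.
apply: contraR => nxy; rewrite /psum big1 // => p /andP[/eqP px /eqP py].
by move: nxy; rewrite -px -py hpath_le.
Qed.

(** Induction on the number of elements strictly between [x] and [y]; if there are none, the pair is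
    an arrow. *)
Lemma ex_hpath x y : (x <= y)%O -> exists p : hpath D, hsrc p = x /\ htgt p = y.
Proof.
have [n] := ubnP #|[set z | (x < z)%O && (z < y)%O]|.
elim: n x y => // n IH x y cn; rewrite le_eqVlt => /predU1P[->|xy].
  by exists (htriv y).
have [z xzy|no] := pickP (fun z => (x < z)%O && (z < y)%O); last first.
  have h : path (@hasse d D) x [:: y].
    by rewrite /= andbT /hasse xy; apply/forallP => z; rewrite no.
  by exists (@HPath _ _ (x, [:: y]) h).
have /andP[xz zy] := xzy.
have [|p [px pz]] := IH x z _ (ltW xz).
  apply: leq_trans (cn : (_ <= n)%N); apply: proper_card; apply/properP; split.
    by apply/subsetP => w; rewrite !inE => /andP[-> /lt_trans->].
  by exists z; rewrite inE ?xzy // ltxx andbF.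
have [|q [qz qy]] := IH z y _ (ltW zy).
  apply: leq_trans (cn : (_ <= n)%N); apply: proper_card; apply/properP; split.
    by apply/subsetP => w; rewrite !inE => /andP[/(lt_trans xz)-> ->].
  by exists z; rewrite inE ?xzy // ltxx.
have [r hr] : exists r, hcomp p q = Some r by apply: hcomp_some; rewrite pz qz.
by have [e1 e2 _ _] := hcompP hr; exists r; rewrite -e1 e2.
Qed.

(** The (x, y) entry of [a] in the matrix description of the incidence algebra; independence of the
    representative is [qsum_qpi]. *)
Definition qsum x y (a : A) : K := psum x y (repr a : KQ).

Lemma qsum_qpi x y (f : KQ) : qsum x y (qp f) = psum x y f.
Proof.
have := psum_ideal (@repr_qpi K d D D_gt0 f) x y.
by rewrite -scaleN1r psumD psumZ mulN1r => /eqP; rewrite subr_eq0 => /eqP.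
Qed.

Lemma qsumD x y a b : qsum x y (a + b) = qsum x y a + qsum x y b.
Proof. by rewrite -[a in LHS]qpiK -[b in LHS]qpiK -qpiD qsum_qpi psumD. Qed.

Lemma qsumZ x y c a : qsum x y (c *: a) = c * qsum x y a.
Proof. by rewrite -[c *: a]/(qp _) qsum_qpi psumZ. Qed.

Lemma qsumM x y a b : qsum x y (a * b) = \sum_z qsum x z a * qsum z y b.
Proof. by rewrite -[a * b]/(qp _) qsum_qpi psumM. Qed.

Lemma qsum1 x y : qsum x y 1 = (x == y)%:R.
Proof. by rewrite -[1]/(qp 1) qsum_qpi psum1. Qed.

(* All paths from x to y have the same class in A; the value is 0 when x <= y fails. *)
Definition qarrow x y : A :=
  if [pick p : hpath D | (hsrc p == x) && (htgt p == y)] is Some p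
  then qp (pbasis K p) else 0.

Lemma qpi_pbasis (p : hpath D) : qp (pbasis K p) = qarrow (hsrc p) (htgt p).
Proof.
rewrite /qarrow; case: pickP => [q /andP[/eqP qs /eqP qt]|/(_ p)]; last by rewrite !eqxx.
by apply: qpi_sub; apply: PIgen; rewrite /hparallel qs qt !eqxx.
Qed.

Lemma qsum_qarrow x y u v : (x <= y)%O ->
  qsum u v (qarrow x y) = ((x == u) && (y == v))%:R.
Proof. by case/ex_hpath => p [<- <-]; rewrite -qpi_pbasis qsum_qpi psum_basis. Qed.

Lemma qpi_sum (f : KQ) : qp f = \sum_p f p *: qarrow (hsrc p) (htgt p).
Proof.
have -> : f = \sum_p f p *: pbasis K p.
  apply/ffunP => q; rewrite sum_ffunE (bigD1 q) //= big1 ?addr0.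
    by rewrite !ffunE eqxx mulr1.
  by move=> p /negbTE pq; rewrite !ffunE eq_sym pq mulr0.
have qp0 : qp 0 = 0 by apply: (@addrI _ (qp 0)); rewrite -qpiD !addr0.
rewrite (big_morph qp (@qpiD K d D D_gt0) qp0); apply: eq_bigr => p _.
by rewrite qpiZ -qpi_pbasis sum_ffunE (bigD1 p) //= big1 ?addr0 ?ffunE ?eqxx ?mulr1 // => q /negbTE qp'; rewrite !ffunE eq_sym qp' mulr0.
Qed.

Lemma pbasisM (p q : hpath D) : pbasis K p * pbasis K q =
  if hcomp p q is Some r then pbasis K r else 0.
Proof.
apply/ffunP => r; rewrite -[LHS]/(pmul _ _ r) pmulE (bigD1 p) //= [X in _ + X]big1 ?addr0; last first.
  by move=> p' /negbTE pp'; rewrite big1 // => q' _; rewrite [pbasis K p p']ffunE pp' mul0r mulr0.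
rewrite (bigD1 q) //= [X in _ + X]big1 ?addr0; last first.
  by move=> q' /negbTE qq'; rewrite [pbasis K q q']ffunE qq' !mulr0.
rewrite !ffunE !eqxx !mulr1; case: (hcomp p q) => [s|]; last by rewrite ffunE.
by rewrite ffunE eq_sym; congr (_%:R); apply/eqP/eqP => [->|[->]].
Qed.

(** The [qarrow x y] multiply like matrix units. *)
Lemma qarrowM x y a : (x <= y)%O -> qarrow x y * a = \sum_z qsum y z a *: qarrow x z.
Proof.
case/ex_hpath => p [<- <-]; rewrite -[a in LHS]qpiK qpi_sum mulr_sumr.
transitivity (\sum_q \sum_z ((hsrc q == htgt p) && (htgt q == z))%:R *
    (repr a : KQ) q *: qarrow (hsrc p) z).
  apply: eq_bigr => q _; rewrite -scalerAr -!qpi_pbasis.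
  rewrite -[qp _ * qp _]/(qmul _ _) -qpiM pbasisM.
  rewrite (bigD1 (htgt q)) //= big1 ?addr0; last first.
    by move=> z /negbTE; rewrite eq_sym => ->; rewrite andbF mul0r scale0r.
  rewrite eqxx andbT; case: (eqVneq (hsrc q) (htgt p)) => [e|ne].
    have [r hr] := hcomp_some (esym e); rewrite hr mul1r qpi_pbasis.
    by rewrite -(hcomp_src hr) (hcomp_tgt hr).
  rewrite mul0r scale0r /hcomp eq_sym (negbTE ne).
  have -> : qp 0 = 0 by apply: (@addrI _ (qp 0)); rewrite -qpiD !addr0.
  by rewrite scaler0.
rewrite exchange_big; apply: eq_bigr => z _; rewrite -scaler_suml; congr (_ *: _).
rewrite /qsum /psum [RHS]big_mkcond; apply: eq_bigr => q _.
by case: (_ && _); rewrite ?mul1r ?mul0r.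
Qed.

Lemma qarrow_idem x : qarrow x x * qarrow x x = qarrow x x.
Proof.
rewrite qarrowM // (bigD1 x) //= big1 ?addr0 => [|z /negbTE zx].
  by rewrite qsum_qarrow // !eqxx scale1r.
by rewrite qsum_qarrow // [x == z]eq_sym zx andbF scale0r.
Qed.

Lemma sum_qarrow : \sum_x qarrow x x = 1.
Proof.
rewrite -[RHS]/(qp (pone K D)) /pone.
have qp0 : qp 0 = 0 by apply: (@addrI _ (qp 0)); rewrite -qpiD !addr0.
rewrite (big_morph qp (@qpiD K d D D_gt0) qp0); apply: eq_bigr => x _.
by rewrite qpi_pbasis.
Qed.

Local Notation V := {ffun D -> K^o}.

(** The product of a row vector with the matrix of the entries [qsum]. *)
Definition const_act (v : V) (a : A) : V := [ffun y => \sum_x v x * qsum x y a].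

Fact const_actDl v w a : const_act (v + w) a = const_act v a + const_act w a.
Proof.
apply/ffunP => y; rewrite !ffunE -big_split; apply: eq_bigr => x _.
by rewrite ffunE mulrDl.
Qed.

Fact const_actDr v a b : const_act v (a + b) = const_act v a + const_act v b.
Proof.
apply/ffunP => y; rewrite !ffunE -big_split; apply: eq_bigr => x _.
by rewrite qsumD mulrDr.
Qed.

Fact const_actZl c v a : const_act (c *: v) a = c *: const_act v a.
Proof.
apply/ffunP => y; rewrite !ffunE scaler_sumr; apply: eq_bigr => x _.
by rewrite ffunE -[c *: v x]/(c * v x) -mulrA.
Qed.

Fact const_actZr c v a : const_act v (c *: a) = c *: const_act v a.
Proof.
apply/ffunP => y; rewrite !ffunE scaler_sumr; apply: eq_bigr => x _.
by rewrite qsumZ mulrCA.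
Qed.

Fact const_actM v a b : const_act v (a * b) = const_act (const_act v a) b.
Proof.
apply/ffunP => y; rewrite !ffunE.
under [RHS]eq_bigr => z _ do rewrite ffunE mulr_suml.
rewrite exchange_big; apply: eq_bigr => x _; rewrite qsumM mulr_sumr.
by apply: eq_bigr => z _; rewrite mulrA.
Qed.

Fact const_act1 v : const_act v 1 = v.
Proof.
apply/ffunP => y; rewrite !ffunE (bigD1 y) //= big1 ?addr0 => [|x /negbTE xy].
  by rewrite qsum1 eqxx mulr1.
by rewrite qsum1 xy mulr0.
Qed.

(* The representation with K at every vertex and the identity on every arrow. *)
Definition const_mod : rmodule A := @RModule K A (V : vectType K) const_act
  const_actDl const_actDr const_actZl const_actZr const_actM const_act1.

Definition cbase x : V := [ffun y => (y == x)%:R].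

Lemma cbase_sum (v : V) : v = \sum_x v x *: cbase x.
Proof.
apply/ffunP => y; rewrite sum_ffunE (bigD1 y) //= big1 ?addr0 => [|x /negbTE xy].
  by rewrite !ffunE eqxx -[_ *: _]/(_ * _) mulr1.
by rewrite !ffunE eq_sym xy scaler0.
Qed.

Lemma cbase_neq0 x : cbase x != 0.
Proof.
by apply/eqP => /ffunP/(_ x)/eqP; rewrite !ffunE eqxx oner_eq0.
Qed.

Lemma const_act_qarrow (v : V) x y : (x <= y)%O ->
  const_act v (qarrow x y) = v x *: cbase y.
Proof.
move=> xy; apply/ffunP => z; rewrite !ffunE (bigD1 x) //= big1 ?addr0 => [|u /negbTE ux].
  by rewrite qsum_qarrow // eqxx [y == z]eq_sym.
by rewrite qsum_qarrow // [x == u]eq_sym ux mulr0.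
Qed.

(** Commuting with the vertex idempotents, [f] acts by a scalar at each vertex; an arrow forces the
    scalars at its two ends to be equal, and connectedness does the rest. *)
Lemma const_mod_end (f : rhom const_mod const_mod) : hasse_connected D ->
  exists c, f = c *: rid const_mod.
Proof.
move=> con; pose c x : K := rhom_val f (cbase x) x.
have fc x : rhom_val f (cbase x) = c x *: cbase x.
  have E : const_act (cbase x) (qarrow x x) = cbase x.
    by rewrite const_act_qarrow // ffunE eqxx scale1r.
  rewrite -{1}E; rewrite [rhom_val f _](rhomP f (cbase x)) /=.
  exact: const_act_qarrow.
have step x y : hasse x y -> c x = c y.
  case/andP => /ltW xy _.
  have E : const_act (cbase x) (qarrow x y) = cbase y.
    by rewrite const_act_qarrow // ffunE eqxx scale1r.
  have : rhom_val f (cbase y) = c x *: cbase y.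
    rewrite -{1}E [rhom_val f _](rhomP f (cbase x)) /= fc.
    by rewrite const_act_qarrow // !ffunE eqxx -[_ *: 1]/(_ * 1) mulr1.
  by rewrite fc => /ffunP/(_ y); rewrite !ffunE eqxx -![_ *: 1]/(_ * 1) !mulr1.
have [x0 _] : exists x : D, x \in D by apply/card_gt0P.
have cE x : c x = c x0.
  have /connectP[s] := con x0 x; elim: s x0 => [|z s IH] y /=; first by move=> _ ->.
  case/andP => /orP[] /step e ps xE; first by rewrite (IH z ps xE) e.
  by rewrite (IH z ps xE) e.
exists (c x0); apply: rhom_ext => v; rewrite rhom_scaleE.
rewrite -[rhom_val (rid _) v]/(rhom_val (@kid _ (mod_kcat A) const_mod) v) rhom_idE.
rewrite [v in LHS]cbase_sum rhom_sumZ [v in RHS]cbase_sum scaler_sumr.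
by apply: eq_bigr => x _; rewrite fc cE !scalerA mulrC.
Qed.

(* The projective cover of the simple module at x, embedded in the constant
   module as the functions supported on the up-set of x. *)
Lemma ex_proj_mod x : exists (P : rmodule A) (e : P) (i : rhom P const_mod),
  [/\ rhom_val i e = cbase x,
      ract P e (qarrow x x) = e,
      forall (N : rmodule A) (n : N), ract N n (qarrow x x) = n ->
        exists f : rhom P N, rhom_val f e = n,
      forall (N : rmodule A) (f g : rhom P N), rhom_val f e = rhom_val g e -> f = g
    & forall w, exists c, ract P w (qarrow x x) = c *: e].
Proof.
pose pr (v : V) : V := [ffun y => if (x <= y)%O then 0 else v y].
have lpr : linear pr.
  move=> c v w; apply/ffunP => y; rewrite !ffunE; case: ifP => _ //.
  by rewrite scaler0 addr0.
pose L : {linear V -> V} := HB.pack pr (GRing.isLinear.Build K V V _ pr lpr).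
pose U := lker (linfun L).
have UP (v : V) : v \in U <-> forall y, ~~ (x <= y)%O -> v y = 0.
  rewrite memv_ker lfunE /= /pr; split=> [/eqP/ffunP h y /negbTE xy|h].
    by have := h y; rewrite !ffunE xy.
  by apply/eqP/ffunP => y; rewrite !ffunE; case: ifP => // /negbT/h.
have sU : submodule (M := const_mod) U.
  move=> v a /UP hv; apply/UP => y xy; rewrite ffunE big1 // => z _.
  have [xz|xz] := boolP (x <= z)%O; last by rewrite hv // mul0r.
  have [->|/psum_neq0_le zy] := eqVneq (qsum z y a) 0; first by rewrite mulr0.
  by rewrite (le_trans xz zy) in xy.
have [P [i [ii hi]]] := ex_submod sU.
have cU y : (x <= y)%O -> (cbase y : const_mod) \in U.
  move=> xy; apply/UP => z xz; rewrite ffunE; case: eqP => // zy.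
  by rewrite zy xy in xz.
have [e ie] := (hi (cbase x)).1 (cU x (lexx x)).
have iact w a : rhom_val i (ract P w a) = const_act (rhom_val i w) a by rewrite rhomP.
have eact y : (x <= y)%O -> rhom_val i (ract P e (qarrow x y)) = cbase y.
  by move=> xy; rewrite iact ie const_act_qarrow // ffunE eqxx scale1r.
(* Every element is recovered from [e], by its coordinates in the constant module. *)
have wE w : w = \sum_y (rhom_val i w : V) y *: ract P e (qarrow x y).
  apply: ii; rewrite rhom_sumZ [LHS]cbase_sum; apply: eq_bigr => y _.
  have [xy|xy] := boolP (x <= y)%O; first by rewrite eact.
  have := (hi (rhom_val i w)).2 (ex_intro _ w erefl).
  by move/UP => /(_ y xy) ->; rewrite !scale0r.
exists P, e, i; split=> //.
- by apply: ii; rewrite eact.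
- move=> N n ne.
  (* The expansion [wE] leaves no other choice for a map taking [e] to [n]. *)
  pose h (w : P) := \sum_y (rhom_val i w : V) y *: ract N n (qarrow x y).
  have lh : linear h.
    move=> c v w; rewrite /h scaler_sumr -big_split; apply: eq_bigr => y _ /=.
    have -> : (rhom_val i (c *: v + w) : V) = c *: (rhom_val i v : V) + (rhom_val i w : V).
      exact (rhom_linear i c v w).
    by rewrite !ffunE scalerDl scalerA.
  have [v a|f fE] := ex_rhom lh.
    rewrite /h iact.
    have rsum (I : finType) (F : I -> N) : ract N (\sum_k F k) a = \sum_k ract N (F k) a.
      by apply: (big_morph (fun u => ract N u a)) => [u w|]; rewrite (ractDl, ract0).
    have asum (I : finType) (F : I -> A) : ract N n (\sum_k F k) = \sum_k ract N n (F k).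
      apply: (big_morph (fun u => ract N n u)) => [u w|]; first by rewrite ractDr.
      by rewrite -(scale0r (0 : A)) ractZr scale0r.
    rewrite rsum.
    under [RHS]eq_bigr => z _ do rewrite ractZl -ractM.
    under [LHS]eq_bigr => y _ do rewrite ffunE scaler_suml.
    rewrite exchange_big; apply: eq_bigr => z _.
    have [xz|xz] := boolP (x <= z)%O.
      rewrite qarrowM // asum scaler_sumr; apply: eq_bigr => y _.
      by rewrite ractZr scalerA.
    have := (hi (rhom_val i v)).2 (ex_intro _ v erefl).
    move/UP => /(_ z xz) ->; rewrite scale0r big1 // => y _.
    by rewrite mul0r scale0r.
  exists f; rewrite fE /h ie (bigD1 x) //= big1 ?addr0 => [|y /negbTE yx].
    by rewrite ffunE eqxx scale1r.
  by rewrite ffunE yx scale0r.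
- move=> N f g fg; apply: rhom_ext => w; rewrite (wE w) !rhom_sumZ.
  by apply: eq_bigr => y _; rewrite !rhomP fg.
- move=> w; exists ((rhom_val i w : V) x); apply: ii.
  by rewrite iact const_act_qarrow // rhom_scale ie.
Qed.

End IncidenceModules.

(** * Degrees of stalk complexes *)

Section Stalks.
Context {K : fieldType} {C : kcat K}.
Implicit Types X Y Z : bcx C.
#[local] Hint Resolve deq_refl : core.

Definition stalk_ob (p : int) (N : C) (i : int) : C := if i == p then N else kzero C.

Fact stalk_diff2 p N i :
  (0 : khom (stalk_ob p N (succz i)) (stalk_ob p N (succz (succz i))))
  \oc (0 : khom (stalk_ob p N i) _) = 0.
Proof. exact: kcompf0. Qed.

Fact stalk_bounded p N : exists n : nat, forall i : int, (n < `|i|)%N -> is_zero (stalk_ob p N i).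
Proof.
exists (absz p) => i hi; rewrite /stalk_ob; case: eqP => [E|_]; last exact: kid_zero.
by rewrite E ltnn in hi.
Qed.

Definition stalk p N : bcx C :=
  @BCx K C (stalk_ob p N) (fun=> 0) (@stalk_diff2 p N) (stalk_bounded p N).

Lemma stalkP p N : stalk_at p (stalk p N).
Proof. by move=> i /negbTE ip; rewrite /= /stalk_ob ip; apply: kid_zero. Qed.

(** The comparison in [stalk_ob] does not compute for a variable degree, so the term in degree [p]
    is identified with [N] by a pair of inverse maps. *)
Lemma stalk_iso p i N : i = p -> exists (f : khom N (stalk p N i)) (g : khom (stalk p N i) N),
  g \oc f = kid N /\ f \oc g = kid _.
Proof.
move=> ->; rewrite /= /stalk_ob eqxx; exists (kid N), (kid N).
by rewrite kcomp1f.
Qed.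

Lemma stalk_cshift p N : diso (cshift (stalk (p + 1) N)) (stalk p N).
Proof.
have [f [g [gf fg]]] := stalk_iso (i := succz p) N (erefl (p + 1)).
have [f' [g' [gf' fg']]] := stalk_iso N (erefl p).
apply: (@stalk_diso _ _ p _ _ (f' \oc g : khom (cshift (stalk (p + 1) N) p) _)).
- by move=> i ip; apply: stalkP; apply/eqP => /succz_inj/eqP; rewrite (negbTE ip).
- exact: stalkP.
exists (f \oc g'); rewrite -!kcompA (kcompA g) gf kcomp1f fg'.
by rewrite (kcompA g') gf' kcomp1f fg.
Qed.

Lemma stalk_projective p N : is_projective N -> forall i, is_projective (stalk p N i).
Proof.
move=> pN i; rewrite /= /stalk_ob; case: eqP => // _ X Y e f _; exists 0.
by rewrite kcompf0 [f](is_zero_from _ (kid_zero C)).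
Qed.

Lemma stalk_homotopic0 p X Y (f : cmap X Y) : stalk_at p X -> stalk_at p Y ->
  homotopic f (czero X Y) -> f p = 0.
Proof.
elim/succz_ind: p => b sX sY /homotopic0P [h ->].
by rewrite (stalk_diff0 _ sX) (stalk_diff0 _ sY) kcomp0f kcompf0 addr0.
Qed.

(** By fullness on stalks an idempotent is a scalar [c]; if [c] is nonzero the idempotent is
    invertible, hence the identity. *)
Lemma stalk_idem_trivial p N : abelian_kcat C ->
  (forall f : khom N N, exists c, f = c *: kid N) -> idem_trivial (stalk p N).
Proof.
move=> abC sc a aa; have [f fE] := stalk_full abC a (@stalkP p N) (@stalkP p N).
have [c fc] : exists c, forall i, f i = c *: kid (stalk p N i).
  have [u [v [vu uv]]] := stalk_iso N (erefl p).
  have [c cE] := sc (v \oc f p \oc u); exists c => i.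
  have [->|ip] := eqVneq i p; last first.
    have z := @stalkP p N i ip.
    by rewrite (is_zero_to (f i) z) (is_zero_to (_ *: _) z).
  rewrite -[f p]kcomp1f -[_ \oc f p]kcompf1 -uv !kcompA -(kcompA u) -(kcompA u) cE.
  by rewrite kcompZr kcompf1 kcompZl.
have {}fE : deq a (dof (cscale c (cid _))).
  by rewrite fE; apply: deq_of => i; rewrite fc.
have [c0|c0] := eqVneq c 0.
  by left; rewrite fE; apply: deq_of => i /=; rewrite c0 scale0r.
right; have aE : deq (dcomp (dof (cscale c^-1 (cid _))) a) (did (stalk p N)).
  rewrite fE -deq_of_comp; apply: deq_of => i /=.
  by rewrite kcompZl kcompZr kcomp1f scalerA mulVf // scale1r.
by rewrite -[a]deq_id_l -/(did _) -aE -deq_compA aa aE.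
Qed.

End Stalks.

(** * Degrees of objects of the derived category *)

Section Degrees.
Context {K : fieldType} {C : kcat K}.
Implicit Types X Y Z : bcx C.
Hypotheses (abC : abelian_kcat C) (heC : hereditary C).

(** A zero object lies in every degree; it is the nonvanishing of Hom that compares degrees. *)
Definition in_degree (p : int) X := exists Y, concentrated p Y /\ diso X Y.

Lemma in_degree_diso p X Y : diso X Y -> in_degree p X -> in_degree p Y.
Proof.
move=> h [Z [cZ dZ]]; exists Z; split=> //.
exact: diso_trans (diso_sym h) dZ.
Qed.

Lemma in_degree_cshift p X : in_degree p X -> in_degree (p - 1) (cshift X).
Proof.
move=> [Y [cY dY]]; exists (cshift Y); split; last exact: diso_cshift.
by move=> i ip; apply/exact_at_cshift; apply: cY; move/eqP: ip => ip; apply/eqP; slia.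
Qed.

Lemma in_degree_cunshift p X : in_degree p (cshift X) -> in_degree (p + 1) X.
Proof.
move=> [Y [cY dY]]; exists (cunshift Y); split; last first.
  exact: diso_trans (diso_sym (diso_unshsh X)) (diso_cunshift abC dY).
apply: succz_ind => i ip; apply/exact_at_cshift.
have [g [gf fg]] := levelwise_iso (@shunsh_iso _ _ Y).
have gi j : is_iso (g j) by exists (shunsh Y j).
apply: (levelwise_exact_at (gi _) (is_iso_mono (gi _))); apply: cY.
by move/eqP: ip => ip; apply/eqP; slia.
Qed.

Lemma in_degree_hom p q X Y : in_degree p X -> in_degree q Y -> ~ hom0 X Y ->
  p = q \/ p = q + 1.
Proof.
move=> [X' [cX dX]] [Y' [cY dY]] h; apply: contrapT => npq; apply: h.
apply: hom0_diso (diso_sym dX) (diso_sym dY) _.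
apply: (hom0_concentrated abC heC cX cY).
by apply/andP; split; apply/eqP => E; apply: npq; [left|right].
Qed.

End Degrees.

(** * Transport along a triangle equivalence *)

Section TriangleEquivalence.
Context {K : fieldType} {C C' : kcat K}.
Variable F : triangle_equivalence C C'.
Implicit Types X Y : bcx C.
#[local] Hint Resolve deq_refl : core.

(** The zero morphism factors through the multiple by 0 of an identity, which [te_scale]
    controls. *)
Lemma te_d0 X Y : deq (te_mor F (d0 X Y)) (d0 (te_ob F X) (te_ob F Y)).
Proof.
have -> : deq (te_mor F (d0 X Y))
    (te_mor F (dcomp (d0 X Y) (dof (cscale 0 (cid X))))).
  apply: te_eq; rewrite /d0 -deq_of_comp; apply: deq_of => i /=.
  by rewrite kcomp0f.
rewrite te_comp te_scale.
have -> : deq (dof (cscale 0 (cid (te_ob F X)))) (d0 (te_ob F X) (te_ob F X)).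
  by apply: deq_of => i /=; rewrite scale0r.
by rewrite dcomp0r.
Qed.

Lemma te_diso X Y : diso X Y -> diso (te_ob F X) (te_ob F Y).
Proof.
move=> [a [b [ba ab]]]; exists (te_mor F a), (te_mor F b).
by rewrite -!te_comp; split; [rewrite (te_eq F ba)|rewrite (te_eq F ab)]; apply: te_id.
Qed.

Lemma te_hom0 X Y : hom0 (te_ob F X) (te_ob F Y) -> hom0 X Y.
Proof. by move=> h a; apply: (@te_faithful _ _ _ F); rewrite te_d0; apply: h. Qed.

Lemma te_idem_trivial X : idem_trivial X -> idem_trivial (te_ob F X).
Proof.
move=> hX e ee; have [a aE] := te_full e.
have [|a0|a1] := hX a.
- by apply: (@te_faithful _ _ _ F); rewrite te_comp aE ee.
- by left; rewrite -aE (te_eq F a0) te_d0.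
- by right; rewrite -aE (te_eq F a1) te_id.
Qed.

Lemma te_in_degree_cshift p X : abelian_kcat C' ->
  in_degree p (te_ob F (cshift X)) <-> in_degree (p + 1) (te_ob F X).
Proof.
move=> ab; have dX : diso (te_ob F (cshift X)) (cshift (te_ob F X)).
  by exists (te_shift F X); apply: te_shift_iso.
split=> [/(in_degree_diso dX)|/in_degree_cshift]; first exact: in_degree_cunshift.
by rewrite addrK; apply: in_degree_diso (diso_sym dX).
Qed.

(** The functor commutes with the shift, so each move of the stalk by one degree moves its image by
    one; the induction runs in both directions. *)
Lemma te_in_degree_stalk p (N : C) : abelian_kcat C' ->
  in_degree p (te_ob F (stalk 0 N)) -> forall s, in_degree (p + s) (te_ob F (stalk s N)).
Proof.
move=> ab h0.
have up s : in_degree (p + s) (te_ob F (stalk s N)) ->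
    in_degree (p + (s + 1)) (te_ob F (stalk (s + 1) N)).
  move=> h; rewrite addrA; apply/(te_in_degree_cshift _ _ ab).
  by apply: in_degree_diso h; apply: te_diso; apply: diso_sym; apply: stalk_cshift.
have down s : in_degree (p + (s + 1)) (te_ob F (stalk (s + 1) N)) ->
    in_degree (p + s) (te_ob F (stalk s N)).
  rewrite addrA => /(te_in_degree_cshift _ _ ab).
  by apply: in_degree_diso; apply: te_diso; apply: stalk_cshift.
elim/int_rect => [|n IH|n IH]; first by rewrite addr0.
  by rewrite -[n.+1]addn1 PoszD; apply: up.
by apply: down; rewrite (_ : - n.+1%:Z + 1 = - n%:Z) //; lia.
Qed.

End TriangleEquivalence.

(** * Maximal submodules and the radical *)

Section Radical.
Context {K : fieldType} {A : algType K}.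
Implicit Types M N : rmodule A.

Lemma ex_maximal_submodule M : ~ is_zero (M : mod_kcat A) ->
  exists U : {vspace M}, maximal_submodule U.
Proof.
move=> nM.
pose P k := `[< exists U : {vspace M}, [/\ submodule U, U <> fullv & \dim U = k] >].
have P0 : exists k, P k.
  exists 0%N; apply/asboolP; exists 0%VS; split; last exact: dimv0.
    by move=> v a; rewrite !memv0 => /eqP->; rewrite ract0.
  move=> E; apply: nM; apply: rhom_ext => v; rewrite rhom_idE rhom_zeroE.
  by have := memvf v; rewrite -E memv0 => /eqP.
have Pb k : P k -> (k <= \dim (fullv : {vspace M}))%N.
  by move/asboolP => [U [_ _ <-]]; apply: dimvS; apply: subvf.
case: (ex_maxnP P0 Pb) => k /asboolP[U [sU nU dU]] mx; exists U; split=> // V sV UV.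
apply: contrapT => /not_orP[n1 n2]; apply: n1; apply/esym/eqP.
rewrite eqEdim UV dU; apply: mx; apply/asboolP; by exists V.
Qed.

(** The preimage of a maximal submodule is maximal unless it is everything: the image of a larger
    submodule either stays in [U] or generates [N] together with [U]. *)
Lemma radical_hom M N (k : rhom M N) (U : {vspace N}) (v : M) :
  maximal_submodule U -> in_radical v -> rhom_val k v \in U.
Proof.
move=> [sU nU mU] rv; pose V := (rhom_val k @^-1: U)%VS.
suff : v \in V by rewrite memv_preim.
have sV : submodule V by move=> w a; rewrite -!memv_preim rhomP => /sU.
have [->|nV] := EM (V = fullv); first exact: memvf.
apply: rv; split=> // W sW VW.
pose T := (U + rhom_val k @: W)%VS.
have sT : submodule T.
  move=> z a /memv_addP[u uU [w /memv_imgP[x xW ->] ->]].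
  rewrite ractDl -rhomP; apply: memv_add; first exact: sU.
  by apply: memv_img; apply: sW.
have [TU|Tf] := mU T sT (addvSl _ _).
- left; apply/eqP; rewrite eqEsubv VW andbT; apply/subvP => w wW.
  rewrite -memv_preim -TU; apply: (subvP (addvSr _ _)).
  exact: memv_img.
- right; apply/eqP; rewrite eqEsubv subvf; apply/subvP => z _.
  have : rhom_val k z \in T by rewrite Tf memvf.
  case/memv_addP => u uU [w /memv_imgP[x xW ->]] E.
  rewrite -(subrK x z); apply: memvD => //; apply: (subvP VW).
  by rewrite -memv_preim rhom_sub E addrK.
Qed.

End Radical.

(** * Vertex projectives and the ends of a radical complex *)

Section IncidenceTest.
Variables (K : fieldType) (d : Order.disp_t) (D : finPOrderType d).
Hypothesis D_gt0 : (0 < #|D|)%N.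
Let A : algType K := incidence_algebra K D_gt0.
Local Notation arr := (qarrow K D_gt0).

(** The universal property of the right ideal generated by the idempotent at [x], with generator
    [e]; the last clause, which makes the endomorphisms scalar, says that the component at [x] is
    spanned by [e]. *)
Definition vertex_generated (x : D) (P : rmodule A) (e : P) :=
  [/\ ract P e (arr x x) = e,
      forall (N : rmodule A) (n : N), ract N n (arr x x) = n ->
        exists f : rhom P N, rhom_val f e = n,
      forall (N : rmodule A) (f g : rhom P N), rhom_val f e = rhom_val g e -> f = g
    & forall w, exists c, ract P w (arr x x) = c *: e].

Lemma vertex_projective x P e : @vertex_generated x P e ->
  is_projective (P : mod_kcat A).
Proof.
move=> [ee lift ext _] M N q f /mod_epi_surj sq.
have [m qm] := sq (rhom_val f e).
have [|g gE] := lift M (ract M m (arr x x)).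
  by rewrite -ractM qarrow_idem.
exists g; apply: ext; rewrite rhom_compE gE rhomP qm -rhomP; congr (rhom_val f _).
exact: ee.
Qed.

Lemma vertex_scalar_end x P e (f : rhom P P) : @vertex_generated x P e ->
  exists c, f = c *: rid P.
Proof.
move=> [ee _ ext sc]; have [c cE] := sc (rhom_val f e); exists c; apply: ext.
by rewrite rhom_scaleE -{1}ee rhomP cE /= id_lfunE.
Qed.

(** The vertex idempotents sum to 1, so some component of a vector outside [U] is outside [U]. *)
Lemma vertex_component (M : rmodule A) (U : {vspace M}) : U <> fullv ->
  exists x v, ract M v (arr x x) \notin U.
Proof.
move=> nU; apply: contrapT => h; apply: nU; apply/eqP; rewrite eqEsubv subvf.
apply/subvP => v _; rewrite -[v]ract1 -(sum_qarrow K D_gt0).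
rewrite (big_morph (ract M v) (@ractDr _ _ M v) (_ : ract M v 0 = 0)); last first.
  by rewrite -(scale0r (0 : A)) ractZr scale0r.
apply: memv_suml => x _; apply: contrapT => /negP hv; apply: h.
by exists x, v.
Qed.

Variables (P : D -> rmodule A) (e : forall x, P x).
Hypothesis Pe : forall x, vertex_generated x (e x).

(** A component outside a maximal submodule [U] of the last term gives a map from some vertex
    projective. If it were zero in D^b it would be null-homotopic, hence would factor through the
    differential, whose image lies in the radical and so in [U]. *)
Lemma radical_top_hom (R : bcx (mod_kcat A)) s : radical_complex R ->
  ~ is_zero (R s) -> is_zero (R (succz s)) ->
  exists x, ~ hom0 (stalk s (P x : mod_kcat A)) R.
Proof.
move=> rR; elim/succz_ind: s => b nR zR.
have [U mU] := ex_maximal_submodule nR; have [sU nU _] := mU.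
have [x [v nv]] := vertex_component nU; exists x => h.
have [ee lift _ _] := Pe x.
have [|f fE] := lift _ (ract (R (succz b)) v (arr x x)).
  by rewrite -ractM qarrow_idem.
have [u [w [wu uw]]] := stalk_iso (P x : mod_kcat A) (erefl (succz b)).
pose f0 : khom (stalk (succz b) (P x : mod_kcat A) (succz b)) (R (succz b)) :=
  (f : khom (P x : mod_kcat A) (R (succz b))) \oc w.
have [|G GE] := ex_map_from_stalk (f := f0) (@stalkP _ _ _ _).
  exact: is_zero_to.
have := projective_deq_homotopic (mod_abelian (A := A))
  (stalk_projective (vertex_projective (Pe x))) (h (dof G)).
move/homotopic0P => [k kE].
have E : G (succz b) = cdiff R b \oc k b by rewrite kE kcompf0 addr0.
move: nv; rewrite -fE -(rhom_idE (e x)) -wu rhom_compE.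
rewrite -[rhom_val f _](rhom_compE f w) -/f0 -GE E rhom_compE => /negP; apply.
exact: rR.
Qed.

(** Some vertex projective maps by [f] onto the simple quotient of the first term by [U], and
    projectivity of that term lifts the quotient map to [g] with q f g = q. If [g] were zero in D^b
    it would factor through the differential; as homomorphisms preserve the radical, f g would have
    image in [U], and [q] would be 0. *)
Lemma radical_bottom_hom (R : bcx (mod_kcat A)) r : proj_complex R ->
  radical_complex R -> ~ is_zero (R r) -> is_zero (R (r - 1)) ->
  exists y, ~ hom0 R (stalk r (P y : mod_kcat A)).
Proof.
move=> pR rR; elim/succz_ind: r => b nR; rewrite sub1_succz => zR.
have [U mU] := ex_maximal_submodule nR; have [sU nU maxU] := mU.
have [y [v nv]] := vertex_component nU; exists y => h.
have [ee lift _ _] := Pe y.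
have [|f fE] := lift _ (ract (R (succz b)) v (arr y y)).
  by rewrite -ractM qarrow_idem.
have [Q [q [sq qU]]] := ex_quotmod sU.
pose f' : khom (P y : mod_kcat A) (R (succz b)) := f.
pose q' : khom (R (succz b)) (Q : mod_kcat A) := q.
have eqf : is_epi (q' \oc f').
  apply: mod_surj_epi => n; have [z <-] := sq n.
  pose T := (U + limg (rhom_val f))%VS.
  have sT : submodule T.
    move=> t a /memv_addP[u uU [w /memv_imgP[t' _ ->] ->]].
    rewrite ractDl -rhomP; apply: memv_add; first exact: sU.
    by apply: memv_img; apply: memvf.
  have [TU|Tf] := maxU T sT (addvSl _ _).
    case/negP: nv; rewrite -TU -fE; apply: (subvP (addvSr _ _)).
    by apply: memv_img; apply: memvf.
  have : z \in T by rewrite Tf memvf.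
  case/memv_addP => u uU [w /memv_imgP[t _ ->] ->]; exists t.
  rewrite rhom_compE; have /qU u0 := uU.
  by rewrite [in RHS]rhom_add u0 add0r.
have [g gE] := pR (succz b) _ _ _ q' eqf.
have [u [w [wu uw]]] := stalk_iso (P y : mod_kcat A) (erefl (succz b)).
have [|G GE] := ex_map_to_stalk (X := R) (f := u \oc g) (@stalkP _ _ _ _).
  exact: is_zero_from.
have := projective_deq_homotopic (mod_abelian (A := A)) pR (h (dof G)).
move/homotopic0P => [k kE].
have E : g = w \oc k (succz b) \oc cdiff R (succz b).
  rewrite -[g]kcomp1f -wu -kcompA -GE kE.
  by rewrite (stalk_diff0 _ (@stalkP _ _ _ _)) kcomp0f add0r kcompA.
apply: nU; apply/eqP; rewrite eqEsubv subvf; apply/subvP => z _; apply/qU.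
rewrite -[rhom_val q z]/(rhom_val q' z) -gE -kcompA rhom_compE; apply/qU.
rewrite E !kcompA rhom_compE; apply: radical_hom mU _; exact: rR.
Qed.

End IncidenceTest.

(** Between stalks in one degree, with projective source, a map that vanishes in D^b is already 0,
    whereas [i] is nonzero on the generator. *)
Lemma const_mod_vertex_hom (K : fieldType) (d : Order.disp_t) (D : finPOrderType d)
    (D_gt0 : (0 < #|D|)%N) (x : D) (P : rmodule (incidence_algebra K D_gt0)) (e : P)
    (i : rhom P (const_mod K D_gt0)) :
  vertex_generated x e -> rhom_val i e = cbase K x ->
  ~ hom0 (stalk 0 (P : mod_kcat _)) (stalk 0 (const_mod K D_gt0 : mod_kcat _)).
Proof.
move=> Pe ie; set A := incidence_algebra K D_gt0 : algType K.
set M := const_mod K D_gt0 : mod_kcat A => h.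
have [u [w [wu uw]]] := stalk_iso (P : mod_kcat A) (erefl 0).
have [u' [w' [wu' uw']]] := stalk_iso M (erefl 0).
pose i' : khom (P : mod_kcat A) M := i.
have [|G GE] := ex_map_from_stalk (f := u' \oc i' \oc w) (@stalkP _ _ _ _).
  exact: kcomp0f.
have := projective_deq_homotopic (mod_abelian (A := A))
  (stalk_projective (vertex_projective Pe)) (h (dof G)).
move/(stalk_homotopic0 (@stalkP _ _ _ _) (@stalkP _ _ _ _)) => G0.
have i0 : i' = 0.
  rewrite -[i']kcompf1 -wu -[i']kcomp1f -wu' -!kcompA (kcompA u') (kcompA (u' \oc _)).
  by rewrite -GE G0 kcomp0f kcompf0.
move/eqP: (cbase_neq0 K x); apply; rewrite -ie -[i]/i' i0.
exact (@rhom_zeroE _ _ P (const_mod K D_gt0) e).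
Qed.

Theorem corollary5p9 (K : closedFieldType) (d : Order.disp_t)
    (Delta : finPOrderType d) (Delta_gt0 : (0 < #|Delta|)%N) :
  hasse_connected Delta ->
  piecewise_hereditary (incidence_algebra K Delta_gt0) ->
  le_ext (strong_global_dimension (incidence_algebra K Delta_gt0)) 3.
Proof.
move=> con [H [[abH _ _ heH] [_ [F]]]].
set A := incidence_algebra K Delta_gt0 : algType K in F *.
have abA := mod_abelian (A := A).
(* A uniform bound on the lengths also excludes the value [None] of the supremum. *)
suff bd l : indecomposable_length A l -> (l <= 3)%N.
  have b3 : is_length_bound A 3 by apply/asboolP.
  rewrite /le_ext /strong_global_dimension; case: pselect => [ex|]; last by case; exists 3%N.
  by case: ex_minnP => m _; apply.
have [P hP] := dep_choice (ex_proj_mod K Delta_gt0).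
have [e he] := dep_choice hP; have [i hi] := dep_choice he.
have Pe x : vertex_generated x (e x) by case: (hi x).
pose M := const_mod K Delta_gt0 : mod_kcat A.
have degree X : idem_trivial X -> exists p, in_degree p (te_ob F X).
  by move/(te_idem_trivial (F := F))/(idem_trivial_concentrated abH heH).
have [m hm] : exists m, in_degree m (te_ob F (stalk 0 M)).
  apply: degree; apply: (stalk_idem_trivial abA) => f.
  exact: const_mod_end f con.
have /choice [p hp] : forall x, exists p, in_degree p (te_ob F (stalk 0 (P x : mod_kcat A))).
  move=> x; apply: degree; apply: (stalk_idem_trivial abA) => f.
  exact: vertex_scalar_end f (Pe x).
have near_m x : p x = m \/ p x = m + 1.
  apply: (in_degree_hom abH heH (hp x) hm) => /te_hom0.
  by apply: const_mod_vertex_hom (Pe x) _; case: (hi x) => + _ _ _ _; apply.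
move=> [Q [pQ iQ [R [r [s [[pR rR QR] [nr ns zR sl]]]]]]].
(* Indecomposability is given for [Q] and passes to its radical representative [R] through an
   isomorphism in D^b. *)
have [n hn] : exists n, in_degree n (te_ob F R).
  apply: degree; apply: idem_trivial_diso (Kb_isomorphic_diso QR) _.
  exact: Kb_idem_trivial.
have [x hx] : exists x, ~ hom0 (stalk s (P x : mod_kcat A)) R.
  apply: (radical_top_hom Pe rR ns); apply: zR; apply/orP; right; slia.
have [y hy] : exists y, ~ hom0 R (stalk r (P y : mod_kcat A)).
  apply: (radical_bottom_hom Pe pR rR nr); apply: zR; apply/orP; left; slia.
have Dx := te_in_degree_stalk abH (hp x) s.
have Dy := te_in_degree_stalk abH (hp y) r.
have := in_degree_hom abH heH Dx hn (fun h => hx (te_hom0 h)).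
have := in_degree_hom abH heH hn Dy (fun h => hy (te_hom0 h)).
have := near_m x; have := near_m y; lia.
Qed.
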